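(* Let $A=(a_{i,j})_{1\le i<j\le n}$ be a collection of integers satisfying (a) $a_{i,i+1}+a_{i+1,i+2}\le a_{i,i+2}$ for $1\le i\le n-2$ and (b) $a_{i,j}+a_{i+1,j+1}\le a_{i,j+1}+a_{i+1,j}$ for $1\le i<j-1\le n-2$, and let $S=\sigma(A)$. Let $\lambda$ be an integral dominant regular weight of $\mathfrak{sl}_n(\mathbb C)$. Let $E_\lambda\subset\mathbb P(L_\lambda^S)$ be the image of $\mathbb C^{\{1\le i<j\le n\}}$ under the map $c\mapsto\exp(c)\mathbf v_\lambda^S$, where $\exp(c)=\prod_{i,j}\exp(c_{i,j}\varphi_{i,j})$ with the factors ordered by $i$ increasing from left to right, and $\mathbf v_\lambda^S\in\mathbb P(L_\lambda^S)$ is the point corresponding to the line $\mathbb C v_\lambda^S$. Then the Zariski closure of $E_\lambda$ is the degenerate flag variety $F^S$. Moreover, this embedding of $F^S$ into $\mathbb P(L_\lambda^S)$ coincides with the Segre-type embedding $F^S\subset\mathbb P(L_\lambda^S)$ described in the context.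
   Context: Fix $n\ge2$ and $\mathfrak g=\mathfrak{sl}_n(\mathbb C)$ with Cartan subalgebra $\mathfrak h$, simple roots $\alpha_1,\dots,\alpha_{n-1}$ and fundamental weights $\omega_1,\dots,\omega_{n-1}$; $(a_1,\dots,a_{n-1})$ denotes the weight $\sum a_k\omega_k$; it is regular if all $a_k>0$. The subalgebra $\mathfrak n_-$ is spanned by negative root vectors $f_{i,j}$, $1\le i<j\le n$, of weight $-\alpha_{i,j}=-(\alpha_i+\dots+\alpha_{j-1})$ ($f_{i,j}e_i=e_j$ in the tautological representation $V=\mathbb C^n$ with basis $e_1,\dots,e_n$). $L_\lambda$ is the irreducible representation with highest weight $\lambda$ and highest weight vector $v_\lambda$; $L_{\omega_k}=\wedge^kV$ has basis $e_{i_1,\dots,i_k}=e_{i_1}\wedge\dots\wedge e_{i_k}$ ($i_1<\dots<i_k$), and $v_{\omega_k}=e_{1,\dots,k}$. Plücker setting. $\mathbb P=\mathbb P(L_{\omega_1})\times\dots\times\mathbb P(L_{\omega_{n-1}})$ has homogeneous coordinate ring $R=\mathbb C[\{X_{i_1,\dots,i_k}\}]$ ($1\le k\le n-1$, $1\le i_1<\dots<i_k\le n$), with $X_{i_1,\dots,i_k}$ the coordinate corresponding to $e_{i_1,\dots,i_k}$. $F=SL_n/B\subset\mathbb P$ is the variety of complete flags in the Plücker embedding, and $I\subset R$ is its (multihomogeneous) ideal of Plücker relations. For a collection of integers $S=(s_{i_1,\dots,i_k})$, $\mathrm{grad}^S$ is the $\mathbb Z$-grading on $R$ with $\mathrm{grad}^SX_{i_1,\dots,i_k}=s_{i_1,\dots,i_k}$,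 $\mathrm{in}_{\mathrm{grad}^S}I$ is the ideal spanned by the nonzero components of minimal grading of elements of $I$, and $F^S\subset\mathbb P$ is the subvariety defined by $\mathrm{in}_{\mathrm{grad}^S}I$. Definition of $\sigma$: $\Theta=\mathbb R^{\{1\le i<j\le n\}}$; $T(i_1,\dots,i_k)\in\Theta$ has coordinate $1$ at each pair $(l,i_l)$ with $1\le l\le k$, $i_l>l$, and all other coordinates $0$. $\sigma(A)_{i_1,\dots,i_k}=\sum_{i<j}a_{i,j}T(i_1,\dots,i_k)_{i,j}$. Degenerate representation. For $\lambda=(a_1,\dots,a_{n-1})$ let $U_\lambda=L_{\omega_1}^{\otimes a_1}\otimes\dots\otimes L_{\omega_{n-1}}^{\otimes a_{n-1}}$; $L_\lambda\subset U_\lambda$ is the subrepresentation generated by $v_{\omega_1}^{\otimes a_1}\otimes\dots\otimes v_{\omega_{n-1}}^{\otimes a_{n-1}}=v_\lambda$. Setting $\mathrm{grad}^Se_{i_1,\dots,i_k}=s_{i_1,\dots,i_k}$ grades $U_\lambda$; $(U_\lambda)_{\le m}$ is spanned by homogeneous elements of degree $\le m$, $(L_\lambda)_m=L_\lambda\cap(U_\lambda)_{\le m}$, and $L_\lambda^S=\bigoplus_m(L_\lambda)_m/(L_\lambda)_{m-1}$. Since the associated graded space of $U_\lambda$ is $U_\lambda$ itself, $L_\lambda^S$ is naturally a subspace of $U_\lambda$. $v_\lambda^S$ is the image of $v_\lambda\in(L_\lambda)_0$ in $(L_\lambda^S)_0$. Action. $\Phi_n$ is the associative algebra generated by $\varphi_{i,j}$,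 $1\le i<j\le n$, with relations $\varphi_{i_1,j_1}\varphi_{i_2,j_2}=0$ whenever $i_1>i_2$ and $\varphi_{i,j_1}\varphi_{i,j_2}=\varphi_{i,j_2}\varphi_{i,j_1}$. Let $L_\lambda(k)$ be the sum of weight subspaces of $L_\lambda$ of weights $\mu$ such that $\mu-\lambda$ is a nonnegative combination of $-\alpha_i$, $i\ge k$. $\Phi_n$ acts on $L_\lambda$: for a weight vector $v$, $\varphi_{i,j}v=f_{i,j}v$ if $v\in L_\lambda(i)$ and $\varphi_{i,j}v=0$ otherwise. With $S=\sigma(A)$ as in the claim, $\varphi_{i,j}$ maps $(L_\lambda)_m$ into $(L_\lambda)_{m+a_{i,j}}$, so it induces maps $(L_\lambda^S)_m\to(L_\lambda^S)_{m+a_{i,j}}$ on the associated graded components; this defines a $\Phi_n$-module structure on $L_\lambda^S$, in which each $\varphi_{i,j}$ acts nilpotently, so exponentials make sense; they act by invertible operators and hence also on $\mathbb P(L_\lambda^S)$. Segre-type embedding: for regular $\lambda$, embed each $\mathbb P(L_{\omega_k})$ diagonally into $\mathbb P(L_{\omega_k})^{a_k}$ and compose with the Segre embedding $\prod_k\mathbb P(L_{\omega_k})^{a_k}\subset\mathbb P(U_\lambda)$. This gives $F^S\subset\mathbb P\subset\mathbb P(U_\lambda)$, and the image of $F^S$ is contained in $\mathbb P(L_\lambda^S)\subset\mathbb P(U_\lambda)$, giving an embedding $F^S\subset\mathbb P(L_\lambda^S)$. *)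

(* Defs.v *)
(* All indices are shifted by one: 'I_n stands for {1, ..., n} and 'I_n.-1 for
   {1, ..., n-1}, so that k : 'I_n.-1 stands for the fundamental weight
   omega_(k+1), and L_(omega_(k+1)) is the (k+1)-st exterior power. *)
From HB Require Import structures.
From mathcomp Require Import all_boot all_order all_algebra.
From mathcomp Require Import boolp classical_sets reals.
From mathcomp Require Import complex mpoly.

Set Implicit Arguments.
Unset Strict Implicit.
Unset Printing Implicit Defensive.

Import Order.TTheory GRing.Theory Num.Theory.
Local Open Scope ring_scope.
Local Open Scope classical_set_scope.

Definition proj (K : fieldType) (W : vectType K) : Type :=
  {l : {vspace W} | \dim l == 1%N}.

Lemma line_dim (K : fieldType) (W : vectType K) (v : W) :
  v != 0 -> \dim <[v]> == 1%N.
Proof. by move=> v0; rewrite dim_vline v0. Qed.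

Definition line (K : fieldType) (W : vectType K) (v : W) (v0 : v != 0) :
  proj W := exist _ <[v]>%VS (line_dim v0).

Definition proj_rep (K : fieldType) (W : vectType K) (x : proj W) : W :=
  vpick (val x).

Lemma proj_rep_neq0 (K : fieldType) (W : vectType K) (x : proj W) :
  proj_rep x != 0.
Proof. by rewrite vpick0 -dimv_eq0 (eqP (valP x)). Qed.

Lemma proj_sub_dim (K : fieldType) (W : vectType K) (V : {vspace W})
  (x : proj (subvs_of V)) :
  \dim (linfun (vsval : subvs_of V -> W) @: val x) == 1%N.
Proof.
rewrite limg_dim_eq ?(eqP (valP x)) //; apply/eqP; rewrite -subv0.
apply/subvP => u; rewrite memv_cap memv_ker lfunE => /andP[_ /= u0].
by rewrite memv0 -(inj_eq val_inj).
Qed.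

Definition proj_incl (K : fieldType) (W : vectType K) (V : {vspace W})
  (x : proj (subvs_of V)) : proj W :=
  exist _ (linfun (vsval : subvs_of V -> W) @: val x)%VS (proj_sub_dim x).

(* the coordinates on W are those of the basis [vbasis fullv] *)
Definition vanishes_at (K : fieldType) (W : vectType K)
  (p : {mpoly K[\dim {:W}]}) (x : proj W) : Prop :=
  forall v : W, v \in val x -> v != 0 ->
    p.@[fun i => coord (vbasis {:W}) i v] = 0.

Definition zariski_closed (K : fieldType) (W : vectType K)
  (Z : set (proj W)) : Prop :=
  exists T : set {mpoly K[\dim {:W}]},
    (forall p, T p -> exists d : nat, p \is d.-homog) /\
    Z = [set x | forall p, T p -> vanishes_at p x].

Definition zariski_closure (K : fieldType) (W : vectType K)
  (E : set (proj W)) : set (proj W) :=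
  smallest (@zariski_closed K W) E.

Section Cyclic.
Variables (K : fieldType) (W : vectType K) (ops : set 'End(W)) (v : W).

Definition is_subrep (V : {vspace W}) : Prop :=
  forall f, ops f -> (f @: V <= V)%VS.

Definition is_cyclic_subrep (V : {vspace W}) : Prop :=
  [/\ v \in V, is_subrep V &
      forall V' : {vspace W}, v \in V' -> is_subrep V' -> (V <= V')%VS].

Definition cyclic_subrep : {vspace W} := xget 0%VS [set V | is_cyclic_subrep V].

Lemma cyclic_subrepP : is_cyclic_subrep cyclic_subrep.
Proof.
pose P d := `[< exists V : {vspace W}, [/\ v \in V, is_subrep V & \dim V = d] >].
have exP : exists d, P d.
  exists (\dim {:W}); apply/asboolP; exists fullv.
  by split=> //; [exact: memvf | move=> f _; exact: subvf].
have [d /asboolP[V [vV sV dV]] dmin] := ex_minnP exP.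
apply: (@xgetPex _ 0%VS [set V | is_cyclic_subrep V]).
exists V; split=> // V' vV' sV'.
have sI : is_subrep (V :&: V').
  move=> f opf; rewrite subv_cap.
  rewrite (subv_trans (limgS f (capvSl V V')) (sV f opf)).
  by rewrite (subv_trans (limgS f (capvSr V V')) (sV' f opf)).
have /dmin : P (\dim (V :&: V')).
  by apply/asboolP; exists (V :&: V')%VS; split=> //; rewrite memv_cap vV vV'.
rewrite -dV => le_d.
have /eqP <- : (V :&: V' == V)%VS by rewrite eqEdim capvSl le_d.
exact: capvSr.
Qed.

End Cyclic.

(* i_1 < ... < i_k *)
Definition incr (n k : nat) : finType :=
  {t : k.-tuple 'I_n | sorted ltn [seq val i | i <- t]}.

(* the exterior power of K^n, in coordinates with respect to the basis e_t *)
Notation ext K n k := {ffun incr n k -> K^o}.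

Section Ext.
Variables (K : fieldType) (n k : nat).

(* the wedge product of the columns of M: its coordinates are the minors *)
Definition wedge (M : 'M[K]_(n, k)) : ext K n k :=
  [ffun t : incr n k => \det (\matrix_(a < k, b < k) M (tnth (val t) a) b)].

Definition ext_basis (t : incr n k) : ext K n k :=
  [ffun t' => (t' == t)%:R].

(* x . (e_(i_1) ^ ... ^ e_(i_k)) is the sum over l of the wedge products in
   which e_(i_l) is replaced by x e_(i_l), which is column i_l of x *)
Definition ext_act_basis (x : 'M[K]_n) (t : incr n k) : ext K n k :=
  \sum_(l < k) wedge (\matrix_(i < n, b < k)
    if b == l then x i (tnth (val t) b) else (i == tnth (val t) b)%:R).

(* the highest weight vector e_(1, ..., k) *)
Definition ext_hw : ext K n k :=
  [ffun t : incr n k => ([seq val i | i <- val t] == iota 0 k)%:R].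

End Ext.

Section Flags.
Variables (K : fieldType) (n : nat).

Notation multiproj := (forall k : 'I_n.-1, proj (ext K n k.+1)).

(* [g *m pid_mx k] consists of the first k columns of g *)
Definition flag_variety : set multiproj :=
  [set x | exists2 g : 'M[K]_n, \det g = 1 &
     forall k : 'I_n.-1, val (x k) =
       <[wedge (g *m (pid_mx k.+1 : 'M[K]_(n, k.+1)))]>%VS].

Definition plu : finType := {k : 'I_n.-1 & incr n k.+1}.

Notation pluring := {mpoly K[#|plu|]}.

Definition plu_eval (p : pluring) (v : forall k : 'I_n.-1, ext K n k.+1) : K :=
  p.@[fun a => v (tag (enum_val a)) (tagged (enum_val a))].

Definition multi_vanishes_at (p : pluring) (x : multiproj) : Prop :=
  forall v : forall k : 'I_n.-1, ext K n k.+1,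
    (forall k, v k \in val (x k) /\ v k != 0) -> plu_eval p v = 0.

(* the ideal of F: all relations between the Plücker coordinates of flags *)
Definition plucker_ideal : set pluring :=
  [set p | forall x, flag_variety x -> multi_vanishes_at p x].

Variable S : forall k : 'I_n.-1, incr n k.+1 -> int.

Definition grad_mon (m : 'X_{1..#|plu|}) : int :=
  \sum_(a < #|plu|) (m a)%:Z * S (tagged (enum_val a)).

Definition grad_comp (d : int) (p : pluring) : pluring :=
  \sum_(m <- msupp p | grad_mon m == d) p@_m *: 'X_[m].

Definition is_initial_part (p q : pluring) : Prop :=
  exists d : int, [/\ q = grad_comp d p, q != 0 &
                      forall d' : int, d' < d -> grad_comp d' p = 0].

Definition initial_ideal (I : set pluring) : set pluring :=
  [set q | exists2 s : seq (K * pluring),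
     (forall r, r \in s -> exists2 p, I p & is_initial_part p r.2) &
     q = \sum_(r <- s) r.1 *: r.2].

Definition degenerate_flag_variety : set multiproj :=
  [set x | forall q, initial_ideal plucker_ideal q -> multi_vanishes_at q x].

End Flags.

Section Sigma.
Variables (n k : nat).

(* coordinate 1 at each (l, i_l) with i_l > l *)
Definition Tvec (t : incr n k) (l i : 'I_n) : int :=
  [&& (l < i)%N, i \in val t & index i (val t) == l]%:R.

Definition sigma (A : 'I_n -> 'I_n -> int) (t : incr n k) : int :=
  \sum_(i < n) \sum_(j < n | (i < j)%N) A i j * Tvec t i j.

End Sigma.

Section Rep.
Variables (K : fieldType) (n : nat).
(* lambda is the sum of the [la k] omega_(k+1) *)
Variable la : 'I_n.-1 -> nat.

Definition pos : finType := {k : 'I_n.-1 & 'I_(la k)}.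

Definition tbasis : finType := {dffun forall p : pos, incr n (tag p).+1}.

(* U_lambda, in coordinates with respect to the products of the e_t *)
Notation U := {ffun tbasis -> K^o}.

Definition tens (w : forall p : pos, ext K n (tag p).+1) : U :=
  [ffun b : tbasis => \prod_(p : pos) (w p (b p) : K)].

Definition tens_basis (b : tbasis) : U := [ffun b' => (b' == b)%:R].

(* the Leibniz rule on the basis, extended linearly *)
Definition act (x : 'M[K]_n) : 'End(U) :=
  linfun (fun u : U => \sum_(b : tbasis) (u b : K) *:
    \sum_(p : pos) tens (fun q => if q == p then ext_act_basis x (b q)
                                  else ext_basis K (b q))).

Definition f_op (i j : 'I_n) : 'End(U) := act (delta_mx j i).

Definition vla : U := tens (fun p => ext_hw K n (tag p).+1).

Definition Lla : {vspace U} :=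
  cyclic_subrep [set act x | x in [set x : 'M[K]_n | \tr x = 0]] vla.

Definition coroot (k : 'I_n.-1) : 'M[K]_n :=
  diag_mx (\row_(i < n) ((i == k :> nat)%:R - (i == k.+1 :> nat)%:R)).

(* a weight is given by its values on the coroots, i.e. by its coordinates
   in the basis of fundamental weights *)
Definition weight_space (mu : 'I_n.-1 -> int) : {vspace U} :=
  (Lla :&: \bigcap_(k < n.-1) passmx.leigenspace (act (coroot k)) (mu k)%:~R)%VS.

Definition simple_root (l : 'I_n.-1) (k : 'I_n.-1) : int :=
  if l == k then 2
  else if (l == k.+1 :> nat) || (k == l.+1 :> nat) then -1 else 0.

(* mu - lambda is a nonnegative combination of the -alpha_l with l >= i *)
Definition below (i : 'I_n) (mu : 'I_n.-1 -> int) : Prop :=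
  exists m : 'I_n.-1 -> nat,
    (forall l : 'I_n.-1, (l < i)%N -> m l = 0%N) /\
    (forall k, mu k - (la k)%:Z = \sum_(l < n.-1) (m l)%:Z * - simple_root l k).

(* every weight of U_lambda is the weight of some basis tensor *)
Definition basis_weight (b : tbasis) (k : 'I_n.-1) : int :=
  \sum_(p : pos) \sum_(i <- val (b p))
    ((i == k :> nat)%:R - (i == k.+1 :> nat)%:R).

(* L_lambda(i), and the sum of the remaining weight subspaces *)
Definition Lbelow (i : 'I_n) : {vspace U} :=
  (\sum_(b : tbasis | `[< below i (basis_weight b) >])
     weight_space (basis_weight b))%VS.

Definition Lnotbelow (i : 'I_n) : {vspace U} :=
  (\sum_(b : tbasis | ~~ `[< below i (basis_weight b) >])
     weight_space (basis_weight b))%VS.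

(* meaningful on L_lambda, where it is f_(i,j) composed with the projection
   onto L_lambda(i) along the other weight subspaces *)
Definition phi (i j : 'I_n) : 'End(U) :=
  (f_op i j \o daddv_pi (Lbelow i) (Lnotbelow i))%VF.

Variable S : forall k : 'I_n.-1, incr n k.+1 -> int.

Definition tdeg (b : tbasis) : int := \sum_(p : pos) S (b p).

Definition tdegs : seq int := undup [seq tdeg b | b : tbasis].

(* (U_lambda)_(<= m) *)
Definition Ufil (m : int) : {vspace U} :=
  (\sum_(b : tbasis | (tdeg b <= m)%R) <[tens_basis b]>)%VS.

(* (L_lambda)_m *)
Definition Lfil (m : int) : {vspace U} := (Lla :&: Ufil m)%VS.

(* the projection of U_lambda onto its component of degree m *)
Definition tcomp (m : int) : 'End(U) :=
  linfun (fun u : U => [ffun b => if tdeg b == m then u b else 0] : U).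

(* the associated graded space of L_lambda, as a subspace of U_lambda:
   [tcomp m] has kernel (L_lambda)_(m-1) on (L_lambda)_m *)
Definition LS : {vspace U} := (\sum_(m <- tdegs) (tcomp m @: Lfil m))%VS.

(* a linear section of the quotient map from (L_lambda)_m to its image in LS *)
Definition lift (m : int) : 'End(U) :=
  let incl := linfun (vsval : subvs_of (Lfil m) -> U) in
  (incl \o (tcomp m \o incl)^-1)%VF.

(* the map of degree a induced on LS by an operator g with
   g (L_lambda)_m <= (L_lambda)_(m + a) for all m; it is then independent
   of the section *)
Definition gr_op (a : int) (g : 'End(U)) : 'End(subvs_of LS) :=
  (linfun (vsproj LS) \o
   (\sum_(m <- tdegs) (tcomp (m + a) \o g \o lift m \o tcomp m)) \o
   linfun (vsval : subvs_of LS -> U))%VF.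

Definition vlaS : subvs_of LS := vsproj LS (tcomp 0 vla).

(* the exponential of a nilpotent operator: the powers beyond \dim {:W} vanish *)
Definition lexp (W : vectType K) (g : 'End(W)) (w : W) : W :=
  \sum_(m < (\dim {:W}).+1) (m`!%:R)^-1 *: iter m g w.

(* the factors are in lexicographic order; those with equal i commute *)
Definition exp_action (A : 'I_n -> 'I_n -> int) (c : 'I_n -> 'I_n -> K)
  (w : subvs_of LS) : subvs_of LS :=
  foldr (fun ij => lexp (c ij.1 ij.2 *: gr_op (A ij.1 ij.2) (phi ij.1 ij.2))) w
    [seq ij : 'I_n * 'I_n <- [seq (i, j) | i <- enum 'I_n, j <- enum 'I_n]
       | (ij.1 < ij.2)%N].

Definition Ela (A : 'I_n -> 'I_n -> int) : set (proj (subvs_of LS)) :=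
  [set x | exists c : 'I_n -> 'I_n -> K, val x = <[exp_action A c vlaS]>%VS].

Lemma tens_neq0 (w : forall p : pos, ext K n (tag p).+1) :
  (forall p, w p != 0) -> tens w != 0.
Proof.
move=> w0.
have wP p : {t | w p t != 0}.
  apply: cid; apply: contrapT => /forallNP H; move/eqP: (w0 p); apply.
  by apply/ffunP => t; rewrite ffunE; apply/eqP/negPn/negP; apply: H.
pose b : tbasis := [ffun p => sval (wP p)].
apply/eqP => /ffunP/(_ b); rewrite !ffunE => /eqP; apply/negP.
by apply/prodf_neq0 => p _; rewrite ffunE; exact: svalP (wP p).
Qed.

Definition segre (x : forall k : 'I_n.-1, proj (ext K n k.+1)) : proj U :=
  line (tens_neq0 (fun p : pos => proj_rep_neq0 (x (tag p)))).

End Rep.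

(* Main.v *)
(* Write O(c) for the family (exp(c) v_(omega_k))_k. Conditions (a) and (b) say
   that A, extended by zero, is a Monge array, so that the action of f_(i,j) on
   an exterior power never raises the degree sigma(A) by more than a_(i,j) and
   the action of phi_(i,j) is the limit at s = 0 of rescaled actions of f_(i,j).
   For s <> 0 the rescaled orbit consists of torus translates of flags of
   unitriangular matrices; letting s tend to 0, the initial parts of the
   Plücker relations vanish on all O(c), i.e. the orbit lies in F^S.
   Conversely, a multihomogeneous form which vanishes on the orbit vanishes on
   F^S. By the Garnir relations, standard monomials span all monomials modulo
   the Plücker relations, and they remain linearly independent on the orbit, as
   is seen by giving the c_(i,j) weights for which every coordinate of O(c)
   has a monomial as its term of lowest weight and distinct standard monomials
   have distinct lowest weights. A dimension count then shows that the initial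
   parts of the relations are all the forms vanishing on the orbit.
   Since the induced action of phi_(i,j) on L_lambda^S is the Leibniz rule,
   exp(c) v_lambda^S is the tensor product of the vectors of O(c), so E_lambda
   is the Segre image of the orbit. Finally, a point at which all the equations
   of E_lambda hold satisfies the quadratic equations of the Segre variety,
   hence is the image of a multiprojective point, on which every form vanishing
   on the orbit vanishes. *)
Require Import Defs.
From HB Require Import structures.
From mathcomp Require Import all_boot all_order all_algebra fingroup perm.
From mathcomp Require Import boolp classical_sets reals.
From mathcomp Require Import complex mpoly.
From mathcomp Require Import zify ring.

Set Implicit Arguments.
Unset Strict Implicit.
Unset Printing Implicit Defensive.

Import Order.TTheory GRing.Theory Num.Theory.
Local Open Scope ring_scope.

(** * Minors *)

(** The Monge inequality for the zero extension of [A] is available only on rectangles whose cells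
    lie on or above the diagonal. The rearrangement is therefore confined to assignments giving row
    [a] an entry at least [a]; triangularity of the matrices kills every other term of a minor. The
    limit at s = 0 involves no topology: the orbit coordinates are polynomials in s, and a
    polynomial identity valid for all nonzero s holds at 0, the field being infinite. Forms are
    treated as functions of a matrix or of a family of vectors and expanded over tableaux of one
    fixed shape, so that each multidegree lives in a finite-dimensional space where dimensions can
    be compared. Elements of the Plücker ideal need not be multihomogeneous, hence the free scalars
    on the factors. In the coordinates of [LS] only forms whose multidegree is a multiple of lambda
    are visible; regularity of lambda allows any form to be raised to such a multidegree by
    coordinates that equal 1 at the limit point. *)

Section Incr.
Variables n k : nat.
Implicit Types t : incr n k.

Lemma incr_lt t (a b : 'I_k) :
  (a < b)%N -> (tnth (val t) a < tnth (val t) b)%N.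
Proof.
move=> ab; have x0 : 'I_n by exact: (tnth (val t) a).
have := sorted_ltn_nth ltn_trans 0%N (valP t) => /(_ a b).
rewrite !inE size_map size_tuple !ltn_ord => /(_ isT isT ab).
by rewrite !(nth_map x0) ?size_tuple ?ltn_ord // -!tnth_nth.
Qed.

Lemma incr_inj t : injective (tnth (val t)).
Proof.
move=> a b e; apply: ord_inj; apply/eqP; rewrite eqn_leq; case: ltngtP => // /(incr_lt t).
all: by rewrite e ltnn.
Qed.

Lemma incr_ge t (a : 'I_k) : (a <= tnth (val t) a)%N.
Proof.
case: a => a; elim: a => [//|a IH] ha /=.
have ha' : (a < k)%N by exact: ltn_trans ha.
apply: leq_ltn_trans (IH ha') _; exact: incr_lt.
Qed.

Lemma incr_eq t t' : {subset val t <= val t'} -> t = t'.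
Proof.
move=> sub; apply: val_inj; apply: val_inj; apply: (inj_map val_inj).
apply: (irr_sorted_eq ltn_trans ltnn (valP t) (valP t')).
have u t0 : uniq (val t0) by rewrite -(map_inj_uniq val_inj); exact: sorted_uniq ltn_trans ltnn _ (valP t0).
have [_ e] := uniq_min_size (u t) sub (eq_leq (etrans (size_tuple _) (esym (size_tuple _)))).
by move=> x; apply/mapP/mapP => -[y yt ->]; exists y; rewrite // -?e // e.
Qed.

Lemma incr_perm_eq t t' (s s' : 'S_k) :
  (forall a, tnth (val t) (s a) = tnth (val t') (s' a)) -> t = t' /\ s = s'.
Proof.
move=> e; have tt : t = t'.
  apply: incr_eq => x /tnthP[a ->]; rewrite -(permKV s a) e; exact: mem_tnth.
split=> //; apply/permP => a; move: (e a); rewrite tt; exact: incr_inj.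
Qed.

Lemma incr_sort (g : 'I_k -> 'I_n) : injective g ->
  exists t, exists s : 'S_k, forall a, g a = tnth (val t) (s a).
Proof.
move=> gi; pose T := [set g a | a in 'I_k]%SET.
have sT : size (enum T) == k by rewrite -cardE card_imset // card_ord.
have srt : sorted ltn [seq val i | i <- Tuple sT].
  apply: (@subseq_sorted _ ltn ltn_trans _ (iota 0 n)); last exact: iota_ltn_sorted.
  rewrite /= -(val_enum_ord n); apply: map_subseq.
  have -> : enum T = filter (mem T) (enum 'I_n) by rewrite [enum 'I_n]enumT.
  exact: filter_subseq.
pose t : incr n k := exist _ (Tuple sT) srt.
have ix a : (index (g a) (enum T) < k)%N.
  by rewrite -[X in (_ < X)%N](eqP sT) index_mem mem_enum; apply: imset_f.
pose f a := Ordinal (ix a).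
have tf a : tnth (val t) (f a) = g a.
  by rewrite (tnth_nth (g a)) /= nth_index // mem_enum; apply: imset_f.
have fi : injective f by move=> a b e; apply: gi; rewrite -!tf e.
by exists t, (perm fi) => a; rewrite permE tf.
Qed.

End Incr.

Section Minors.
Variables (K : fieldType) (n k : nat).
Implicit Types (t : incr n k) (M : 'M[K]_(n, k)).

Lemma wedgeE M t : wedge M t = \det (rowsub (tnth (val t)) M).
Proof. by rewrite ffunE; congr (\det _); apply/matrixP=> a b; rewrite !mxE. Qed.

Lemma det_rowsub_alt (g : 'I_k -> 'I_n) M a b :
  a != b -> g a = g b -> \det (rowsub g M) = 0.
Proof.
move=> ab e; apply: (determinant_alternate ab) => c; by rewrite !mxE e.
Qed.

Lemma det_rowsub_noninj (g : 'I_k -> 'I_n) M :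
  ~~ injectiveb g -> \det (rowsub g M) = 0.
Proof.
by case/injectivePn=> a [b ab e]; exact: det_rowsub_alt ab e.
Qed.

Lemma det_rowsub_perm (g h : 'I_k -> 'I_n) (s : 'S_k) M :
  (forall a, h a = g (s a)) ->
  \det (rowsub h M) = (-1) ^+ s * \det (rowsub g M).
Proof.
move=> e; rewrite -det_perm -det_mulmx -row_permE.
by congr (\det _); apply/matrixP=> a b; rewrite !mxE e.
Qed.

Lemma cauchy_binet (A : 'M[K]_(k, n)) (B : 'M[K]_(n, k)) :
  \det (A *m B) = \sum_(t : incr n k)
     \det (colsub (tnth (val t)) A) * \det (rowsub (tnth (val t)) B).
Proof.
have -> : \det (A *m B) =
    \sum_(g : {ffun 'I_k -> 'I_n}) (\prod_a A a (g a)) * \det (rowsub g B).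
  rewrite /determinant.
  under eq_bigr => s _.
    under eq_bigr => a _ do rewrite mxE.
    rewrite bigA_distr_bigA /= mulr_sumr.
    over.
  rewrite exchange_big; apply: eq_bigr => g _; rewrite mulr_sumr.
  apply: eq_bigr => s _; rewrite big_split /= mulrCA.
  by congr (_ * (_ * _)); apply: eq_bigr => a _; rewrite mxE.
rewrite (bigID (fun g : {ffun 'I_k -> 'I_n} => injectiveb g)) /= addrC big1 ?add0r; last first.
  by move=> g gi; rewrite det_rowsub_noninj ?mulr0.
(* Only injective row choices contribute, and each is uniquely an increasing sequence composed with
   a permutation. *)
pose h (x : incr n k * 'S_k) := [ffun a => tnth (val x.1) (x.2 a)].
have hi : injective h.
  move=> [t s] [t' s'] /ffunP e.
  by have [|/= -> ->] := @incr_perm_eq _ _ t t' s s' => // a; have := e a; rewrite !ffunE.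
transitivity (\sum_(g in [set h x | x in predT]%SET) (\prod_a A a (g a)) * \det (rowsub g B)).
  apply: eq_bigl => g; apply/injectiveP/imsetP => [gi|[[t s] _ ->] a b].
    have [t [s e]] := incr_sort gi; exists (t, s) => //.
    by apply/ffunP=> a; rewrite ffunE e.
  by rewrite !ffunE => /incr_inj /perm_inj.
rewrite big_imset /=; last by move=> x y _ _; exact: hi.
rewrite -(pair_bigA _ (fun t s => (\prod_a A a (h (t, s) a)) * \det (rowsub (h (t, s)) B))) /=.
apply: eq_bigr => t _; rewrite [X in _ = X * _]/determinant mulr_suml.
apply: eq_bigr => s _.
rewrite (@det_rowsub_perm (tnth (val t)) (h (t, s)) s) => [|a]; last by rewrite ffunE.
rewrite mulrCA mulrA; congr (_ * _ * _); apply: eq_bigr => a _; by rewrite mxE ffunE.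
Qed.

End Minors.

(** * Monge costs *)

Section Rearrangement.
Variables (k : nat) (D : 'I_k -> 'I_k -> Prop) (c : 'I_k -> 'I_k -> int) (e : int).
Hypothesis e0 : 0 <= e.
Hypothesis Dl : forall r l x : 'I_k, (r < l)%N -> D l x -> D r x.
Hypothesis Dr : forall l x y : 'I_k, (x < y)%N -> D l x -> D l y.
Hypothesis monge : forall r l x y : 'I_k, (r < l)%N -> (x < y)%N -> D l x ->
  c r x + c l y + e <= c r y + c l x.

(** Columns are put in place from the largest down. By the Monge inequality, the transposition that
    brings [M] onto the diagonal saves at least [e]. [D] marks the cells where the inequality is
    available. The slack [e] is 0 for the costs of [sigma] and 1 for the strictly Monge weights used
    for independence. *)
Lemma rearrangement (s : 'S_k) : (forall a, D a (s a)) ->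
  \sum_a c a a + (s != 1%g)%:R * e <= \sum_a c a (s a).
Proof.
suff gen m : (m <= k)%N -> forall s : 'S_k, (forall a : 'I_k, (m <= a)%N -> s a = a) ->
    (forall a, D a (s a)) -> \sum_a c a a + (s != 1%g)%:R * e <= \sum_a c a (s a).
  by apply: (gen k) => // a; rewrite leqNgt ltn_ord.
elim: m => [_ {}s sfix _|m IH mk {}s sfix sD].
  have -> : s = 1%g by apply/permP => a; rewrite perm1 sfix.
  rewrite eqxx mul0r addr0; apply: ler_sum => a _; by rewrite perm1.
pose M := Ordinal mk; have [sM|sM] := eqVneq (s M) M.
  apply: IH => // [|a]; first exact: ltnW.
  rewrite leq_eqVlt => /orP[/eqP aM|]; last exact: sfix.
  by have -> : a = M by apply: ord_inj.
pose r := (s^-1)%g M; have sr : s r = M by rewrite permKV.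
have rM : (r < M)%N.
  rewrite ltnNge leq_eqVlt; apply/negP => /orP[/eqP/ord_inj rM|/sfix].
    by case/eqP: sM; rewrite {1}rM.
  by rewrite sr => /= rM; case/eqP: sM; rewrite {1}rM.
have xM : (s M < M)%N.
  rewrite ltnNge leq_eqVlt; apply/negP => /orP[/eqP/ord_inj e1|/sfix/perm_inj e1].
    by case/eqP: sM.
  by case/eqP: sM.
pose s' := (tperm r M * s)%g.
have s'r : s' r = s M by rewrite permM tpermL.
have s'M : s' M = M by rewrite permM tpermR.
have s'o a : a != r -> a != M -> s' a = s a.
  by move=> ar aM; rewrite permM tpermD // eq_sym.
have nrM : r != M by apply: contraTneq rM => ->; rewrite ltnn.
(* A single exchange accounts for the whole slack, so the slack in the induction hypothesis is
   dropped. *)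
have le1 : \sum_a c a a <= \sum_a c a (s' a).
  apply: le_trans (IH (ltnW mk) s' _ _).
  - by rewrite lerDl mulr_ge0.
  - move=> a; rewrite leq_eqVlt => /orP[/eqP aM|ma].
      by have -> : a = M by apply: ord_inj.
    rewrite s'o ?sfix //; apply: contraTneq ma => ->; rewrite ?ltnn //.
    by rewrite -leqNgt ltnW.
  - move=> a; have [->|ar] := eqVneq a r; first by rewrite s'r; apply: Dl (sD M).
    have [->|aM] := eqVneq a M; first by rewrite s'M; apply: Dr (sD M).
    by rewrite s'o.
have := monge rM xM (sD M).
have E (f : 'I_k -> int) : \sum_a f a = f r + (f M + \sum_(a | (a != r) && (a != M)) f a).
  by rewrite (bigD1 r) //= (bigD1 M) //= eq_sym.
have : (s != 1%g)%:R * e <= e by case: (_ != _); rewrite ?mul1r ?mul0r.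
move: le1; rewrite (E (fun a => c a (s' a))) (E (fun a => c a (s a))) s'r s'M sr.
have -> : \sum_(a | (a != r) && (a != M)) c a (s' a) = \sum_(a | (a != r) && (a != M)) c a (s a).
  by apply: eq_bigr => a /andP[ar aM]; rewrite s'o.
set X := \sum_(_ | _ && _) _; set Y := \sum_(_ | true) _; lia.
Qed.

End Rearrangement.

Section Sigma.
Variables (n : nat) (A : 'I_n -> 'I_n -> int).

(* [A] extended by zero to all pairs of natural numbers, so that [sigma A t] is
   the cost of assigning the a-th entry of [t] to row [a] *)
Definition cost (l x : nat) : int :=
  if insub l is Some i then if insub x is Some j then
    if (l < x)%N then A i j else 0 else 0 else 0.

Lemma costE (i j : 'I_n) : cost i j = if (i < j)%N then A i j else 0.
Proof. by rewrite /cost !valK. Qed.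

Lemma costxx l : cost l l = 0.
Proof. by rewrite /cost; rewrite ltnn; case: (insub l) => // i; case: (insub l). Qed.

Lemma sigmaE k (t : incr n k) : sigma A t = \sum_(a < k) cost a (tnth (val t) a).
Proof.
have ut : uniq (val t).
  by rewrite -(map_inj_uniq val_inj); exact: sorted_uniq ltn_trans ltnn _ (valP t).
rewrite /sigma (exchange_big_dep xpredT) //=.
transitivity (\sum_(j in val t) cost (index j (val t)) j).
  rewrite [RHS]big_mkcond; apply: eq_bigr => j _.
  case: ifP => jt; last first.
    by rewrite big1 // => i ij; rewrite /Tvec jt andbF mulr0.
  pose ix := index j (val t).
  have ixn : (ix < n)%N.
    have : (ix < k)%N by rewrite -[k](size_tuple (val t)) index_mem.
    move=> h; have := incr_ge t (Ordinal h); move/leq_ltn_trans; apply; exact: ltn_ord.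
  rewrite -[index _ _]/(val (Ordinal ixn)) costE; case: ifP => lt.
    rewrite (bigD1 (Ordinal ixn)) //= /Tvec jt lt eqxx /= mulr1 big1 ?addr0 // => i /andP[_ ne].
    case: eqP => [e|]; last by rewrite andbF mulr0.
    by case/eqP: ne; apply: ord_inj.
  rewrite big1 // => i ij; rewrite /Tvec jt ij /=; case: eqP => [e|]; last by rewrite mulr0.
  by move: lt; rewrite /= /ix e ij.
rewrite -big_uniq // big_tuple; apply: eq_bigr => a _.
by rewrite (tnth_nth (tnth (val t) a)) index_uniq ?size_tuple.
Qed.

Hypothesis hA1 : forall i j k : 'I_n, j = i.+1 :> nat -> k = j.+1 :> nat ->
     A i j + A j k <= A i k.
Hypothesis hA2 : forall i i' j j' : 'I_n, i' = i.+1 :> nat -> j' = j.+1 :> nat ->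
     (i.+1 < j)%N -> A i j + A i' j' <= A i j' + A i' j.

(** For [x = r.+1] the cell [cost r.+1 x] is a diagonal zero and the inequality is condition (a);
    further from the diagonal it is condition (b). *)
Lemma cost_monge_loc r x : (r.+1 <= x)%N -> (x.+1 < n)%N ->
  cost r x + cost r.+1 x.+1 <= cost r x.+1 + cost r.+1 x.
Proof.
move=> rx xn; have xn' := ltnW xn; have rn' := leq_ltn_trans rx xn'.
have rn := ltnW rn'.
have -> := costE (Ordinal rn) (Ordinal xn'); have -> := costE (Ordinal rn') (Ordinal xn).
have -> := costE (Ordinal rn) (Ordinal xn); have -> := costE (Ordinal rn') (Ordinal xn').
rewrite /= rx ltnS rx ltnW ?ltnS //.
move: rx; rewrite leq_eqVlt => /orP[/eqP rx|rx].
  have -> : (r.+1 < x)%N = false by rewrite -rx ltnn.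
  rewrite addr0; have -> : Ordinal xn' = Ordinal rn' by apply: ord_inj.
  by apply: hA1 => //=; rewrite -rx.
by rewrite rx; apply: hA2.
Qed.

(** The local inequalities telescope over the rectangle; [l <= x] keeps all its cells on or above
    the diagonal. *)
Lemma cost_monge r l x y : (r < l)%N -> (l <= x)%N -> (x < y)%N -> (y < n)%N ->
  cost r x + cost l y <= cost r y + cost l x.
Proof.
move=> rl lx xy yn.
have row r' : (r' < l)%N -> cost r' x + cost r'.+1 y <= cost r' y + cost r'.+1 x.
  move=> r'l; elim: y xy yn => // y IH; rewrite ltnS leq_eqVlt => /orP[/eqP <-|xy] yn.
    by apply: cost_monge_loc => //; exact: leq_trans lx.
  have := IH xy (ltnW yn); have := @cost_monge_loc r' y _ yn.
  move=> /(_ (leq_trans r'l (leq_trans lx (ltnW xy)))); lia.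
elim: l rl lx row => // l IH; rewrite ltnS leq_eqVlt => /orP[/eqP <- _ row|rl lx row].
  exact: row.
have := IH rl (ltnW lx) (fun r' h => row r' (leq_trans h (leqnSn l))).
have := row l (leqnn _); lia.
Qed.

(** The tropical meaning of [sigma]: it is the least cost among the terms that survive in a minor of
    a lower triangular matrix. All exponents of the deformation are nonnegative for this reason. *)
Lemma sigma_min k (t : incr n k) (s : 'S_k) :
  (forall a : 'I_k, (a <= tnth (val t) (s a))%N) ->
  sigma A t <= \sum_(a < k) cost a (tnth (val t) (s a)).
Proof.
move=> ad; rewrite sigmaE.
have := @rearrangement k (fun a b => (a <= tnth (val t) b)%N)
  (fun a b => cost a (tnth (val t) b)) 0 (lexx _) _ _ _ s ad.
rewrite mulr0 addr0; apply.
- by move=> r l x rl; apply: leq_trans; exact: ltnW.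
- by move=> l x y xy lx; apply: leq_trans lx _; apply: ltnW; exact: incr_lt.
- by move=> r l x y rl xy lx; rewrite addr0; apply: cost_monge => //; exact: incr_lt.
Qed.

End Sigma.

(** * Elementary unipotent matrices on exterior powers *)

Section Elementary.
Variables (K : fieldType) (n k : nat).
Implicit Types (t : incr n k).

(** The coefficient of e_t in f_(i,j) e_t'. *)
Definition fcoef (i j : 'I_n) t' t : K := ext_act_basis (delta_mx j i) t' t.

Lemma wedge_colsub1 t' t : wedge (colsub (tnth (val t')) (1%:M : 'M[K]_n)) t = (t == t')%:R.
Proof.
rewrite wedgeE; have [->|ne] := eqVneq t t'.
  rewrite -[RHS](det1 K k); congr (\det _); apply/matrixP => a b.
  by rewrite !mxE (inj_eq (@incr_inj _ _ _)).
have [a ha] : exists a, tnth (val t) a \notin val t'.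
  apply/existsP; apply: contraNT ne; rewrite negb_exists => /forallP h.
  apply/eqP/incr_eq => x /tnthP[a ->]; exact: negbNE (h a).
rewrite (expand_det_row _ a) big1 // => b _; rewrite !mxE.
case: eqP => [e|]; last by rewrite mul0r.
by case/negP: ha; rewrite e mem_tnth.
Qed.

Lemma fcoefE i j t' t (l : 'I_k) : tnth (val t') l = i ->
  fcoef i j t' t =
    \det (\matrix_(a < k, b < k) (tnth (val t) a == if b == l then j else tnth (val t') b)%:R).
Proof.
move=> li; rewrite /fcoef /ext_act_basis sum_ffunE (bigD1 l) //= big1 ?addr0.
  rewrite wedgeE; congr (\det _); apply/matrixP => a b; rewrite !mxE.
  by case: ifP => // /eqP ->; rewrite li eqxx andbT.
move=> l' ll'; rewrite wedgeE (expand_det_col _ l') big1 // => a _; rewrite !mxE eqxx.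
have -> : tnth (val t') l' == i = false by rewrite -li (inj_eq (@incr_inj _ _ _)); apply/negbTE.
by rewrite andbF mul0r.
Qed.

Lemma fcoef_out i j t' t : (forall l, tnth (val t') l != i) -> fcoef i j t' t = 0.
Proof.
move=> h; rewrite /fcoef /ext_act_basis sum_ffunE big1 // => l' _.
rewrite wedgeE (expand_det_col _ l') big1 // => a _; rewrite !mxE eqxx.
by rewrite (negbTE (h _)) andbF mul0r.
Qed.

Lemma fcoef_neq0 i j t' t : fcoef i j t' t != 0 ->
  exists l, tnth (val t') l = i /\ exists s : 'S_k,
    forall a, tnth (val t) (s a) = if a == l then j else tnth (val t') a.
Proof.
move=> nz; have [l /eqP li] : exists l, tnth (val t') l == i.
  apply/existsP; apply: contraNT nz; rewrite negb_exists => /forallP h.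
  by apply/eqP/fcoef_out.
exists l; split=> //; move: nz; rewrite (fcoefE _ _ li) -det_tr /determinant.
case: (pickP (fun s : 'S_k => [forall a, tnth (val t) (s a) == if a == l then j else tnth (val t') a])).
  by move=> s /forallP h _; exists s => a; apply/eqP.
move=> h; rewrite big1 ?eqxx // => s _.
have /forallPn[a ha] := negbT (h s).
by rewrite (bigD1 a) //= !mxE (negbTE ha) mul0r mulr0.
Qed.

(** The determinant is affine in the one column that carries the index [i], so no higher power of
    [c] occurs: 1 + c f_(i,j) is already the exponential on an exterior power. *)
Lemma wedge_elem (c : K) i j t' t : i != j ->
  wedge (colsub (tnth (val t')) (1%:M + c *: delta_mx j i)) t = (t == t')%:R + c * fcoef i j t' t.
Proof.
move=> ij; rewrite -wedge_colsub1.
case: (pickP (fun l => tnth (val t') l == i)) => [l /eqP li|h]; last first.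
  rewrite fcoef_out => [|l]; last by rewrite h.
  rewrite mulr0 addr0; congr (wedge _ t); apply/matrixP => a b; rewrite !mxE.
  by rewrite h andbF mulr0 addr0.
rewrite (fcoefE _ _ li) !wedgeE -!(det_tr (rowsub _ _)) -(det_tr (\matrix_(_, _) _)).
rewrite -[X in _ = X + _]mul1r.
apply: (determinant_multilinear (i0 := l)); apply/matrixP => b a; rewrite !mxE.
- by rewrite li !eqxx andbT mul1r.
- by rewrite -li (inj_eq (@incr_inj _ _ _)) [lift l b == l]eq_sym (negbTE (neq_lift _ _)) andbF mulr0 addr0.
by rewrite -li (inj_eq (@incr_inj _ _ _)) [lift l b == l]eq_sym (negbTE (neq_lift _ _)) andbF mulr0 addr0.
Qed.

Lemma wedge_mul_elem (c : K) i j (M : 'M[K]_(n, k)) t : i != j ->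
  wedge ((1%:M + c *: delta_mx j i) *m M) t =
  wedge M t + c * \sum_t' (wedge M t' : K) * fcoef i j t' t.
Proof.
move=> ij; rewrite wedgeE.
have -> X : rowsub (tnth (val t)) (X *m M) = rowsub (tnth (val t)) X *m M.
  by apply/matrixP => a b; rewrite !mxE; apply: eq_bigr => d _; rewrite !mxE.
rewrite cauchy_binet mulr_sumr.
have -> : wedge M t = \sum_t' (t == t')%:R * wedge M t' :> K.
  rewrite (bigD1 t) //= eqxx mul1r big1 ?addr0 // => t' ne.
  by rewrite eq_sym (negbTE ne) mul0r.
rewrite -big_split; apply: eq_bigr => t' _ /=.
have -> X : colsub (tnth (val t')) (rowsub (tnth (val t)) X) =
   rowsub (tnth (val t)) (colsub (tnth (val t')) X) :> 'M[K]_k.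
  by apply/matrixP => a b; rewrite !mxE.
rewrite -(wedgeE (colsub _ _)) wedge_elem // -wedgeE mulrDl; congr (_ + _).
by rewrite -mulrA; congr (_ * _); rewrite mulrC.
Qed.

End Elementary.

(** * Degeneration of the orbit *)

Section PolyFun.
Variable K : numFieldType.

(** Replaces continuity in the deformation parameter s. *)
Definition polyfun (f : K -> K) := exists p : {poly K}, forall s, f s = p.[s].

Lemma polyfun_cst c : polyfun (fun _ => c).
Proof. by exists c%:P => s; rewrite hornerC. Qed.

Lemma polyfun_exp m : polyfun (fun s => s ^+ m).
Proof. by exists ('X^m) => s; rewrite hornerXn. Qed.

Lemma polyfunD f g : polyfun f -> polyfun g -> polyfun (fun s => f s + g s).
Proof. by move=> [p fp] [q gq]; exists (p + q) => s; rewrite hornerD fp gq. Qed.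

Lemma polyfunM f g : polyfun f -> polyfun g -> polyfun (fun s => f s * g s).
Proof. by move=> [p fp] [q gq]; exists (p * q) => s; rewrite hornerM fp gq. Qed.

Lemma polyfun_sum (I : Type) (r : seq I) (P : pred I) (f : I -> K -> K) :
  (forall i, polyfun (f i)) -> polyfun (fun s => \sum_(i <- r | P i) f i s).
Proof.
move=> h; elim: r => [|i r [p IH]].
  by exists 0 => s; rewrite big_nil horner0.
have [q hq] := h i; exists ((if P i then q else 0) + p) => s.
by rewrite big_cons IH hornerD; case: (P i); rewrite ?hq // horner0 add0r.
Qed.

Lemma polyfun_prod (I : Type) (r : seq I) (P : pred I) (f : I -> K -> K) :
  (forall i, polyfun (f i)) -> polyfun (fun s => \prod_(i <- r | P i) f i s).
Proof.
move=> h; elim: r => [|i r [p IH]].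
  by exists 1 => s; rewrite big_nil hornerC.
have [q hq] := h i; exists ((if P i then q else 1) * p) => s.
by rewrite big_cons IH hornerM; case: (P i); rewrite ?hq // hornerC mul1r.
Qed.

Lemma poly_eq0_away0 (p : {poly K}) : (forall s, s != 0 -> p.[s] = 0) -> p = 0.
Proof.
move=> h; apply/eqP/negPn/negP => p0.
(* The numbers 1, ..., size p are nonzero and distinct in characteristic zero, and there are too
   many of them. *)
pose rs := [seq i.+1%:R : K | i <- iota 0 (size p)].
have : (size rs < size p)%N.
  apply: max_poly_roots => //.
    by apply/allP => x /mapP[i _ ->]; rewrite /root h // pnatr_eq0.
  rewrite map_inj_uniq ?iota_uniq // => i j e.
  by apply/eqP; rewrite -eqSS -(eqr_nat K) e.
by rewrite size_map size_iota ltnn.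
Qed.

Lemma polyfun_eq f g : polyfun f -> polyfun g ->
  (forall s, s != 0 -> f s = g s) -> f 0 = g 0.
Proof.
move=> [p fp] [q gq] h; have e : p - q = 0.
  by apply: poly_eq0_away0 => s s0; rewrite !hornerE -fp -gq h // subrr.
by rewrite fp gq; apply/eqP; rewrite -subr_eq0 -hornerN -hornerD e horner0.
Qed.

End PolyFun.

Section Prefix.
Variables (n k : nat).
Implicit Types (t : incr n k).

(* The basis vector e_t of the k-th exterior power lies in the sum of weight
   subspaces L_(omega_k)(i) exactly when [t] starts with 0, ..., i-1 *)
Definition prefixed (i : nat) t := [forall a : 'I_k, (a < i)%N ==> (tnth (val t) a == a :> nat)].

Lemma prefixedP i t :
  reflect (forall a : 'I_k, (a < i)%N -> tnth (val t) a = a :> nat) (prefixed i t).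
Proof.
apply: (iffP forallP) => h a; first by move=> ai; apply/eqP; apply: (implyP (h a)).
by apply/implyP => /h ->.
Qed.

Lemma prefixed_le i i' t : (i <= i')%N -> prefixed i' t -> prefixed i t.
Proof.
by move=> ii /prefixedP h; apply/prefixedP => a ai; apply: h; apply: leq_trans ii.
Qed.

Variables (K : fieldType) (A : 'I_n -> 'I_n -> int).
Hypothesis hA1 : forall i j k : 'I_n, j = i.+1 :> nat -> k = j.+1 :> nat ->
     A i j + A j k <= A i k.
Hypothesis hA2 : forall i i' j j' : 'I_n, i' = i.+1 :> nat -> j' = j.+1 :> nat ->
     (i.+1 < j)%N -> A i j + A i' j' <= A i j' + A i' j.

(** Behind the prefix 0, ..., i-1, the entry [i] can only stand in position [i], a diagonal cell of
    cost zero. *)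
Lemma prefixed_fcoef_pos (i j : 'I_n) t' t : prefixed i t' -> (fcoef K i j t' t) != 0 ->
  exists l : 'I_k, [/\ l = i :> nat, tnth (val t') l = i & exists s : 'S_k,
    forall a, tnth (val t) (s a) = if a == l then j else tnth (val t') a].
Proof.
move=> /prefixedP pt /fcoef_neq0[l [li hs]]; exists l; split=> //.
apply/eqP; rewrite eqn_leq; apply/andP; split; first by rewrite -li incr_ge.
by rewrite leqNgt; apply/negP => lti; have := pt l lti; rewrite li => e; rewrite e ltnn in lti.
Qed.

(** Replacing the diagonal entry [i] by [j] adds exactly [A i j] to the cost, and sorting the result
    can only lower it, by [sigma_min]. *)
Lemma sigma_fcoef (i j : 'I_n) t' t : (i < j)%N -> prefixed i t' -> fcoef K i j t' t != 0 ->
  sigma A t <= sigma A t' + A i j.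
Proof.
move=> ij pt nz; have [l [li t'l [s hs]]] := prefixed_fcoef_pos pt nz.
apply: le_trans (sigma_min hA1 hA2 (s := s) _) _ => [a|].
  rewrite hs; case: eqP => [->|_]; last exact: incr_ge.
  by rewrite li ltnW.
rewrite sigmaE (bigD1 l) //= [X in _ <= X + _](bigD1 l) //= hs eqxx li costE ij t'l costxx.
rewrite add0r addrC lerD2r; apply: ler_sum => a al; by rewrite hs (negbTE al).
Qed.

Lemma prefixed_fcoef (i j : 'I_n) t' t : (i < j)%N -> prefixed i t' -> fcoef K i j t' t != 0 ->
  prefixed i t.
Proof.
move=> ij pt nz; have [l [li t'l [s hs]]] := prefixed_fcoef_pos pt nz.
move/prefixedP: pt => pt.
have h (a : 'I_k) : (a < i)%N -> tnth (val t) (s a) = a :> nat.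
  move=> ai; rewrite hs; case: eqP => [al|_]; last exact: pt.
  by move: ai; rewrite al li ltnn.
(* The sorting permutation fixes the positions below [i]: a position sent lower would collide with
   one already known to be fixed. *)
suff H m : forall a : 'I_k, (a < i)%N -> (a < m)%N -> s a = a.
  by apply/prefixedP => a ai; rewrite -[in LHS](H a.+1 a) // h.
elim: m => // m IH a ai; rewrite ltnS leq_eqVlt => /orP[/eqP am|]; last exact: IH.
have : (s a <= a)%N by rewrite -[X in (_ <= X)%N](h a ai) incr_ge.
rewrite leq_eqVlt => /orP[/eqP /ord_inj//|sa].
have e : s (s a) = s a by apply: IH; [exact: ltn_trans ai | rewrite -am].
by move: (h _ (ltn_trans sa ai)); rewrite e h // => e1; move: sa; rewrite -e1 ltnn.
Qed.

End Prefix.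

(** * The one-parameter deformation of the unipotent orbit *)

Section Deformation.
Variables (K : numFieldType) (n k : nat) (A : 'I_n -> 'I_n -> int).
Hypothesis hA1 : forall i j k : 'I_n, j = i.+1 :> nat -> k = j.+1 :> nat ->
     A i j + A j k <= A i k.
Hypothesis hA2 : forall i i' j j' : 'I_n, i' = i.+1 :> nat -> j' = j.+1 :> nat ->
     (i.+1 < j)%N -> A i j + A i' j' <= A i j' + A i' j.
Implicit Types (t : incr n k) (w : ext K n k) (c : 'I_n -> 'I_n -> K).
Implicit Types (L : seq ('I_n * 'I_n)).

(* A family of operators interpolating between f_(i,j) (at s = 1) and the
   operator induced by f_(i,j) on the associated graded space (at s = 0) *)
Definition fdef (s : K) (i j : 'I_n) w : ext K n k :=
  [ffun t => \sum_t' if prefixed i t' then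
     (w t' : K) * fcoef K i j t' t * s ^+ absz (sigma A t' + A i j - sigma A t)%R else 0].

(** At s = 0 this is the full exponential, since there the operator squares to zero by
    [fdef_nil]. *)
Definition estep s c (ij : 'I_n * 'I_n) w : ext K n k :=
  [ffun t => (w t : K) + c ij.1 ij.2 * (fdef s ij.1 ij.2 w t : K)].

Definition eorbit s c L w := foldr (estep s c) w L.

Definition supp_in (i : nat) w := forall t, w t != 0 -> prefixed i t.

Lemma estep_supp s c (i j : 'I_n) w : (i < j)%N -> supp_in i w -> supp_in i (estep s c (i, j) w).
Proof.
move=> ij sw t; rewrite !ffunE /=; have [->|wt _] := eqVneq (w t) 0; last exact: sw.
rewrite add0r => nz; apply: contraNT nz => nt; rewrite big1 ?mulr0 // => t' _.
case: ifP => // pt; case: (eqVneq (fcoef K i j t' t) 0) => [->|h]; first by rewrite mulr0 mul0r.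
by case/negP: nt; apply: prefixed_fcoef h.
Qed.

Lemma supp_in_le i i' w : (i <= i')%N -> supp_in i' w -> supp_in i w.
Proof. by move=> ii h t /h; apply: prefixed_le. Qed.

Definition increasing_list L := all (fun ij : 'I_n * 'I_n => (ij.1 < ij.2)%N) L &&
  pairwise (fun x y : 'I_n * 'I_n => (x.1 <= y.1)%N) L.

(** The factors applied first have the largest [i], so every operator of index [i] meets a vector
    supported on indices with prefix 0, ..., i-1. Along the orbit the truncation in [fdef] thus
    removes nothing. *)
Lemma eorbit_supp s c L w (i : nat) : increasing_list L -> (forall i0, supp_in i0 w) ->
  all (fun ij : 'I_n * 'I_n => (i <= ij.1)%N) L -> supp_in i (eorbit s c L w).
Proof.
move=> + sw; elim: L i => [|[i0 j0] L IH] i; first by move=> _ _; exact: sw.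
rewrite /increasing_list /= => /andP[/andP[ij aL] /andP[h pL]] /andP[i0i _].
apply: supp_in_le i0i _; apply: estep_supp => //; apply: IH => //.
by rewrite /increasing_list aL pL.
Qed.

Lemma estep_polyfun c ij (w : K -> ext K n k) :
  (forall t, polyfun (fun s => w s t)) -> forall t, polyfun (fun s => estep s c ij (w s) t).
Proof.
move=> h t.
have [p hp] : polyfun (fun s => (w s t : K) + c ij.1 ij.2 * \sum_t' if prefixed ij.1 t' then
     (w s t' : K) * fcoef K ij.1 ij.2 t' t * s ^+ absz (sigma A t' + A ij.1 ij.2 - sigma A t)%R else 0).
  apply: polyfunD => //; apply: polyfunM; first exact: polyfun_cst.
  apply: polyfun_sum => t'; case: (prefixed _ _); last exact: polyfun_cst.
  apply: polyfunM; last exact: polyfun_exp.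
  by apply: polyfunM => //; exact: polyfun_cst.
by exists p => s; rewrite -hp !ffunE.
Qed.

Lemma eorbit_polyfun c L w t : polyfun (fun s => eorbit s c L w t).
Proof.
elim: L t => [|ij L IH] t; first exact: polyfun_cst.
exact: (estep_polyfun (w := fun s => eorbit s c L w) c ij IH).
Qed.

Definition twist (s : K) c (i j : 'I_n) : K := s ^ (A i j) * c i j.

(** Conjugation by the diagonal operator with entries s^(- sigma) turns s^(A i j) f_(i,j) into
    [fdef s]; the power of s in [fdef] was chosen for this. *)
Lemma eorbit_scale s c L w t : s != 0 -> all (fun ij : 'I_n * 'I_n => (ij.1 < ij.2)%N) L ->
  (eorbit s c L [ffun t => s ^ (- sigma A t) * (w t : K)] t) =
  s ^ (- sigma A t) * (eorbit 1 (twist s c) L w t : K).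
Proof.
move=> s0 + ; elim: L t => [|[i j] L IH] t /=; first by rewrite ffunE.
move=> /andP[/= ij aL]; rewrite [LHS]ffunE [RHS]/= [in RHS]ffunE /= IH // mulrDr; congr (_ + _).
rewrite !ffunE mulrCA !mulr_sumr; apply: eq_bigr => t' _.
case: ifP => pt; last by rewrite !mulr0.
rewrite IH // expr1n mulr1 /twist.
have [->|nz] := eqVneq (fcoef K i j t' t) 0; first by rewrite !(mulr0, mul0r).
have le0 : 0 <= sigma A t' + A i j - sigma A t by rewrite subr_ge0; exact: sigma_fcoef nz.
rewrite -[s ^+ _]/(s ^ (absz (sigma A t' + A i j - sigma A t)%R)%:Z) gez0_abs //.
rewrite !expfzDr // -!mulrA.
have -> : s ^ (- sigma A t') = (s ^ sigma A t')^-1 by rewrite invr_expz.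
have := expfz_neq0 (sigma A t') s0; set x := s ^ sigma A t'; move=> x0.
set y := s ^ _; set z := s ^ _.
by field.
Qed.

Lemma expz_pos (s : K) (z : int) : 0 <= z -> s ^ z = s ^+ absz z.
Proof. by case: z. Qed.

Fixpoint uni_prod c L : 'M[K]_n :=
  if L is (i, j) :: L' then (1%:M + c i j *: delta_mx j i) *m uni_prod c L' else 1%:M.

(** Cross terms vanish: the product of [delta_mx j i] and [delta_mx j' i'] needs [i = j'], whereas
    the order of the list gives [i <= i' < j']. The parameters are therefore the matrix entries
    themselves. *)
Lemma uni_prodE c L : increasing_list L ->
  uni_prod c L = 1%:M + \sum_(ij <- L) c ij.1 ij.2 *: delta_mx ij.2 ij.1.
Proof.
elim: L => [|[i j] L IH]; first by rewrite big_nil addr0.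
rewrite /increasing_list /= => /andP[/andP[ij aL] /andP[h pL]].
rewrite IH; last by rewrite /increasing_list aL pL.
rewrite big_cons /= mulmxDl !mul1mx mulmxDr mulmx1 -addrA; congr (_ + _).
rewrite addrC -addrA; congr (_ + _); rewrite addrC -[RHS]addr0; congr (_ + _).
rewrite mulmx_sumr big_seq big1 // => -[i' j'] /= ij'.
rewrite -scalemxAl -scalemxAr mul_delta_mx_cond.
have -> : i == j' = false; last by rewrite mulr0n !scaler0.
apply/negbTE; rewrite neq_ltn; apply/orP; left.
have /= ii := allP h _ ij'; have /= := allP aL _ ij'; exact: leq_ltn_trans.
Qed.

Lemma eorbit1_wedge c L (M : 'M[K]_(n, k)) : increasing_list L ->
  (forall i, supp_in i (wedge M)) ->
  eorbit 1 c L (wedge M) = wedge (uni_prod c L *m M).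
Proof.
move=> + sM; elim: L => [|[i j] L IH] /=; first by rewrite mul1mx.
rewrite /increasing_list /= => /andP[/andP[ij aL] /andP[h pL]].
have iL : increasing_list L by rewrite /increasing_list aL pL.
apply/ffunP => t; rewrite IH // -mulmxA wedge_mul_elem; last first.
  by apply: contraTneq ij => ->; rewrite ltnn.
rewrite [LHS]ffunE /= [fdef _ _ _ _ _]ffunE; congr (_ + _ * _); apply: eq_bigr => t' _.
rewrite expr1n mulr1; case: ifP => // /negbT nt.
suff -> : (wedge (uni_prod c L *m M) t') = 0 by rewrite mul0r.
apply/eqP; apply: contraNT nt; rewrite -IH //; exact: (eorbit_supp (i := i) iL sM h).
Qed.

End Deformation.

Section HighestWeight.
Variables (K : fieldType) (n k : nat).
Implicit Types (t : incr n k).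

Lemma incr_gap t (a b : 'I_k) : (a <= b)%N -> (tnth (val t) a + (b - a) <= tnth (val t) b)%N.
Proof.
case: b => b; elim: b => [|b IH] bk /=.
  by rewrite leqn0 => /eqP a0; rewrite a0 subnn addn0 (_ : a = Ordinal bk) //; apply: ord_inj.
rewrite leq_eqVlt => /orP[/eqP ab|ab].
  by rewrite ab subnn addn0 (_ : a = Ordinal bk) //; apply: ord_inj.
have := IH (ltnW bk) ab; rewrite subSn // addnS => /leq_ltn_trans; apply; exact: incr_lt.
Qed.

Lemma incr_prefixed t : (forall a, tnth (val t) a < k)%N -> prefixed k t.
Proof.
move=> h; apply/prefixedP => a _; apply/eqP; rewrite eqn_leq incr_ge andbT.
have k1 : (k.-1 < k)%N by case: (k) a => [[]|].
have ak : (a <= Ordinal k1)%N by rewrite /= -ltnS (ltn_predK (ltn_ord a)).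
by have := incr_gap t ak; have := h (Ordinal k1); have := ltn_ord a; rewrite /=; lia.
Qed.

Lemma ext_hwE t : ext_hw K n k t = (prefixed k t)%:R.
Proof.
rewrite ffunE; congr (_%:R); congr nat_of_bool; apply/eqP/prefixedP => [e a _|h].
  have := congr1 (fun s => nth 0%N s a) e.
  by rewrite nth_iota // add0n (nth_map (tnth (val t) a)) ?size_tuple // -tnth_nth.
apply: (@eq_from_nth _ 0%N); rewrite size_map size_tuple ?size_iota // => i ik.
rewrite nth_iota // (nth_map (tnth (val t) (Ordinal ik))) ?size_tuple //.
by have := h (Ordinal ik) ik; rewrite {1}(tnth_nth (tnth (val t) (Ordinal ik))).
Qed.

Lemma ext_hw_wedge : ext_hw K n k = wedge (pid_mx k).
Proof.
apply/ffunP => t; rewrite ext_hwE wedgeE; case: (boolP (prefixed k t)) => pt.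
  rewrite -[LHS](det1 K k); congr (\det _); apply/matrixP => a b; rewrite !mxE.
  by rewrite (prefixedP _ _ pt) // ltn_ord andbT.
have [a ha] : exists a, ~~ (tnth (val t) a < k)%N.
  by apply/existsP; apply: contraNT pt; rewrite negb_exists => /forallP h; apply: incr_prefixed => a; exact: negbNE (h a).
by rewrite (expand_det_row _ a) big1 // => b _; rewrite !mxE (negbTE ha) andbF mul0r.
Qed.

End HighestWeight.

Lemma ext_hw_supp (K : numFieldType) n k i : supp_in i (ext_hw K n k).
Proof.
move=> t; rewrite ext_hwE; case: (boolP (prefixed k t)) => [/prefixedP h _|]; last by rewrite eqxx.
by apply/prefixedP => a _; exact: h.
Qed.

(** * Coordinates of the deformed orbit of the highest weight vector *)

Section Orbit.
Variables (K : numFieldType) (n : nat) (A : 'I_n -> 'I_n -> int).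
Hypothesis hA1 : forall i j k : 'I_n, j = i.+1 :> nat -> k = j.+1 :> nat ->
     A i j + A j k <= A i k.
Hypothesis hA2 : forall i i' j j' : 'I_n, i' = i.+1 :> nat -> j' = j.+1 :> nat ->
     (i.+1 < j)%N -> A i j + A i' j' <= A i j' + A i' j.
Implicit Types (c : 'I_n -> 'I_n -> K).

Definition root_list : seq ('I_n * 'I_n) :=
  [seq ij : 'I_n * 'I_n <- [seq (i, j) | i <- enum 'I_n, j <- enum 'I_n] | (ij.1 < ij.2)%N].

Lemma root_list_increasing : increasing_list root_list.
Proof.
apply/andP; split; first exact: filter_all.
apply: (subseq_pairwise (filter_subseq _ _)).
have : pairwise (fun x y : 'I_n => (x <= y)%N) (enum 'I_n).
  rewrite -(pairwise_map val leq) val_enum_ord.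
  by rewrite -(sorted_pairwise leq_trans) iota_sorted.
elim: (enum 'I_n) {2}(enum 'I_n) => [//|x s IH] r /= /andP[h p].
rewrite pairwise_cat IH // andbT; apply/andP; split.
  apply/allrelP => y z /mapP[y' _ ->] /allpairsP[[z1 z2] [/= z1s _ ->]] /=.
  exact: (allP h).
rewrite pairwise_map; elim: r {IH} => //= y r ->; rewrite andbT; apply/allP => z _ /=; exact: leqnn.
Qed.

Lemma mem_root_list (i j : 'I_n) : ((i, j) \in root_list) = (i < j)%N.
Proof.
rewrite mem_filter /=; case: (_ < _)%N => //=; apply/allpairsP.
by exists (i, j); rewrite !mem_enum.
Qed.

Lemma root_list_uniq : uniq root_list.
Proof. by apply: filter_uniq; apply: allpairs_uniq; rewrite ?enum_uniq // => -[x y] [x' y'] _ _. Qed.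

Definition uni_coef c (i x : 'I_n) : K :=
  if i == x then 1 else if (i < x)%N then c i x else 0.

Definition uni_mx c : 'M[K]_n := \matrix_(x, i) uni_coef c i x.

Lemma uni_prod_mx c : uni_prod c root_list = uni_mx c.
Proof.
rewrite uni_prodE ?root_list_increasing //; apply/matrixP => x i.
rewrite !mxE summxE /uni_coef.
have -> : \sum_(ij <- root_list) (c ij.1 ij.2 *: delta_mx ij.2 ij.1) x i =
   \sum_(ij <- root_list | ij == (i, x)) c i x.
  rewrite [RHS]big_mkcond; apply: eq_bigr => -[i' j'] _; rewrite !mxE /= xpair_eqE.
  rewrite [x == j']eq_sym [i == i']eq_sym andbC.
  by case: andP => [[/eqP -> /eqP ->]|_]; rewrite ?mulr1 ?mulr0.
have -> : \sum_(ij <- root_list | ij == (i, x)) c i x = if (i < x)%N then c i x else 0.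
  case: ifP => ix; first by rewrite -big_filter filter_pred1_uniq ?root_list_uniq ?mem_root_list // big_seq1.
  by rewrite big_seq_cond big1 // => ij /andP[+ /eqP e]; rewrite e mem_root_list ix.
by rewrite [x == i]eq_sym; case: eqP => [->|_]; rewrite ?ltnn ?addr0 ?add0r.
Qed.

Lemma det_uni_mx c : \det (uni_mx c) = 1.
Proof.
rewrite det_trig; first by rewrite big1 // => i _; rewrite mxE /uni_coef eqxx.
apply/is_trig_mxP => i j ij; rewrite mxE /uni_coef.
by rewrite ltnNge ltnW //=; case: eqP => // e; rewrite e ltnn in ij.
Qed.

Variables (k : nat) (kn : (k <= n)%N).
Implicit Types (t : incr n k).

Definition orbit_vec (s : K) c : ext K n k := eorbit A s c root_list (ext_hw K n k).

Lemma orbit_vec_flag s c t : s != 0 ->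
  orbit_vec s c t = s ^ (- sigma A t) * (wedge (uni_mx (twist A s c) *m pid_mx k) t : K) :> K.
Proof.
move=> s0; rewrite /orbit_vec.
have -> : ext_hw K n k = [ffun t => s ^ (- sigma A t) * (ext_hw K n k t : K)].
  apply/ffunP => t'; rewrite [RHS]ffunE !ext_hwE; case: (boolP (prefixed k t')) => [/prefixedP h|]; last by rewrite mulr0.
  rewrite sigmaE big1 ?oppr0 ?expr0z ?mul1r // => a _; by rewrite h // costxx.
rewrite eorbit_scale //; last by case/andP: root_list_increasing.
congr (_ * _); rewrite ext_hw_wedge eorbit1_wedge ?root_list_increasing //.
  by rewrite uni_prod_mx.
by move=> i; rewrite -ext_hw_wedge; exact: ext_hw_supp.
Qed.

Lemma orbit_vec_polyfun c t : polyfun (fun s => orbit_vec s c t).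
Proof. exact: eorbit_polyfun. Qed.

(** The Leibniz expansion of the minor for nonzero s, carried over to s = 0 by polynomiality. There,
    with 0^0 = 1, only permutations of minimal cost remain: the coordinate becomes an initial form
    of the minor. *)
Lemma orbit_vecE s c t :
  orbit_vec s c t = \sum_(p : 'S_k) (-1) ^+ p *
    (\prod_b uni_coef c (widen_ord kn b) (tnth (val t) (p b))) *
    s ^+ absz (\sum_(b < k) cost A b (tnth (val t) (p b)) - sigma A t)%R.
Proof.
pose F s := \sum_(p : 'S_k) (-1) ^+ p *
    (\prod_b uni_coef c (widen_ord kn b) (tnth (val t) (p b))) *
    s ^+ absz (\sum_(b < k) cost A b (tnth (val t) (p b)) - sigma A t)%R.
have E s1 : s1 != 0 -> orbit_vec s1 c t = F s1 :> K.
  move=> s0; rewrite orbit_vec_flag // wedgeE -det_tr /determinant mulr_sumr.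
  apply: eq_bigr => p _; rewrite mulrCA -mulrA; congr (_ * _).
  have M b : (rowsub (tnth (val t)) (uni_mx (twist A s1 c) *m (pid_mx k : 'M_(n, k))))^T b (p b) =
     uni_coef c (widen_ord kn b) (tnth (val t) (p b)) * s1 ^ (cost A b (tnth (val t) (p b))).
    rewrite !mxE (bigD1 (widen_ord kn b)) //= !mxE eqxx /= ltn_ord mulr1 big1 ?addr0; last first.
      move=> d db; rewrite !mxE; case: eqP => [e|]; last by rewrite mulr0.
      by case/eqP: db; apply: ord_inj.
    rewrite -[b in cost A b]/(nat_of_ord (widen_ord kn b)) costE /uni_coef /twist /=.
    case: eqP => [<-|_]; first by rewrite ltnn expr0z mulr1.
    by case: ifP; rewrite ?mul0r // mulrC.
  under eq_bigr do rewrite M; rewrite big_split /= mulrCA; set P := \prod_(_ | _) uni_coef _ _ _.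
  have [->|P0] := eqVneq P 0; first by rewrite !mul0r.
  congr (_ * _); have -> (f : 'I_k -> int) : \prod_b s1 ^ f b = s1 ^ (\sum_b f b).
    by elim/big_rec2: _ => [|b x y _ ->]; rewrite ?expr0z // expfzDr.
  (* A nonzero product [P] forces [a <= tnth (val t) (p a)] for all [a], so the exponent is
     nonnegative by [sigma_min]. *)
  rewrite -expfzDr // addrC expz_pos // subr_ge0; apply: sigma_min => // a.
  rewrite leqNgt; apply: contraNN P0 => lt; rewrite /P (bigD1 a) //= /uni_coef.
  have -> : (widen_ord kn a < tnth (val t) (p a))%N = false by rewrite /= ltnNge ltnW.
  rewrite (_ : (widen_ord kn a == _) = false) ?mul0r //.
  by apply/eqP => e; rewrite -e /= ltnn in lt.
have [->|s0] := eqVneq s 0; last exact: E.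
apply: (polyfun_eq (orbit_vec_polyfun c t) _ E).
apply: polyfun_sum => p; apply: polyfunM; first exact: polyfun_cst.
exact: polyfun_exp.
Qed.

(** For the entries 0, ..., k-1 an admissible permutation satisfies b <= p b everywhere, hence is
    the identity, as one sees from the top position downwards. This coordinate keeps the orbit away
    from zero. *)
Lemma orbit_vec_hw s c t : prefixed k t -> orbit_vec s c t = 1 :> K.
Proof.
move=> /prefixedP h; rewrite orbit_vecE (bigD1 1%g) //= odd_perm1 expr0 mul1r.
rewrite big1 ?mul1r; last first.
  by move=> b _; rewrite perm1 /uni_coef (_ : _ == _) //; apply/eqP/ord_inj; rewrite /= h.
rewrite sigmaE -sumrB big1 ?expr0; last by move=> b _; rewrite perm1 subrr.
rewrite big1 ?addr0 // => p p1.
case: (boolP [forall b : 'I_k, (b <= p b)%N]) => [/forallP pb|/forallPn[b pb]].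
  case/eqP: p1; apply/permP => b; rewrite perm1.
  suff H m : forall b : 'I_k, (k - b <= m)%N -> p b = b by apply: (H k); rewrite leq_subr.
  elim: m => [|m IH] b' le; first by have := ltn_ord b'; lia.
  have := pb b'; rewrite leq_eqVlt => /orP[/eqP/ord_inj//|lt].
  apply: (@perm_inj _ p); apply: IH.
  by have := ltn_ord (p b'); lia.
rewrite (bigD1 b) //= /uni_coef.
rewrite (_ : (widen_ord kn b < _)%N = false); last first.
  by rewrite /= h // ltnNge; move: pb; rewrite -ltnNge => /ltnW ->.
rewrite (_ : (widen_ord kn b == _) = false); first by rewrite !(mul0r, mulr0).
 by apply/eqP => /(congr1 (@nat_of_ord _)) /=; rewrite h // => e; move: pb; rewrite -e leqnn.
Qed.

Lemma ex_prefixed : exists t : incr n k, prefixed k t.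
Proof.
have inj : injective (@widen_ord k n kn) by move=> a b [] /ord_inj.
have [t [p e]] := incr_sort inj; exists t; apply: incr_prefixed => a.
by rewrite -(permKV p a) -e /= ltn_ord.
Qed.

Lemma orbit_vec_neq0 s c : orbit_vec s c != 0.
Proof.
have [t pt] := ex_prefixed; apply/eqP => /ffunP/(_ t); rewrite orbit_vec_hw // ffunE => /eqP.
by rewrite oner_eq0.
Qed.

End Orbit.

(** * Straightening *)

Section Spanned.
Variables (K : fieldType) (G : Type) (T : finType) (m : T -> G -> K).

(** Span membership for functions, with coefficients supported on [X]. [G] is the set of matrices
    during straightening and the set of families of vectors afterwards. *)
Definition spanned (X : pred T) (F : G -> K) :=
  exists kap : T -> K, (forall x, ~~ X x -> kap x = 0) /\
    forall g, F g = \sum_x kap x * m x g.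

Lemma spanned_ext X F F' : F =1 F' -> spanned X F -> spanned X F'.
Proof. by move=> e [kap [k0 kE]]; exists kap; split=> // g; rewrite -e. Qed.

Lemma spanned_mem (X : pred T) x : X x -> spanned X (m x).
Proof.
move=> Xx; exists (fun y => (y == x)%:R); split=> [y|g].
  by case: eqP => // ->; rewrite Xx.
rewrite (bigD1 x) //= eqxx mul1r big1 ?addr0 // => y /negbTE ->; exact: mul0r.
Qed.

Lemma spanned0 X : spanned X (fun _ => 0).
Proof. by exists (fun _ => 0); split=> // g; rewrite big1 // => y _; rewrite mul0r. Qed.

Lemma spannedZ X c F : spanned X F -> spanned X (fun g => c * F g).
Proof.
move=> [kap [k0 kE]]; exists (fun x => c * kap x); split=> [x /k0 ->|g].
  by rewrite mulr0.
by rewrite kE mulr_sumr; apply: eq_bigr => x _; rewrite mulrA.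
Qed.

Lemma spannedD X F F' : spanned X F -> spanned X F' -> spanned X (fun g => F g + F' g).
Proof.
move=> [k1 [k10 k1E]] [k2 [k20 k2E]]; exists (fun x => k1 x + k2 x); split=> [x Xx|g].
  by rewrite k10 // k20 // addr0.
by rewrite k1E k2E -big_split; apply: eq_bigr => x _; rewrite mulrDl.
Qed.

Lemma spanned_sum X (I : Type) (r : seq I) (P : pred I) (F : I -> G -> K) :
  (forall i, P i -> spanned X (F i)) -> spanned X (fun g => \sum_(i <- r | P i) F i g).
Proof.
move=> h; elim: r => [|i r IH].
  by apply: spanned_ext (spanned0 X) => g; rewrite big_nil.
case Pi: (P i); last by apply: spanned_ext IH => g; rewrite big_cons Pi.
by apply: spanned_ext (spannedD (h i Pi) IH) => g; rewrite big_cons Pi.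
Qed.

End Spanned.

(** After subtraction of [th], values on [B] are nonnegative and all others negative. The values
    from [B] that [s] keeps in [B] form a subfamily of the original ones, and the one imported at
    [m0] is a strict loss. *)
Lemma ltn_sum_perm (N : nat) (Z : 'I_N -> nat) (B : pred 'I_N) (th : nat) (s : 'S_N) m0 :
  (forall m, B m -> (th <= Z m)%N) -> (forall m, ~~ B m -> (Z m < th)%N) ->
  B m0 -> ~~ B (s m0) -> (\sum_(m | B m) Z (s m) < \sum_(m | B m) Z m)%N.
Proof.
move=> hB hnB Bm Bsm.
suff : (\sum_(m | B m) (Z (s m))%:Z < \sum_(m | B m) (Z m)%:Z).
  by rewrite -!(big_morph Posz PoszD (erefl _)).
rewrite -subr_gt0 -sumrB.
have -> : \sum_(m | B m) ((Z m)%:Z - (Z (s m))%:Z) =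
   \sum_(m | B m) ((Z m)%:Z - th%:Z) - \sum_(m | B m) ((Z (s m))%:Z - th%:Z).
  rewrite -sumrB; apply: eq_bigr => m _; lia.
rewrite subr_gt0 (bigD1 m0) //=.
have le1 : \sum_(m | B m && B (s m)) ((Z (s m))%:Z - th%:Z) <= \sum_(m | B m) ((Z m)%:Z - th%:Z).
  rewrite (reindex_inj (@perm_inj _ (s^-1)%g)) /=.
  rewrite [X in _ <= X](bigID (fun m => B ((s^-1)%g m))) /=.
  have -> : \sum_(j | B ((s^-1)%g j) && B (s ((s^-1)%g j))) ((Z (s ((s^-1)%g j)))%:Z - th%:Z) =
    \sum_(j | B j && B ((s^-1)%g j)) ((Z j)%:Z - th%:Z).
    by apply: eq_big => [m|m _]; rewrite permKV // andbC.
  rewrite lerDl; apply: sumr_ge0 => m /andP[/hB]; lia.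
apply: lt_le_trans le1.
rewrite [X in _ < X](eq_bigl (fun m => B m && B (s m) && (m != m0))); last first.
  by move=> m; case: eqP => [->|]; rewrite ?andbT // (negbTE Bsm) andbF.
have : \sum_(m | B m && (m != m0)) ((Z (s m))%:Z - th%:Z) <=
   \sum_(m | B m && B (s m) && (m != m0)) ((Z (s m))%:Z - th%:Z).
  rewrite [X in X <= _](bigID (fun m => B (s m))) /= [X in X + _](eq_bigl (fun m => B m && B (s m) && (m != m0))).
    by rewrite gerDl; apply: sumr_le0 => m /andP[_ /hnB]; lia.
  by move=> m; rewrite -!andbA; congr (_ && _); exact: andbC.
by move=> le2; rewrite -[X in _ < X]add0r; apply: ltr_leD => //; rewrite subr_lt0 ltz_nat hnB.
Qed.

(** * Garnir relations between two minors *)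

Section Garnir.
Variables (K : numFieldType) (n P Q : nat) (QP : (Q <= P)%N) (Pn : (P <= n)%N).
Variables (I : incr n P) (J : incr n Q) (l : nat) (lQ : (l < Q)%N).
Let lP : (l < P)%N := leq_trans lQ QP.
Hypothesis JI : (tnth (val J) (Ordinal lQ) < tnth (val I) (Ordinal lP))%N.

Let In (a : nat) := nth (tnth (val I) (Ordinal lP)) (val I) a.
Let Jn (a : nat) := nth (tnth (val I) (Ordinal lP)) (val J) a.
Let Z (m : 'I_P.+1) : 'I_n := if (m <= l)%N then Jn m else In m.-1.
Let rl (s : 'S_P.+1) (a : 'I_P) : 'I_n := if (a < l)%N then In a else Z (s (lift ord0 a)).
Let wd (a : 'I_Q) : 'I_P.+1 := widen_ord (leqW QP) a.
Let rr (s : 'S_P.+1) (a : 'I_Q) : 'I_n := if (a <= l)%N then Z (s (wd a)) else Jn a.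

Definition first_cols k (g : 'M[K]_n) : 'M[K]_(n, k) := g *m pid_mx k.

Lemma first_colsE k (kn : (k <= n)%N) g x (b : 'I_k) : first_cols k g x b = g x (widen_ord kn b).
Proof.
rewrite mxE (bigD1 (widen_ord kn b)) //= !mxE /= eqxx ltn_ord mulr1 big1 ?addr0 // => d db.
by rewrite !mxE; case: eqP => [e|]; rewrite ?mulr0 //; case/eqP: db; apply: ord_inj.
Qed.

Lemma garnir_split (R : Type) (idx : R) (op : Monoid.com_law idx) (F : 'I_P.+1 -> R) :
  \big[op/idx]_(m < P.+1) F m =
  op (\big[op/idx]_(a < P | (l <= a)%N) F (lift ord0 a)) (\big[op/idx]_(a < Q | (a <= l)%N) F (wd a)).
Proof.
rewrite (bigID (fun m : 'I_P.+1 => (l < m)%N)) /=; congr (op _ _).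
  by rewrite big_mkcond big_ord_recl /= Monoid.mul1m -big_mkcond.
have := @big_ord_narrow_cond R idx op Q P.+1 (fun m : 'I_P.+1 => (m <= l)%N) F (leqW QP).
move=> /= <-.
apply: eq_bigl => m; rewrite -leqNgt; apply/idP/andP=> [ml|[]//]; split=> //.
exact: leq_ltn_trans ml lQ.
Qed.

(* With the rows Z = (J_0, ..., J_l, I_l, ..., I_(P-1)), [V s] is, up to
   sign, the product of the two minors in which these P + 1 rows are permuted by
   [s]. The sum of all [V s] is alternating in P + 1 vectors of length P. *)
Let V (s : 'S_P.+1) (g : 'M[K]_n) : K := (-1) ^+ s * \det (rowsub (rl s) (first_cols P g)) * \det (rowsub (rr s) (first_cols Q g)).

(** The shorter minor uses some of the P columns of the longer one. Expanding both, each choice of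
    columns yields a determinant of order P + 1 built from only P columns, so a repetition makes it
    vanish. *)
Lemma garnir_sum0 g : \sum_s V s g = 0.
Proof.
(* The column used at each of the P + 1 places. For [l < m] the predecessor [m.-1] undoes the shift
   by [lift ord0]. *)
pose col (pi : 'S_P) (rho : 'S_Q) (m : 'I_P.+1) : 'I_P :=
  if (l < m)%N then pi (insubd (Ordinal lP) m.-1) else widen_ord QP (rho (insubd (Ordinal lQ) m)).
pose fixd (pi : 'S_P) (rho : 'S_Q) :=
  (\prod_(a < P | (a < l)%N) first_cols P g (In a) (pi a)) *
  (\prod_(a < Q | ~~ (a <= l)%N) first_cols Q g (Jn a) (rho a)).
transitivity (\sum_(s : 'S_P.+1) \sum_(pi : 'S_P) \sum_(rho : 'S_Q) ((-1) ^+ pi * (-1) ^+ rho * fixd pi rho) *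
   ((-1) ^+ s * \prod_m first_cols P g (Z (s m)) (col pi rho m))).
  apply: eq_bigr => s _; rewrite /V /determinant -mulrA mulr_suml mulr_sumr; apply: eq_bigr => pi _.
  rewrite 2!mulr_sumr; apply: eq_bigr => rho _.
  have -> : \prod_a rowsub (rl s) (first_cols P g) a (pi a) =
    (\prod_(a < P | (a < l)%N) first_cols P g (In a) (pi a)) *
    (\prod_(a < P | (l <= a)%N) first_cols P g (Z (s (lift ord0 a))) (pi a)).
    rewrite (bigID (fun a : 'I_P => (a < l)%N)) /=; congr (_ * _).
      by apply: eq_bigr => a al; rewrite mxE /rl al.
    by apply: eq_big => [a|a al]; [rewrite -leqNgt | rewrite mxE /rl (negbTE al)].
  have -> : \prod_a rowsub (rr s) (first_cols Q g) a (rho a) =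
    (\prod_(a < Q | (a <= l)%N) first_cols P g (Z (s (wd a))) (widen_ord QP (rho a))) *
    (\prod_(a < Q | ~~ (a <= l)%N) first_cols Q g (Jn a) (rho a)).
    rewrite (bigID (fun a : 'I_Q => (a <= l)%N)) /=; congr (_ * _).
      apply: eq_bigr => a al; rewrite mxE /rr al (first_colsE Pn) (first_colsE (leq_trans QP Pn)).
      by congr (g _ _); apply: ord_inj.
    by apply: eq_bigr => a al; rewrite mxE /rr (negbTE al).
  have -> : \prod_m first_cols P g (Z (s m)) (col pi rho m) =
    (\prod_(a < P | (l <= a)%N) first_cols P g (Z (s (lift ord0 a))) (pi a)) *
    (\prod_(a < Q | (a <= l)%N) first_cols P g (Z (s (wd a))) (widen_ord QP (rho a))).
    rewrite garnir_split; congr (_ * _); apply: eq_bigr => a al; congr (first_cols P g _ _).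
      by rewrite /col /= ltnS al; congr (pi _); apply: ord_inj; rewrite val_insubd /= ltn_ord.
    rewrite /col /= ltnNge al /=; congr (widen_ord _ (rho _)); apply: ord_inj.
    by rewrite val_insubd /= ltn_ord.
  have R (x1 x2 x3 f1 f2 p1 p2 : K) : x1 * (x2 * (f1 * p1) * (x3 * (p2 * f2))) =
    x2 * x3 * (f1 * f2) * (x1 * (p1 * p2)) by ring.
  exact: R.
rewrite exchange_big big1 // => pi _; rewrite exchange_big big1 // => rho _.
rewrite -mulr_sumr.
pose N : 'M[K]_P.+1 := \matrix_(m, m') first_cols P g (Z m') (col pi rho m).
have -> : \sum_(s : 'S_P.+1) (-1) ^+ s * \prod_m first_cols P g (Z (s m)) (col pi rho m) = \det N.
  by apply: eq_bigr => s _; congr (_ * _); apply: eq_bigr => m _; rewrite [N _ _]mxE.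
have /injectivePn[m [m' mm e]] : ~~ injectiveb (col pi rho).
  apply/negP => /injectiveP inj; have := leq_card _ inj; by rewrite !card_ord ltnn.
by rewrite (determinant_alternate mm) ?mulr0 // => m1; rewrite !mxE e.
Qed.

(** A transposition inside one block changes the sign of [s] and of exactly one of the two
    minors. *)
Lemma garnir_tperm (s : 'S_P.+1) (x y : 'I_P.+1) g : x != y -> (x <= l)%N = (y <= l)%N ->
  V (tperm x y * s)%g g = V s g.
Proof.
move=> xy xyl; rewrite /V odd_mul_tperm xy /= signrN.
case: (leqP x l) xyl => [xl /esym yl|lx /esym/negbT]; last rewrite -ltnNge => ly.
  have xQ := leq_ltn_trans xl lQ; have yQ := leq_ltn_trans yl lQ.
  have -> : rowsub (rl (tperm x y * s)%g) (first_cols P g) = rowsub (rl s) (first_cols P g).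
    apply/matrixP => a b; rewrite !mxE /rl; case: ltnP => // la; rewrite permM tpermD //.
      by apply: contraTneq xl => ->; rewrite /= -ltnNge.
    by apply: contraTneq yl => ->; rewrite /= -ltnNge.
  rewrite (@det_rowsub_perm _ _ _ (rr s) _ (tperm (Ordinal xQ) (Ordinal yQ))) => [|a].
    rewrite odd_tperm (_ : _ != _); last first.
      by apply: contra xy => /eqP[e]; apply/eqP/ord_inj.
    by rewrite expr1 mulN1r !(mulNr, mulrN) opprK.
  rewrite /rr; case: tpermP => [->|->|ne1 ne2] /=.
  - by rewrite xl yl permM (_ : wd _ = x) ?tpermL; [congr (Z (s _))|]; apply: ord_inj.
  - by rewrite xl yl permM (_ : wd _ = y) ?tpermR; [congr (Z (s _))|]; apply: ord_inj.
  case: leqP => // al; rewrite permM tpermD //.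
    by apply: contra_notN ne1 => /eqP e; apply: ord_inj; rewrite /= e.
  by apply: contra_notN ne2 => /eqP e; apply: ord_inj; rewrite /= e.
have -> : rowsub (rr (tperm x y * s)%g) (first_cols Q g) = rowsub (rr s) (first_cols Q g).
  apply/matrixP => a b; rewrite !mxE /rr; case: leqP => // la; rewrite permM tpermD //.
    by apply: contraTneq lx => ->; rewrite /= -leqNgt.
  by apply: contraTneq ly => ->; rewrite /= -leqNgt.
have [x' ex] : exists x', x = lift ord0 x'.
  by case: (unliftP ord0 x) lx => [x' -> _|->] //; exists x'.
have [y' ey] : exists y', y = lift ord0 y'.
  by case: (unliftP ord0 y) ly => [y' -> _|->] //; exists y'.
rewrite (@det_rowsub_perm _ _ _ (rl s) _ (tperm x' y')) => [|a].
  rewrite odd_tperm (_ : _ != _); last by apply: contra xy => /eqP e; rewrite ex ey e.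
  by rewrite expr1 mulN1r !(mulNr, mulrN) opprK.
move: lx ly; rewrite ex ey /= !ltnS => lx ly; rewrite /rl permM; case: (tpermP x' y' a) => [->|->|ne1 ne2].
- by rewrite !(ltnNge _ l) lx ly /= tpermL.
- by rewrite !(ltnNge _ l) lx ly /= tpermR.
case: ltnP => // al; rewrite tpermD //; apply/eqP => /lift_inj e; [exact: ne1|exact: ne2].
Qed.

Let blk (s : 'S_P.+1) := [forall m : 'I_P.+1, (l < m)%N ==> (l < s m)%N].

Lemma blk_le (s : 'S_P.+1) (m : 'I_P.+1) : blk s -> (s m <= l)%N = (m <= l)%N.
Proof.
move=> /forallP h; pose B := [set m : 'I_P.+1 | (l < m)%N]%SET.
have sub : [set s m | m in B]%SET \subset B.
  by apply/fintype.subsetP => x /imsetP[y]; rewrite !inE => yl ->; exact: (implyP (h y)).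
have /eqP eB : [set s m | m in B]%SET == B by rewrite eqEcard sub (card_imset _ (@perm_inj _ s)) leqnn.
rewrite !(leqNgt _ l); congr (~~ _); apply/idP/idP; last exact: (implyP (h m)).
move=> sm; have : s m \in B by rewrite inE.
by rewrite -eB => /imsetP[m']; rewrite inE => lm' /perm_inj ->.
Qed.

(** Induction on the number of moved points; each is removed by a transposition inside a block. *)
Lemma garnir_blk s g : blk s -> V s g = V 1%g g.
Proof.
have [N] := ubnP #|[pred m | s m != m]|; elim: N s => // N IH s; rewrite ltnS => sN bs.
case: (pickP [pred m | s m != m]) => [m /= sm|h]; last first.
  have -> : s = 1%g by apply/permP => m; rewrite perm1; apply/eqP; exact: negbFE (h m).
  by [].
pose y := (s^-1)%g m; have sy : s y = m by rewrite permKV.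
have my : m != y by apply: contra sm => /eqP e; rewrite {1}e sy.
rewrite -(garnir_tperm _ _ my); last by rewrite -[in LHS]sy blk_le.
have bb : blk (tperm m y * s)%g.
  apply/forallP => z; apply/implyP; rewrite permM !ltnNge blk_le //.
  case: tpermP => // [->|->]; rewrite -?(blk_le y bs) ?sy //.
apply: IH => //; apply: leq_trans sN; apply: proper_card; apply/properP; split.
  apply/fintype.subsetP => z; rewrite !inE; case: (eqVneq z m) => [-> //|zm].
  rewrite permM; case: (eqVneq z y) => [->|zy]; first by rewrite sy.
  by rewrite tpermD // eq_sym.
by exists m; rewrite !inE // permM tpermL sy eqxx.
Qed.

Definition incr_sum k (t : incr n k) : nat := \sum_a tnth (val t) a.

Definition pair_minor (x : incr n P * incr n Q) (g : 'M[K]_n) : K :=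
  (wedge (first_cols P g) x.1 : K) * (wedge (first_cols Q g) x.2 : K).

(** Entry sum passes from the longer minor to the shorter one; this is the order in which
    straightening terminates. *)
Definition garnir_lower (x : incr n P * incr n Q) :=
  (incr_sum x.1 < incr_sum I)%N && (incr_sum x.1 + incr_sum x.2 == incr_sum I + incr_sum J)%N.

Lemma rl1 a : rl 1%g a = tnth (val I) a.
Proof.
rewrite /rl /Z perm1 /In lift0 [RHS](tnth_nth (tnth (val I) (Ordinal lP))) /=.
by case: (a < l)%N.
Qed.

Lemma rr1 a : rr 1%g a = tnth (val J) a.
Proof.
rewrite /rr /Z perm1 /Jn [RHS](tnth_nth (tnth (val I) (Ordinal lP))) /=.
by case: leqP.
Qed.

(** The violation [JI] gives J_0 < ... < J_l < I_l < ... < I_(P-1), so any exchange between the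
    blocks lowers the entries of the first minor. *)
Lemma garnir_rl_lt s : ~~ blk s -> (\sum_a rl s a < incr_sum I)%N.
Proof.
move=> /forallPn[m0]; rewrite negb_imply -leqNgt => /andP[lm sm].
have E s' : (\sum_a rl s' a = \sum_(a < P | (a < l)%N) In a + \sum_(m < P.+1 | (l < m)%N) Z (s' m))%N.
  rewrite (bigID (fun a : 'I_P => (a < l)%N)) /=; congr (_ + _)%N.
    by apply: eq_bigr => a al; rewrite /rl al.
  rewrite [RHS]big_mkcond big_ord_recl /= add0n -big_mkcond; apply: eq_big => a.
    by rewrite -leqNgt /= ltnS.
  by rewrite /rl => /negbTE ->.
have -> : incr_sum I = (\sum_a rl 1%g a)%N by apply: eq_bigr => a _; rewrite rl1.
rewrite !E ltn_add2l; under [X in (_ < X)%N]eq_bigr do rewrite perm1.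
apply: (@ltn_sum_perm _ Z (fun m => (l < m)%N) (tnth (val I) (Ordinal lP)) s m0) => //=.
- move=> m lm'; rewrite /Z (leqNgt m l) lm' /=.
  have mP : (m.-1 < P)%N by have := ltn_ord m; lia.
  rewrite -[In _](tnth_nth _ _ (Ordinal mP)).
  have : (l <= m.-1)%N by lia.
  rewrite leq_eqVlt => /orP[/eqP e|lt]; last by apply: ltnW; apply: incr_lt.
  by rewrite (_ : Ordinal mP = Ordinal lP) //; apply: ord_inj.
- move=> m; rewrite -leqNgt => ml; rewrite /Z ml.
  apply: leq_ltn_trans JI; have mQ := leq_ltn_trans ml lQ.
  rewrite -[Jn _](tnth_nth _ _ (Ordinal mQ)).
  move: ml; rewrite leq_eqVlt => /orP[/eqP e|lt]; last by apply: ltnW; apply: incr_lt.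
  by rewrite (_ : Ordinal mQ = Ordinal lQ) //; apply: ord_inj.
by rewrite -leqNgt.
Qed.

Lemma garnir_total s : (\sum_a rl s a + \sum_a rr s a = incr_sum I + incr_sum J)%N.
Proof.
have E s' : (\sum_a rl s' a + \sum_a rr s' a = (\sum_(a < P | (a < l)%N) In a +
   \sum_(a < Q | ~~ (a <= l)%N) Jn a) + \sum_m Z (s' m))%N.
  rewrite (bigID (fun a : 'I_P => (a < l)%N)) /= (bigID (fun a : 'I_Q => (a <= l)%N)) /=.
  rewrite garnir_split [RHS]addnACA [X in _ = (_ + X)%N]addnC; congr (_ + _ + (_ + _))%N.
  - by apply: eq_bigr => a al; rewrite /rl al.
  - by apply: eq_big => a; [rewrite -leqNgt|rewrite /rl => /negbTE ->].
  - by apply: eq_bigr => a al; rewrite /rr al.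
  - by apply: eq_bigr => a al; rewrite /rr (negbTE al).
have -> : incr_sum I = (\sum_a rl 1%g a)%N by apply: eq_bigr => a _; rewrite rl1.
have -> : incr_sum J = (\sum_a rr 1%g a)%N by apply: eq_bigr => a _; rewrite rr1.
rewrite !E; congr (_ + _)%N; rewrite [RHS](reindex_inj (@perm_inj _ s)) /=.
by apply: eq_bigr => m _; rewrite perm1.
Qed.

Lemma garnir : spanned pair_minor garnir_lower (pair_minor (I, J)).
Proof.
have V1 g : V 1%g g = pair_minor (I, J) g.
  rewrite /V odd_perm1 expr0 mul1r /pair_minor !wedgeE /=.
  have -> : rowsub (rl 1%g) (first_cols P g) = rowsub (tnth (val I)) (first_cols P g).
    by apply/matrixP => a b; rewrite !mxE rl1.
  have -> // : rowsub (rr 1%g) (first_cols Q g) = rowsub (tnth (val J)) (first_cols Q g).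
  by apply/matrixP => a b; rewrite !mxE rr1.
have Vs s : ~~ blk s -> spanned pair_minor garnir_lower (V s).
  move=> bs; case: (boolP (injectiveb (rl s))) => [/injectiveP il|ni]; last first.
    apply: spanned_ext (spanned0 _ _) => g; by rewrite /V det_rowsub_noninj // mulr0 mul0r.
  case: (boolP (injectiveb (rr s))) => [/injectiveP ir|ni]; last first.
    apply: spanned_ext (spanned0 _ _) => g; by rewrite /V (det_rowsub_noninj _ ni) mulr0.
  have [t [p tp]] := incr_sort il; have [t' [p' tp']] := incr_sort ir.
  have St : incr_sum t = (\sum_a rl s a)%N.
    by rewrite /incr_sum (reindex_inj (@perm_inj _ p)) /=; apply: eq_bigr => a _; rewrite tp.
  have St' : incr_sum t' = (\sum_a rr s a)%N.
    by rewrite /incr_sum (reindex_inj (@perm_inj _ p')) /=; apply: eq_bigr => a _; rewrite tp'.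
  apply: (@spanned_ext _ _ _ _ _ (fun g => ((-1) ^+ s * (-1) ^+ p * (-1) ^+ p') * pair_minor (t, t') g)).
    move=> g; rewrite /V (det_rowsub_perm _ tp) (det_rowsub_perm _ tp') /pair_minor !wedgeE /=.
      have R (x1 x2 x3 d1 d2 : K) : x1 * (x2 * d1) * (x3 * d2) = x1 * x2 * x3 * (d1 * d2) by ring.
      exact/esym/R.
  apply: spannedZ; apply: spanned_mem; rewrite /garnir_lower /= St St' garnir_total eqxx andbT.
  exact: garnir_rl_lt.
(* The number of permutations preserving the two blocks: all of them contribute the same product,
   which is isolated by dividing by [N] in characteristic zero. *)
pose N := #|[pred s | blk s]|.
have N0 : N%:R != 0 :> K.
  rewrite pnatr_eq0 -lt0n; apply/card_gt0P; exists 1%g.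
  by rewrite inE; apply/forallP => m; rewrite perm1; apply/implyP.
apply: (@spanned_ext _ _ _ _ _ (fun g => - N%:R^-1 * \sum_(s | ~~ blk s) V s g)).
  move=> g; have := garnir_sum0 g; rewrite (bigID blk) /=.
  rewrite (eq_bigr (fun _ => V 1%g g)) => [|s bs]; last exact: garnir_blk.
  rewrite sumr_const -/N -V1 => /eqP; rewrite addr_eq0 => /eqP e.
  by apply: (mulfI N0); rewrite [RHS]mulr_natl e mulNr mulrN mulVKf.
by apply: spannedZ; apply: spanned_sum.
Qed.

End Garnir.

(** * Tableaux and the straightening algorithm *)

Section Tableaux.
Variables (n : nat) (mu : 'I_n.-1 -> nat).
Notation tb := (tbasis mu).
Notation ps := (pos mu).

Definition ent k (t : incr n k) (l : nat) : nat := nth 0%N [seq val i | i <- val t] l.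

Lemma entE k (t : incr n k) (a : 'I_k) : ent t a = tnth (val t) a.
Proof. by rewrite /ent (nth_map (tnth (val t) a)) ?size_tuple // -tnth_nth. Qed.

Lemma ent_eq k (t t' : incr n k) : (forall a, (a < k)%N -> ent t a = ent t' a) -> t = t'.
Proof.
move=> h; apply: val_inj; apply: eq_from_tnth => a; apply: ord_inj.
by rewrite -!entE h.
Qed.

(** Longer columns come first, columns of equal length follow their index; the base exceeds every
    such index. *)
Definition rank (p : ps) : nat :=
  ((n - tag p) * (\sum_k mu k).+1 + tagged p)%N.

Lemma mu_lt_sum (p : ps) : (tagged p < (\sum_k mu k).+1)%N.
Proof.
apply: leq_trans (ltnW (ltn_ord (tagged p))) _ => //.
by rewrite (bigD1 (tag p)) //= leq_addr.
Qed.

Lemma rank_inj : injective rank.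
Proof.
move=> p p' e; have := mu_lt_sum p; have := mu_lt_sum p'; move: e; rewrite /rank.
case: p p' => [k i] [k' i'] /=; set B := (\sum_k mu k).+1 => e h' h.
have ek : (n - k = n - k')%N.
  have := congr1 (fun x => x %/ B)%N e.
  by rewrite !divnMDl // !divn_small // !addn0.
have kk : k = k'.
  by apply: ord_inj; have := ltn_ord k; have := ltn_ord k'; lia.
subst k'; congr (existT _ _ _); apply: ord_inj; move: e; lia.
Qed.

Lemma rank_tag p p' : (rank p < rank p')%N -> (tag p' <= tag p)%N.
Proof.
rewrite /rank; have := mu_lt_sum p; have := mu_lt_sum p'.
set B := (\sum_k mu k).+1 => h' h lt; rewrite leqNgt; apply/negP => kk.
have : (n - tag p' + 1 <= n - tag p)%N by have := ltn_ord (tag p'); lia.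
move=> le; have := leq_mul le (leqnn B); rewrite mulnDl mul1n.
move: lt h h'; clear; set x := (_ * B)%N; set y := (_ * B)%N; lia.
Qed.

(** Semistandardness: columns are strictly increasing by the type [incr], and rows are weakly
    increasing along [rank]. *)
Definition standard (b : tb) := [forall p, forall p', (rank p < rank p')%N ==>
  [forall l : 'I_n, (l <= tag p')%N ==> (ent (b p) l <= ent (b p') l)%N]].

Lemma standardP (b : tb) : reflect (forall p p' l, (rank p < rank p')%N -> (l <= tag p')%N ->
  (ent (b p) l <= ent (b p') l)%N) (standard b).
Proof.
apply: (iffP forallP) => [h p p' l pp lp|h p].
  have ln : (l < n)%N by have := ltn_ord (tag p'); lia.
  have /forallP/(_ p')/implyP/(_ pp)/forallP/(_ (Ordinal ln))/implyP := h p.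
  exact.
apply/forallP => p'; apply/implyP => pp; apply/forallP => l; apply/implyP; exact: h.
Qed.

Definition upd2 (b : tb) (p p' : ps) (x : incr n (tag p).+1 * incr n (tag p').+1) : tb :=
  [ffun q => dfwith (dfwith b x.1) x.2 q].

Lemma upd2E (b : tb) (p p' : ps) x : p != p' -> [/\ upd2 b x p = x.1, upd2 b x p' = x.2 &
  forall q, q != p -> q != p' -> upd2 b x q = b q].
Proof.
move=> pp; split=> [||q qp qp']; rewrite ffunE ?dfwith_in //.
  by rewrite dfwith_out ?dfwith_in // eq_sym.
by rewrite !dfwith_out // eq_sym.
Qed.

(** A potential that every Garnir step raises, because entry sum moves to a column of larger rank
    while the total is kept. *)
Definition meas (b : tb) : nat := \sum_p rank p * incr_sum (b p).

Variable K : numFieldType.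

Definition flag_vec (g : 'M[K]_n) (k : 'I_n.-1) : ext K n k.+1 := wedge (first_cols k.+1 g).

Definition tmon (v : forall k : 'I_n.-1, ext K n k.+1) (b : tb) : K :=
  \prod_(p : ps) (v (tag p) (b p) : K).

Lemma straightening (b : tb) : spanned (fun b g => tmon (flag_vec g) b) standard
   (fun g => tmon (flag_vec g) b).
Proof.
(* The sum over all tableaux is a crude upper bound of [meas]; the induction is on the distance to
   it. *)
have [N] := ubnP (\sum_b meas b - meas b)%N; elim: N b => // N IH b; rewrite ltnS => bN.
case: (boolP (standard b)) => [sb|]; first exact: (@spanned_mem _ _ _ (fun b g => tmon (flag_vec g) b) standard b sb).
case/forallPn => p /forallPn[p']; rewrite negb_imply => /andP[pp /forallPn[l]].
rewrite negb_imply -ltnNge => /andP[lp lt].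
have npp : p != p' by apply: contraTneq pp => ->; rewrite ltnn.
have QP : ((tag p').+1 <= (tag p).+1)%N by rewrite ltnS; exact: rank_tag pp.
have Pn : ((tag p).+1 <= n)%N by have := ltn_ord (tag p); lia.
have JI : (tnth (val (b p')) (Ordinal (lp : (l < (tag p').+1)%N)) <
           tnth (val (b p)) (Ordinal (leq_trans (lp : (l < (tag p').+1)%N) QP)))%N.
  by rewrite -!entE.
have [kap [k0 kE]] := garnir K Pn JI.
pose rest g := \prod_(q | (q != p) && (q != p')) (flag_vec g (tag q) (b q) : K).
have monE g (x : incr n (tag p).+1 * incr n (tag p').+1) : tmon (flag_vec g) (upd2 b x) = pair_minor x g * rest g.
  have [e1 e2 e3] := upd2E b x npp.
  rewrite /tmon (bigD1 p) //= (bigD1 p') //= 1?eq_sym // e1 e2 mulrA; congr (_ * _).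
  by apply: eq_bigr => q /andP[qp qp']; rewrite e3.
have bE : upd2 b (b p, b p') = b.
  have [e1 e2 e3] := upd2E b (b p, b p') npp.
  apply/ffunP => q; case: (eqVneq q p) => [->|qp]; first by rewrite e1.
  by case: (eqVneq q p') => [->|qp']; rewrite ?e2 ?e3.
apply: (@spanned_ext _ _ _ _ _ (fun g => \sum_(x | garnir_lower (b p) (b p') x) kap x * tmon (flag_vec g) (upd2 b x))).
  move=> g; rewrite -[in RHS]bE monE kE mulr_suml [RHS](bigID (garnir_lower (b p) (b p'))) /=.
  rewrite [X in _ = _ + X]big1 ?addr0 => [|x /k0 ->]; last by rewrite !mul0r.
  by apply: eq_bigr => x _; rewrite monE mulrA.
apply: spanned_sum => x /andP[lt1 /eqP eq1]; apply: spannedZ; apply: IH.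
have [e1 e2 e3] := upd2E b x npp.
have mE b' : (meas b' = rank p * incr_sum (b' p) + (rank p' * incr_sum (b' p') +
   \sum_(q | (q != p) && (q != p')) rank q * incr_sum (b' q)))%N.
  by rewrite /meas (bigD1 p) //= (bigD1 p') //= eq_sym.
have : (meas b < meas (upd2 b x))%N.
  rewrite !mE e1 e2.
  have -> : (\sum_(q | (q != p) && (q != p')) rank q * incr_sum (upd2 b x q) =
             \sum_(q | (q != p) && (q != p')) rank q * incr_sum (b q))%N.
    by apply: eq_bigr => q /andP[qp qp']; rewrite e3.
  rewrite addnA [X in (_ < X)%N]addnA ltn_add2r.
  move: lt1 eq1 pp; clear; set a1 := rank p; set a2 := rank p'.
  by set s1 := incr_sum _; set s2 := incr_sum _; set s3 := incr_sum _; set s4 := incr_sum _; nia.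
have : (meas (upd2 b x) <= \sum_b meas b)%N by rewrite (bigD1 (upd2 b x)) //= leq_addr.
move: bN; clear; lia.
Qed.

End Tableaux.

(** * Independence of standard monomials on the orbit *)

Lemma digits_lt (M B : nat) (d : nat -> nat) : (forall m, (m < M)%N -> (d m < B)%N) ->
  (\sum_(m < M) d m * B ^ m < B ^ M)%N.
Proof.
elim: M => [|M IH] h; first by rewrite big_ord0 expn0.
rewrite big_ord_recr /= expnS.
have := IH (fun m hm => h m (ltnW hm)); have := h M (ltnSn M).
set x := (\sum_(m < M) _)%N; move: (B ^ M)%N => y dB xy.
have : (d M * y + y <= B * y)%N by rewrite -mulSnr leq_mul2r dB orbT.
lia.
Qed.

Lemma digits_inj (M B : nat) (d d' : nat -> nat) :
  (forall m, (m < M)%N -> (d m < B)%N) -> (forall m, (m < M)%N -> (d' m < B)%N) ->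
  (\sum_(m < M) d m * B ^ m = \sum_(m < M) d' m * B ^ m)%N ->
  forall m, (m < M)%N -> d m = d' m.
Proof.
elim: M => [//|M IH] h h'; rewrite !big_ord_recr /= => e.
have l1 := digits_lt (fun m hm => h m (ltnW hm)).
have l2 := digits_lt (fun m hm => h' m (ltnW hm)).
have B0 : (0 < B ^ M)%N by exact: leq_ltn_trans l1.
have eM : d M = d' M.
  have := congr1 (fun x => x %/ B ^ M)%N e.
  by rewrite ![(_ + _ * B ^ M)%N]addnC !divnMDl // !divn_small // !addn0.
move=> m; rewrite ltnS leq_eqVlt => /orP[/eqP -> //|]; apply: IH.
- by move=> m' hm; apply: h; exact: ltnW.
- by move=> m' hm; apply: h'; exact: ltnW.
by move: e; rewrite eM => /addIn.
Qed.

Section Independence.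
Variables (n : nat) (mu : 'I_n.-1 -> nat).
Notation tb := (tbasis mu).
Notation ps := (pos mu).

Definition content (b : tb) (i x : nat) : nat :=
  #|[pred p : ps | (i <= tag p)%N && (ent (b p) i == x)]|.

Lemma ent_ge k (t : incr n k) a : (a < k)%N -> (a <= ent t a)%N.
Proof. by move=> ak; rewrite (entE t (Ordinal ak)); exact: (incr_ge t (Ordinal ak)). Qed.

Lemma ent_lt k (t : incr n k) a : (a < k)%N -> (ent t a < n)%N.
Proof. by move=> ak; rewrite (entE t (Ordinal ak)) ltn_ord. Qed.

Lemma sum_content (b : tb) (i : nat) (v : nat) :
  #|[pred p : ps | (i <= tag p)%N && (ent (b p) i < v)%N]| = (\sum_(x < v) content b i x)%N.
Proof.
case: v => [|v]; first by rewrite big_ord0; apply: eq_card0 => p; rewrite !inE andbF.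
rewrite -sum1_card (partition_big (fun p => inord (ent (b p) i) : 'I_v.+1) predT) //=.
apply: eq_bigr => x _; rewrite /content -sum1_card; apply: eq_bigl => p.
rewrite !inE -andbA; congr (_ && _); apply/andP/eqP => [[le /eqP <-]|->]; first by rewrite inordK.
have xv := ltn_ord x; split=> //; by rewrite inord_val.
Qed.

(** Row [i] of a standard tableau is weakly increasing in rank, so it is the sorted listing of its
    content and each entry can be read off by counting. *)
Lemma standard_ent (b : tb) (p : ps) (i v : nat) : standard b -> (i <= tag p)%N ->
  (ent (b p) i <= v)%N =
  (#|[pred q : ps | (i <= tag q)%N && (rank q < rank p)%N]| < \sum_(x < v.+1) content b i x)%N.
Proof.
move=> /standardP sb ip; rewrite -(sum_content b i v.+1); apply/idP/idP => [le|].
  apply: proper_card; apply/properP; split; last first.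
    by exists p; rewrite !inE ?ip ?le // ltnn andbF.
  apply/fintype.subsetP => q; rewrite !inE => /andP[iq qp]; rewrite iq /=.
  exact: leq_trans (sb _ _ _ qp ip) le.
apply: contraTT; rewrite -ltnNge -leqNgt => lt; apply: subset_leq_card.
apply/fintype.subsetP => q; rewrite !inE => /andP[iq qv]; rewrite iq /=.
rewrite ltnNge leq_eqVlt; apply/negP => /orP[/eqP/rank_inj e|/sb h].
  by move: qv; rewrite -e ltnNge lt.
by have := leq_trans (leq_trans lt (h _ iq)) qv; rewrite ltnn.
Qed.

(** Entries of row [i] are at least [i] and the row length is fixed by the shape, so the counts with
    [i < x] determine the diagonal count. These counts are the exponents of c_(i,x) in the diagonal
    term of the monomial. *)
Lemma standard_inj (b b' : tb) : standard b -> standard b' ->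
  (forall i x, (i < x < n)%N -> content b i x = content b' i x) -> b = b'.
Proof.
move=> sb sb' h.
have small (b0 : tb) i x : (x < i)%N -> content b0 i x = 0%N.
  move=> xi; apply: eq_card0 => p; rewrite !inE; apply/negP => /andP[ip /eqP e].
  by have := @ent_ge _ (b0 p) i ip; rewrite e leqNgt xi.
have tot (b0 : tb) (i : nat) : (\sum_(x < n) content b0 i x)%N = #|[pred p : ps | (i <= tag p)%N]|.
  rewrite -sum_content; apply: eq_card => p; rewrite !inE; case: (leqP i (tag p)) => //= ip.
  by rewrite ent_lt.
have eq i x : (x < n)%N -> content b i x = content b' i x.
  move=> xn; case: (ltngtP x i) => [xi|ix|->]; first by rewrite !small.
    by apply: h; rewrite ix.
  case: (ltnP i n) => [iN|ni]; last first.
    by rewrite /content !eq_card0 // => p; rewrite !inE; have := ltn_ord (tag p); lia.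
  have := tot b i; rewrite -(tot b' i) (bigD1 (Ordinal iN)) //= [RHS](bigD1 (Ordinal iN)) //=.
  have -> : (\sum_(x < n | x != Ordinal iN) content b i x = \sum_(x < n | x != Ordinal iN) content b' i x)%N.
    apply: eq_bigr => y yi; case: (ltngtP y i) => [lt|lt|e]; first by rewrite !small.
      by apply: h; rewrite lt ltn_ord.
    by case/eqP: yi; apply: ord_inj.
  by move/addIn.
apply/ffunP => p; apply: ent_eq => i; rewrite ltnS => ip.
have cmp v : (v < n)%N -> (ent (b p) i <= v)%N = (ent (b' p) i <= v)%N.
  move=> vn; rewrite (standard_ent _ sb) // (standard_ent _ sb') //; congr (_ < _)%N.
  by apply: eq_bigr => x _; apply: eq; apply: leq_trans vn; rewrite ltnS -ltnS.
apply/eqP; rewrite eqn_leq cmp ?ent_lt ?ltnS // leqnn.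
by rewrite -cmp ?ent_lt ?ltnS // leqnn.
Qed.

(* weights of the coordinates: the square makes them strictly Monge, so that the
   diagonal term of each minor is its term of lowest weight; the digits
   in base [wbase] separate the diagonal terms of the standard monomials *)
Definition wbase : nat := #|ps|.+1.
Definition wtop : nat := (4 * (wbase ^ n) ^ n)%N.
Definition wt (i x : nat) : nat :=
  if (i < x)%N then (wtop * (x - i) ^ 2 + wbase ^ x * (wbase ^ n) ^ i)%N else 0%N.

Definition mon_wt k (t : incr n k) : nat := \sum_(a < k) wt a (tnth (val t) a).

Definition tab_wt (b : tb) : nat := \sum_p mon_wt (b p).

Lemma content_lt b i x : (content b i x < wbase)%N.
Proof. by rewrite ltnS; exact: max_card. Qed.

Lemma tab_wtE b : tab_wt b = (\sum_(i < n) \sum_(x < n) content b i x * wt i x)%N.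
Proof.
rewrite /tab_wt.
have E p : mon_wt (b p) = (\sum_(i < n) \sum_(x < n) ((i <= tag p)%N && (ent (b p) i == x)) * wt i x)%N.
  have kn : ((tag p).+1 <= n)%N by have := ltn_ord (tag p); lia.
  rewrite /mon_wt; transitivity (\sum_(i < n | (i < (tag p).+1)%N) wt i (ent (b p) i))%N.
    rewrite (big_ord_narrow kn) /=; apply: eq_bigr => a _; by rewrite entE.
  rewrite big_mkcond; apply: eq_bigr => i _; rewrite ltnS; case: ifP => ip /=; last by rewrite big1.
  have xn := @ent_lt _ (b p) i ip.
  rewrite (bigD1 (Ordinal xn)) //= eqxx mul1n big1 ?addn0 // => x xe.
  by case: eqP => // e; case/eqP: xe; apply: ord_inj.
under eq_bigr do rewrite E; rewrite exchange_big; apply: eq_bigr => i _.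
rewrite exchange_big; apply: eq_bigr => x _; rewrite -big_distrl /=; congr (_ * _)%N.
by rewrite /content -sum1_card [RHS]big_mkcond.
Qed.

(** Reduction modulo [wtop] strips the square part; digits in base [wbase ^ n] then separate the
    rows, and digits in base [wbase] the entries of a row. *)
Lemma tab_wt_inj b b' : standard b -> standard b' -> tab_wt b = tab_wt b' -> b = b'.
Proof.
move=> sb sb' e; apply: standard_inj => // i x /andP[ix xn].
pose d (b : tb) (i x : nat) := if (i < x)%N then content b i x else 0%N.
have dl b0 i0 x0 : (d b0 i0 x0 < wbase)%N by rewrite /d; case: ifP => // _; exact: content_lt.
have dl2 b0 i0 : (\sum_(x0 < n) d b0 i0 x0 * wbase ^ x0 < wbase ^ n)%N by apply: digits_lt => *; exact: dl.
pose W b0 := (\sum_(i0 < n) (\sum_(x0 < n) d b0 i0 x0 * wbase ^ x0) * (wbase ^ n) ^ i0)%N.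
have Wl b0 : (W b0 < wtop)%N.
  apply: (@leq_trans ((wbase ^ n) ^ n)); last by rewrite leq_pmull.
  by apply: (@digits_lt n (wbase ^ n) (fun i0 => \sum_(x0 < n) d b0 i0 x0 * wbase ^ x0)%N).
have E b0 : tab_wt b0 = ((\sum_(i0 < n) \sum_(x0 < n) d b0 i0 x0 * (x0 - i0) ^ 2) * wtop + W b0)%N.
  rewrite tab_wtE big_distrl -big_split; apply: eq_bigr => i0 _ /=.
  rewrite !big_distrl -big_split; apply: eq_bigr => x0 _ /=.
  rewrite /wt /d; case: ifP => _; last by rewrite !(muln0, mul0n).
  by rewrite mulnDr [(wtop * _)%N]mulnC !mulnA.
have eW : W b = W b'.
  have t0 : (0 < wtop)%N by exact: leq_ltn_trans (Wl b).
  by have := congr1 (fun x => x %% wtop)%N e; rewrite !E !modnMDl !modn_small.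
have e1 := @digits_inj n (wbase ^ n) (fun i0 => \sum_(x0 < n) d b i0 x0 * wbase ^ x0)%N
   (fun i0 => \sum_(x0 < n) d b' i0 x0 * wbase ^ x0)%N (fun m _ => dl2 b m) (fun m _ => dl2 b' m) eW i (ltn_trans ix xn).
have := @digits_inj n wbase (d b i) (d b' i) (fun m _ => dl b i m) (fun m _ => dl b' i m) e1 x xn.
by rewrite /d ix.
Qed.

Lemma wt_monge (r l x y : nat) : (r < l)%N -> (l <= x)%N -> (x < y)%N -> (y < n)%N ->
  (wt r x + wt l y + 1 <= wt r y + wt l x)%N.
Proof.
move=> rl lx xy yn; have b i z : (i < n)%N -> (z < n)%N -> (wbase ^ z * (wbase ^ n) ^ i <= (wbase ^ n) ^ n)%N.
  move=> i_n zn; apply: (@leq_trans ((wbase ^ n) ^ i.+1)).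
    by rewrite expnS leq_mul // leq_pexp2l // ltnW.
  by rewrite leq_pexp2l // expn_gt0.
have b1 := b r x (leq_trans rl (leq_trans lx (ltnW (ltn_trans xy yn)))) (ltn_trans xy yn).
have b2 := b l y (leq_ltn_trans lx (ltn_trans xy yn)) yn.
have T0 : (0 < (wbase ^ n) ^ n)%N by rewrite !expn_gt0.
(* The gain is 2 (l - r) (y - x), at least 2. Multiplied by [wtop] it absorbs the two digit terms on
   the left, each of which is at most a quarter of [wtop]. *)
have sq : ((x - r) ^ 2 + (y - l) ^ 2 + 2 <= (y - r) ^ 2 + (x - l) ^ 2)%N.
  have [u xu] : exists u, x = (l + u)%N by exists (x - l)%N; lia.
  have [v yv] : exists v, y = (x + v)%N by exists (y - x)%N; lia.
  have [w lw] : exists w, l = (r + w)%N by exists (l - r)%N; lia.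
  subst y x l.
  have -> : (r + w + u - r = w + u)%N by lia.
  have -> : (r + w + u + v - (r + w) = u + v)%N by lia.
  have -> : (r + w + u + v - r = w + u + v)%N by lia.
  have -> : (r + w + u - (r + w) = u)%N by lia.
  rewrite -!mulnn; nia.
rewrite /wt (leq_trans rl lx) (leq_ltn_trans lx xy) (ltn_trans rl (leq_ltn_trans lx xy)).
apply: (@leq_trans (wtop * ((y - r) ^ 2 + (x - l) ^ 2))%N).
  have key (T c1 c2 s1 s2 s3 s4 : nat) : (0 < T -> c1 <= T -> c2 <= T -> s1 + s2 + 2 <= s3 + s4 ->
      4 * T * s1 + c1 + (4 * T * s2 + c2) + 1 <= 4 * T * (s3 + s4))%N.
    move=> t0 h1 h2 h3; have := leq_mul (leqnn (4 * T)) h3.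
    rewrite !mulnDr; move: (4 * T * s1)%N (4 * T * s2)%N (4 * T * s3)%N (4 * T * s4)%N.
    by move: t0 h1 h2; clear; lia.
  exact: key.
rewrite mulnDr; apply: leq_add; first exact: leq_addr.
case: ltnP => lx'; first exact: leq_addr.
by rewrite (_ : x - l = 0)%N ?exp0n ?muln0 //; apply/eqP.
Qed.

Variables (K : numFieldType) (A : 'I_n -> 'I_n -> int).
Hypothesis hA1 : forall i j k : 'I_n, j = i.+1 :> nat -> k = j.+1 :> nat ->
     A i j + A j k <= A i k.
Hypothesis hA2 : forall i i' j j' : 'I_n, i' = i.+1 :> nat -> j' = j.+1 :> nat ->
     (i.+1 < j)%N -> A i j + A i' j' <= A i j' + A i' j.

Definition orbit_fam (c : 'I_n -> 'I_n -> K) (k : 'I_n.-1) : ext K n k.+1 := orbit_vec A k.+1 0 c.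

Lemma wt_min k (t : incr n k) (p : 'S_k) : (forall a : 'I_k, (a <= tnth (val t) (p a))%N) ->
  (mon_wt t + (p != 1%g) <= \sum_(a < k) wt a (tnth (val t) (p a)))%N.
Proof.
move=> ad.
have := @rearrangement k (fun a b => (a <= tnth (val t) b)%N)
  (fun a b => (wt a (tnth (val t) b))%:Z) 1 ler01 _ _ _ p ad.
rewrite mulr1 /mon_wt -!(big_morph Posz PoszD (erefl _)) => h.
rewrite -lez_nat PoszD; apply: le_trans (h _ _ _).
- by case: (p != 1%g).
- by move=> r l x rl; apply: leq_trans; exact: ltnW.
- by move=> l x y xy lx; apply: leq_trans lx _; apply: ltnW; exact: incr_lt.
- by move=> r l x y rl xy lx; have := @wt_monge r l _ _ rl lx (incr_lt t xy) (ltn_ord _); lia.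
Qed.

(** Some terms of the minor disappear at s = 0, but the diagonal one has minimal cost and stays with
    coefficient 1. Strictness in [wt_min] makes it the only term of lowest weight. *)
Lemma orbit_lead k (kn : (k <= n)%N) (t : incr n k) : exists r : {poly K}, r.[0] = 1 /\
  forall u, orbit_vec A k 0 (fun i x => u ^+ wt i x) t = u ^+ mon_wt t * r.[u].
Proof.
pose adm (p : 'S_k) := [forall a : 'I_k, (a <= tnth (val t) (p a))%N].
pose eps (p : 'S_k) : K := (-1) ^+ p *
  0 ^+ absz (\sum_(b < k) cost A b (tnth (val t) (p b)) - sigma A t)%R.
pose ex (p : 'S_k) := (\sum_(a < k) wt a (tnth (val t) (p a)) - mon_wt t)%N.
exists (\sum_(p | adm p) eps p *: 'X^(ex p)); split=> [|u].
  rewrite horner_sum (bigD1 1%g) /=; last first.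
    by apply/forallP => a; rewrite perm1 incr_ge.
  rewrite big1 ?addr0 => [|p /andP[/forallP ap p1]].
    rewrite hornerZ hornerXn /ex /eps odd_perm1.
    have -> : (\sum_(a < k) wt a (tnth (val t) ((1%g : 'S_k) a)) = mon_wt t)%N.
      by apply: eq_bigr => a _; rewrite perm1.
    have -> : \sum_(b < k) cost A b (tnth (val t) ((1%g : 'S_k) b)) = sigma A t.
      by rewrite sigmaE; apply: eq_bigr => a _; rewrite perm1.
    by rewrite subnn subrr !expr0 !mulr1.
  rewrite hornerZ hornerXn expr0n /ex; have := wt_min ap; rewrite p1.
  move=> lt1; have /negbTE -> : (\sum_(a < k) wt a (tnth (val t) (p a)) - mon_wt t)%N != 0%N.
    by rewrite subn_eq0 -ltnNge -addn1.
  by rewrite mulr0.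
rewrite (orbit_vecE hA1 hA2 kn) horner_sum mulr_sumr (bigID adm) /= [X in _ + X]big1 ?addr0.
  apply: eq_bigr => p ap; rewrite hornerZ hornerXn /eps [RHS]mulrCA -exprD /ex subnKC; last first.
    by apply: leq_trans (wt_min (forallP ap)); rewrite leq_addr.
  rewrite -!mulrA; congr (_ * _); rewrite mulrC; congr (_ * _).
  rewrite expr_sum; apply: eq_bigr => b _; rewrite /uni_coef -(inj_eq (@ord_inj _)) /=.
  have /forallP/(_ b) := ap; rewrite leq_eqVlt; case: eqP => [<- _|_ /= ->//].
  by rewrite /wt ltnn expr0.
move=> p /forallPn[a]; rewrite -ltnNge => lt; rewrite (bigD1 a) //= /uni_coef.
rewrite -(inj_eq (@ord_inj _)) /= gtn_eqF // ltnNge ltnW //=.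
by rewrite mul0r mulr0 mul0r.
Qed.

(** Among the tableaux with nonzero coefficient, one of least weight is alone in contributing to
    that power of u, by [tab_wt_inj]. *)
Lemma standard_free (kap : tb -> K) : (forall b, ~~ standard b -> kap b = 0) ->
  (forall c, \sum_b kap b * tmon (orbit_fam c) b = 0) -> forall b, kap b = 0.
Proof.
move=> kst kz b; apply/eqP/negPn/negP => kb.
case: (@arg_minnP _ b (fun b => kap b != 0) tab_wt kb) => b0 kb0 bmin.
have kn p : ((tag p : 'I_n.-1).+1 <= n)%N by have := ltn_ord (tag p); lia.
have /choice[r rP] : forall x : {k : 'I_n.-1 & incr n k.+1}, exists r : {poly K}, r.[0] = 1 /\
  forall u, orbit_fam (fun i x => u ^+ wt i x) (tag x) (tagged x) = u ^+ mon_wt (tagged x) * r.[u] :> K.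
  by move=> [k t]; exact: orbit_lead (kn (fun k => incr n k.+1) (existT _ k t)) t.
pose R (b : tb) := \prod_p r (Tagged (fun k : 'I_n.-1 => incr n k.+1) (b p)).
have R0 b1 : (R b1).[0] = 1.
  by rewrite horner_prod big1 // => p _; case: (rP (Tagged (fun k : 'I_n.-1 => incr n k.+1) (b1 p))).
have P0 : \sum_b kap b *: ('X^(tab_wt b) * R b) = 0.
  apply: poly_eq0_away0 => u _; rewrite horner_sum -[RHS](kz (fun i x => u ^+ wt i x)).
  apply: eq_bigr => b1 _; rewrite hornerZ hornerM hornerXn horner_prod; congr (_ * _).
  rewrite /tmon /tab_wt expr_sum -big_split; apply: eq_bigr => p _ /=.
  by case: (rP (Tagged (fun k : 'I_n.-1 => incr n k.+1) (b1 p))) => _ ->.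
have := congr1 (fun p : {poly K} => p`_(tab_wt b0)) P0; rewrite coef0 coef_sum (bigD1 b0) //=.
rewrite big1 => [|b1 b10].
  rewrite addr0 coefZ coefXnM ltnn subnn -horner_coef0 R0 mulr1 => e.
  by rewrite e eqxx in kb0.
rewrite coefZ coefXnM; case: ltnP => [|le]; first by rewrite mulr0.
case: (eqVneq (kap b1) 0) => [->|kb1]; first by rewrite mul0r.
case/eqP: b10; apply: tab_wt_inj.
- by apply: contraNT kb1 => /kst ->.
- by apply: contraNT kb0 => /kst ->.
by apply/eqP; rewrite eqn_leq le bmin.
Qed.

End Independence.

(** * The initial ideal of the Plücker relations *)

Lemma linfun_linear (K : fieldType) (U V : vectType K) (f : U -> V) :
  linear f -> linfun f =1 f.
Proof.
move=> lf u; pose F : {linear U -> V} := HB.pack f (GRing.isLinear.Build K U V _ f lf).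
exact: (lfunE F u).
Qed.

(** * Initial parts of a subspace and their dimension *)

Section InitialSpace.
Variables (K : fieldType) (T : finType).
Notation V := {ffun T -> K^o}.

Definition restr (P : pred T) (u : V) : V := [ffun x => if P x then u x else 0].

Lemma restr_linear P : linear (restr P).
Proof.
move=> a u v; apply/ffunP => x; rewrite !ffunE; case: (P x) => //.
by rewrite scaler0 addr0.
Qed.

Definition lrestr P : 'End(V) := linfun (restr P).

Lemma lrestrE P u : lrestr P u = restr P u.
Proof. exact/linfun_linear/restr_linear. Qed.

Variables (deg : T -> nat) (W : {vspace V}).

Definition filt (i : nat) : {vspace V} := (W :&: lker (lrestr (fun x => deg x < i)%N))%VS.

Lemma mem_filt i u : reflect (u \in W /\ forall x, (deg x < i)%N -> u x = 0) (u \in filt i).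
Proof.
rewrite memv_cap memv_ker lrestrE; apply: (iffP andP) => -[uW].
  by move=> /eqP/ffunP h; split=> // x xi; have := h x; rewrite !ffunE xi.
move=> h; split=> //; apply/eqP/ffunP => x; rewrite !ffunE; case: ifP => // /h; exact.
Qed.

Definition init_part (i : nat) : {vspace V} := (lrestr (fun x => deg x == i) @: filt i)%VS.

(** Rank-nullity for the degree-[m] part: its kernel on [filt m] lies in [filt m.+1], and parts of
    distinct degrees are independent. Passing to initial parts loses no dimension. *)
Lemma dim_init m : (\dim W <= \dim (\sum_(i < m) init_part i)%VS + \dim (filt m))%N.
Proof.
elim: m => [|m IH].
  rewrite big_ord0 dimv0 add0n; apply: dimvS; apply/subvP => u uW; apply/mem_filt; split=> //.
apply: leq_trans IH _; rewrite big_ord_recr /=.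
rewrite dimv_disjoint_sum; last first.
  apply/eqP; rewrite -subv0; apply/subvP => u; rewrite memv_cap => /andP[/memv_sumP[f hf eu]].
  move=> /memv_imgP[w _ ew]; rewrite memv0; apply/eqP/ffunP => x; rewrite ffunE.
  have [xm|xm] := eqVneq (deg x) m; last by rewrite ew lrestrE ffunE (negbTE xm).
  rewrite eu sum_ffunE big1 // => i _; have /memv_imgP[w' _ ->] := hf i isT.
  by rewrite lrestrE ffunE xm gtn_eqF // ltn_ord.
rewrite -addnA leq_add2l -(limg_ker_dim (lrestr (fun x => deg x == m)) (filt m)) addnC leq_add2l.
apply: dimvS; apply/subvP => u; rewrite memv_cap memv_ker lrestrE => /andP[/mem_filt[uW um] /eqP/ffunP h].
apply/mem_filt; split=> // x; rewrite ltnS leq_eqVlt => /orP[xm|]; last exact: um.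
by have := h x; rewrite !ffunE xm.
Qed.

(** A subspace spanning everything together with [W] still does so after degeneration, once it meets
    the initial parts trivially; beyond degree [M] the filtration is exhausted. *)
Lemma init_full (M : nat) (X : {vspace V}) : (forall x, (deg x < M)%N) ->
  (W + X)%VS = fullv -> ((\sum_(i < M) init_part i) :&: X)%VS = 0%VS ->
  (\sum_(i < M) init_part i + X)%VS = fullv.
Proof.
move=> hM WX IX; apply/eqP; rewrite eqEdim subvf /= dimv_disjoint_sum // -WX.
apply: leq_trans (dimv_add_leqif W X) _; rewrite leq_add2r.
apply: leq_trans (dim_init M) _; rewrite -[leqRHS]addn0 leq_add2l leqn0 dimv_eq0 -subv0.
apply/subvP => u /mem_filt[_ h]; rewrite memv0; apply/eqP/ffunP => x; by rewrite h // ffunE.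
Qed.

End InitialSpace.

Section PluckerPoly.
Variables (K : numFieldType) (n : nat).
Notation R := {mpoly K[#|plu n|]}.

Definition plu_var (k : 'I_n.-1) (t : incr n k.+1) : 'I_#|plu n| :=
  enum_rank (Tagged (fun k : 'I_n.-1 => incr n k.+1) t : plu n).

Variable mu : 'I_n.-1 -> nat.
Notation tb := (tbasis mu).

Definition tab_mon (b : tb) : 'X_{1..#|plu n|} := (\sum_p U_(plu_var (b p)))%MM.

(** This map may have a kernel: tableaux that differ by a permutation of columns of equal length
    give the same monomial. *)
Definition tab_poly (kap : tb -> K) : R := \sum_b kap b *: 'X_[tab_mon b].

Lemma tab_poly_eval kap v : plu_eval (tab_poly kap) v = \sum_b kap b * tmon v b.
Proof.
rewrite /plu_eval /tab_poly raddf_sum; apply: eq_bigr => b _; rewrite /= mevalZ; congr (_ * _).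
rewrite /tab_mon (big_morph _ (@mpolyXD _ _) (@mpolyX0 _ _)) rmorph_prod; apply: eq_bigr => p _; rewrite /= mevalXU.
by rewrite /plu_var enum_rankK.
Qed.

Variable S : forall k : 'I_n.-1, incr n k.+1 -> int.

Lemma grad_mon_tab b : grad_mon S (tab_mon b) = tdeg S b.
Proof.
rewrite /grad_mon /tdeg.
under eq_bigr => a _.
  rewrite /tab_mon mnm_sumE (big_morph Posz PoszD (erefl _)) big_distrl /=.
  over.
rewrite exchange_big; apply: eq_bigr => p _; rewrite (bigD1 (plu_var (b p))) //= mnm1E eqxx mul1r.
rewrite /plu_var enum_rankK big1 ?addr0 // => a ne; rewrite mnm1E eq_sym (negbTE ne); exact: mul0r.
Qed.

Lemma grad_compE d (p : R) m : (grad_comp S d p)@_m = if grad_mon S m == d then p@_m else 0.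
Proof.
rewrite /grad_comp raddf_sum /=; under eq_bigr do rewrite mcoeffZ mcoeffX.
case: (boolP (m \in msupp p)) => mp.
  rewrite big_mkcond (bigD1_seq m) //= eqxx mulr1 big1 ?addr0 // => m' ne.
  by case: ifP => // _; rewrite (negbTE ne) mulr0.
rewrite (memN_msupp_eq0 mp) if_same big_seq_cond big1 // => m' /andP[m'p _].
by case: eqP => [e|]; rewrite ?mulr0 //; rewrite -e m'p in mp.
Qed.

Lemma grad_comp_tab d kap : grad_comp S d (tab_poly kap) = tab_poly (fun b => if tdeg S b == d then kap b else 0).
Proof.
apply/mpolyP => m; rewrite grad_compE /tab_poly !raddf_sum /=.
case: ifP => md; last first.
  rewrite big1 // => b _; case: ifP => bd; last by rewrite scale0r mcoeff0.
  by rewrite mcoeffZ mcoeffX; case: eqP => [e|]; rewrite ?mulr0 //; rewrite -e grad_mon_tab bd in md.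
apply: eq_bigr => b _; rewrite !mcoeffZ !mcoeffX; case: eqP => [e|]; rewrite ?mulr0 //.
by rewrite -grad_mon_tab e md.
Qed.

End PluckerPoly.

Lemma scale_coordE (K : fieldType) (T : finType) (z : K) (u : {ffun T -> K^o}) x :
  (z *: u) x = z * (u x : K).
Proof. by rewrite ffunE. Qed.

Section InitialIdeal.
Variables (K : numFieldType) (n : nat) (A : 'I_n -> 'I_n -> int).
Hypothesis hA1 : forall i j k : 'I_n, j = i.+1 :> nat -> k = j.+1 :> nat ->
     A i j + A j k <= A i k.
Hypothesis hA2 : forall i i' j j' : 'I_n, i' = i.+1 :> nat -> j' = j.+1 :> nat ->
     (i.+1 < j)%N -> A i j + A i' j' <= A i j' + A i' j.
Notation S := (fun k : 'I_n.-1 => @sigma n k.+1 A).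
Notation R := {mpoly K[#|plu n|]}.
Notation multiproj := (forall k : 'I_n.-1, proj (ext K n k.+1)).

Lemma wt_size (k : 'I_n.-1) : (k.+1 <= n)%N.
Proof. by have := ltn_ord k; lia. Qed.

(** If all these minors vanished, Cauchy-Binet would contradict the left inverse that the first
    columns inherit from [invmx g]. *)
Lemma flag_vec_neq0 (g : 'M[K]_n) (k : 'I_n.-1) : \det g = 1 -> flag_vec g k != 0.
Proof.
move=> dg; apply/eqP => /ffunP h.
have := cauchy_binet ((pid_mx k.+1 : 'M_(k.+1, n)) *m invmx g) (first_cols k.+1 g).
rewrite [X in _ = X]big1 => [|t _]; last first.
  by have := h t; rewrite wedgeE ffunE => ->; rewrite mulr0.
rewrite /first_cols mulmxA mulmxKV ?unitmxE ?dg ?unitr1 //.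
rewrite mul_pid_mx minnn (minn_idPr (wt_size k)) pid_mx_1 det1 => /eqP.
by rewrite oner_eq0.
Qed.

(** s^(-d) times the value of [p] at a flag becomes, in orbit coordinates, a polynomial in s. It is
    zero for nonzero s, and its value at 0 is the degree-[d] component evaluated on the orbit. *)
Lemma initial_limit (p : R) (d : int) (z : 'I_n.-1 -> K) c :
  (forall g, \det g = 1 -> plu_eval p (fun k => z k *: flag_vec g k) = 0) ->
  (forall d', d' < d -> grad_comp S d' p = 0) ->
  plu_eval (grad_comp S d p) (fun k => z k *: orbit_fam A c k) = 0.
Proof.
move=> pF pd.
pose co (s : K) (a : 'I_#|plu n|) : K := z (tag (enum_val a)) *
  orbit_vec A (tag (enum_val a)).+1 s c (tagged (enum_val a)).
pose f s := \sum_(m <- msupp p) p@_m * s ^+ absz (grad_mon S m - d)%R * \prod_a co s a ^+ m a.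
have sup m : m \in msupp p -> d <= grad_mon S m.
  move=> mp; rewrite leNgt; apply/negP => /pd /(congr1 (mcoeff m)).
  by rewrite grad_compE eqxx mcoeff0 => /eqP; rewrite mcoeff_eq0 mp.
have f0 s : s != 0 -> f s = 0.
  move=> s0; have := pF (uni_mx (twist A s c)) (det_uni_mx _).
  rewrite /plu_eval mevalE => h; rewrite -[RHS](mulr0 (s ^ (- d))) -[X in _ = _ * X]h mulr_sumr.
  rewrite /f big_seq [RHS]big_seq; apply: eq_bigr => m /sup dm.
  have -> : \prod_a co s a ^+ m a = s ^ (- grad_mon S m) *
     \prod_a (z (tag (enum_val a)) *: flag_vec (uni_mx (twist A s c)) (tag (enum_val a))) (tagged (enum_val a)) ^+ m a.
    rewrite /grad_mon -sumrN.
    have -> (F : 'I_#|plu n| -> int) : s ^ (\sum_a F a) = \prod_a s ^ F a.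
      by elim/big_rec2: _ => [|a x y _ <-]; rewrite ?expr0z // expfzDr.
    rewrite -big_split; apply: eq_bigr => a _; rewrite /co (orbit_vec_flag hA1 hA2) // scale_coordE.
    rewrite mulrCA exprMn; congr (_ * _).
    by rewrite -[LHS]/((s ^ _) ^ (m a)%:Z) exprz_exp mulNr mulrC.
  rewrite -expz_pos ?subr_ge0 // expfzDr //.
  have -> : s ^ (- grad_mon S m) = (s ^ grad_mon S m)^-1 by rewrite invr_expz.
  have R (x y P a : K) : a != 0 -> x * (a * y) * (a^-1 * P) = y * (x * P) by move=> a0; field.
  exact: R (expfz_neq0 _ s0).
have : f 0 = 0.
  apply: (@polyfun_eq _ f (fun _ => 0) _ _ f0); last exact: polyfun_cst.
  apply: polyfun_sum => m; apply: polyfunM.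
    by apply: polyfunM; [exact: polyfun_cst|exact: polyfun_exp].
  apply: polyfun_prod => a; elim: (m a) => [|e [q qE]]; first exact: polyfun_cst.
  have [q' q'E] := orbit_vec_polyfun A c (tagged (enum_val a)).
  exists (z (tag (enum_val a)) *: q' * q) => s.
  by rewrite exprS qE hornerM hornerZ -q'E.
move=> f00; rewrite -[RHS]f00 /f /plu_eval /grad_comp raddf_sum /= [LHS]big_mkcond [LHS]big_seq [RHS]big_seq.
apply: eq_bigr => m /sup dm; rewrite mevalZ mevalX expr0n absz_eq0 subr_eq0.
case: ifP => _; last by rewrite mulr0 mul0r.
by rewrite mulr1; congr (_ * _); apply: eq_bigr => a _; rewrite scale_coordE.
Qed.

Lemma plucker_flag (p : R) (z : 'I_n.-1 -> K) g : plucker_ideal p ->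
  (forall k, z k != 0) -> \det g = 1 -> plu_eval p (fun k => z k *: flag_vec g k) = 0.
Proof.
move=> Ip z0 dg; pose x : multiproj := fun k => line (flag_vec_neq0 k dg).
have xF : flag_variety x by exists g.
apply: (Ip _ xF) => k; split; first by rewrite /= memvZ ?memv_line.
by rewrite scaler_eq0 negb_or z0 flag_vec_neq0.
Qed.

Lemma line_scale (k : 'I_n.-1) (u w : ext K n k.+1) : w \in <[u]>%VS -> w != 0 ->
  exists2 z : K, z != 0 & w = z *: u.
Proof.
move=> /vlineP[z ->] w0; exists z => //.
by apply: contraNneq w0 => ->; rewrite scale0r.
Qed.

Lemma orbit_degenerate c (x : multiproj) : (forall k, val (x k) = <[orbit_fam A c k]>%VS) ->
  degenerate_flag_variety S x.
Proof.
move=> xE q [s sI ->] v vx; rewrite /plu_eval raddf_sum big_seq big1 // => r /sI[p Ip [d [-> _ pd]]].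
rewrite /= mevalZ; apply/eqP; rewrite mulf_eq0; apply/orP; right; apply/eqP.
have /choice[z zP] k : exists z : K, z != 0 /\ v k = z *: orbit_fam A c k.
  have [vk v0] := vx k; rewrite xE in vk; have [z z0 e] := line_scale vk v0; by exists z.
rewrite -[RHS](initial_limit c _ pd (z := z)) => [|g dg]; last first.
  by apply: plucker_flag => // k; case: (zP k).
rewrite /plu_eval; apply: meval_eq => a; by have [_ ->] := zP (tag (enum_val a)).
Qed.

Variable mu : 'I_n.-1 -> nat.
Notation tb := (tbasis mu).
Notation V := {ffun tb -> K^o}.

Lemma tmonZ (z : 'I_n.-1 -> K) v (b : tb) :
  tmon (fun k => z k *: v k) b = (\prod_(p : pos mu) z (tag p)) * tmon v b.
Proof. by rewrite /tmon -big_split; apply: eq_bigr => p _; rewrite scale_coordE. Qed.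

(* [W] is spanned by the straightening relations and [X] by the standard
   monomials. The initial parts of [W] meet [X] trivially, because they vanish on
   the orbit, where standard monomials are independent; by dimension, they are
   complementary to [X] as well. *)
Lemma degenerate_vanish (kap : tb -> K) x v :
  (forall c, \sum_b kap b * tmon (orbit_fam A c) b = 0) ->
  degenerate_flag_variety S x -> (forall k, v k \in val (x k) /\ v k != 0) ->
  \sum_b kap b * tmon v b = 0.
Proof.
move=> kO xF vx.
have /choice[kk kkP] b := straightening (mu := mu) K b.
pose del b : V := [ffun y => (y == b)%:R].
pose rel b : V := [ffun y => (y == b)%:R - kk b y].
pose W : {vspace V} := (\sum_b <[rel b]>)%VS.
pose X : {vspace V} := (\sum_(b | standard b) <[del b]>)%VS.
have WX : (W + X)%VS = fullv.
  apply/eqP; rewrite eqEsubv subvf; apply/subvP => u _.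
  have -> : u = \sum_b u b *: del b.
    apply/ffunP => y; rewrite sum_ffunE (bigD1 y) //= !ffunE eqxx [_ *: _]mulr1 big1 ?addr0 // => b ne.
    by rewrite !ffunE eq_sym (negbTE ne) scaler0.
  apply: memv_suml => b _; apply: memvZ.
  have -> : del b = rel b + \sum_(y | standard y) kk b y *: del y.
    apply/ffunP => y; rewrite !ffunE sum_ffunE; case: (boolP (standard y)) => sy.
      rewrite (bigD1 y) //= !ffunE eqxx [_ *: _]mulr1 big1 ?addr0 ?subrK // => y' /andP[_ ne].
      by rewrite !ffunE eq_sym (negbTE ne) scaler0.
    have [k0 _] := kkP b; rewrite k0 // subr0 big1 ?addr0 // => y' sy'.
    by rewrite !ffunE; case: eqP => [e|]; rewrite ?scaler0 //; rewrite e sy' in sy.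
  apply: memv_add; last by apply: memv_suml => y sy; apply: memvZ; apply: (subvP (sumv_sup y sy (subvv _))); exact: memv_line.
  by apply: (subvP (sumv_sup b isT (subvv _))); exact: memv_line.
have WF u : u \in W -> forall g, \sum_b u b * tmon (flag_vec g) b = 0.
  move=> /memv_sumP[w wP ->] g; under eq_bigr do rewrite sum_ffunE mulr_suml.
  rewrite exchange_big big1 // => b _; have /vlineP[a ->] := wP b isT.
  under eq_bigr do rewrite !ffunE -[_ *: _]/(_ * _) -mulrA.
  rewrite -mulr_sumr; under eq_bigr do rewrite mulrBl.
  rewrite sumrB; have [_ <-] := kkP b.
  rewrite (bigD1 b) //= eqxx mul1r big1 ?addr0 ?subrr ?mulr0 // => y ne.
  by rewrite (negbTE ne) mul0r.
have XS u : u \in X -> forall b, ~~ standard b -> u b = 0.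
  move=> /memv_sumP[w wP ->] b sb; rewrite sum_ffunE big1 // => y sy.
  have /vlineP[a ->] := wP y sy; rewrite !ffunE; case: eqP => [e|]; rewrite ?scaler0 //.
  by rewrite e sy in sb.
(* A common lower bound of the degrees, which shifts the integer grading to the natural numbers used
   by [filt]. *)
pose m0 : int := - \sum_(b : tb) `|tdeg S b|.
have m0P (b : tb) : m0 <= tdeg S b.
  rewrite /m0 lerNl; apply: le_trans (ler_norm _) _; rewrite normrN (bigD1 b) //= lerDl.
  by apply: sumr_ge0 => *; exact: normr_ge0.
pose deg (b : tb) := absz (tdeg S b - m0)%R.
have degE (b : tb) : tdeg S b = m0 + (deg b)%:Z.
  by rewrite /deg gez0_abs ?subr_ge0 // addrC subrK.
pose M := (\sum_b deg b).+1.
have degM b : (deg b < M)%N by rewrite ltnS (bigD1 b) //= leq_addr.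
have partE (i : nat) (w : V) (b : tb) : (if tdeg S b == m0 + i%:Z then w b else 0) = restr (fun b => deg b == i) w b.
  by rewrite ffunE degE (inj_eq (addrI _)) eqz_nat.
have initO (i : nat) (u : V) : u \in init_part deg W i -> forall c, \sum_b u b * tmon (orbit_fam A c) b = 0.
  move=> /memv_imgP[w /mem_filt[wW wi] ->] c; rewrite lrestrE.
  have /= := @initial_limit (tab_poly w) (m0 + i%:Z) (fun _ => 1) c _ _.
  rewrite grad_comp_tab tab_poly_eval => H; rewrite -[RHS]H => [||d' d'lt].
  - by apply: eq_bigr => b _; rewrite partE tmonZ big1_eq mul1r.
  - move=> g _; rewrite tab_poly_eval -[RHS](WF _ wW g); apply: eq_bigr => b _.
    by rewrite tmonZ big1_eq mul1r.
  rewrite grad_comp_tab /tab_poly big1 // => b _; case: eqP => [e|]; last by rewrite scale0r.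
  rewrite wi ?scale0r //; move: d'lt; rewrite -e degE; lia.
have initv (i : nat) (u : V) : u \in init_part deg W i -> \sum_b u b * tmon v b = 0.
  move=> /memv_imgP[w /mem_filt[wW wi] ->]; rewrite lrestrE -(tab_poly_eval (restr _ w)).
  (* A nonzero combination of tableaux can represent the zero polynomial, which does not count as an
     initial part. *)
  have [->|q0] := eqVneq (tab_poly (restr (fun b => deg b == i) w)) 0; first exact: meval0.
  apply: (xF _ _ _ vx); exists [:: (1, tab_poly (restr (fun b => deg b == i) w))]; last first.
    by rewrite big_seq1 /= scale1r.
  move=> r; rewrite inE => /eqP -> /=; exists (tab_poly w).
    move=> y [g dg yE] v' v'y; rewrite tab_poly_eval.
    have /choice[z zP] k : exists z : K, z != 0 /\ v' k = z *: flag_vec g k.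
      have [vk v0] := v'y k; rewrite yE in vk; have [z z0 e] := line_scale vk v0; by exists z.
    have -> : v' = fun k => z k *: flag_vec g k by apply: functional_extensionality_dep => k; case: (zP k).
    under eq_bigr do rewrite tmonZ mulrCA; by rewrite -mulr_sumr WF ?mulr0.
  exists (m0 + i%:Z); split=> // [|d' d'lt].
    by rewrite grad_comp_tab /tab_poly; apply: eq_bigr => b _; rewrite partE.
  rewrite grad_comp_tab /tab_poly big1 // => b _; case: eqP => [e|]; last by rewrite scale0r.
  rewrite wi ?scale0r //; move: d'lt; rewrite -e degE; lia.
have sumO (P : V -> K) u : {morph P : x y / x + y >-> x + y} -> P 0 = 0 ->
    (forall i w, w \in init_part deg W i -> P w = 0) ->
    u \in (\sum_(i < M) init_part deg W i)%VS -> P u = 0.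
  move=> PD P0 Pi /memv_sumP[w wP ->]; elim/big_ind: _ => //.
    by move=> x1 x2 e1 e2; rewrite PD e1 e2 addr0.
  by move=> i _; apply: Pi; exact: wP.
have evD f : {morph (fun u : V => \sum_b (u b : K) * f b) : x y / x + y >-> x + y}.
  by move=> u w; rewrite -big_split; apply: eq_bigr => b _; rewrite ffunE mulrDl.
have ev0 f : \sum_b ((0 : V) b : K) * f b = 0.
  by rewrite big1 // => b _; rewrite ffunE mul0r.
have sO c u := sumO _ u (evD (fun b => tmon (orbit_fam A c) b)) (ev0 _) (fun i w h => initO i w h c).
have sv u := sumO _ u (evD (fun b => tmon v b)) (ev0 _) initv.
have IX : ((\sum_(i < M) init_part deg W i) :&: X)%VS = 0%VS.
  apply/eqP; rewrite -subv0; apply/subvP => u; rewrite memv_cap => /andP[uI uX].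
  rewrite memv0; apply/eqP/ffunP => b; rewrite ffunE.
  by apply: (standard_free hA1 hA2 (kap := u)) => [|c]; [exact: XS|exact: sO].
have full := init_full degM WX IX.
have : [ffun b => kap b : K^o] \in (\sum_(i < M) init_part deg W i + X)%VS by rewrite full memvf.
move=> /memv_addP[u1 u1I [u2 u2X e]].
(* Both [kap] and [u1] vanish on the orbit, hence so does the standard part [u2], and independence
   kills it. *)
have u20 b : u2 b = 0.
  apply: (standard_free hA1 hA2 (kap := u2)) => [|c]; first exact: XS.
  have s1 : \sum_b (u1 b : K) * tmon (orbit_fam A c) b = 0 by exact: sO.
  have /= := evD (fun b => tmon (orbit_fam A c) b) u1 u2; rewrite -e s1 add0r => <-.
  by rewrite -[RHS](kO c); apply: eq_bigr => y _; rewrite ffunE.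
rewrite -[RHS](sv u1 u1I); apply: eq_bigr => b _; congr (_ * _).
by have /ffunP/(_ b) := e; rewrite !ffunE u20 addr0.
Qed.

End InitialIdeal.

(** * The action on the degenerate representation *)

Lemma sum_ltn k l : (\sum_(a < k) (a < l) = minn l k)%N.
Proof.
elim: k => [|k IH]; first by rewrite big_ord0 minn0.
rewrite big_ord_recr [LHS]/= IH; case: (ltnP k l) => kl /=; lia.
Qed.

Section Weights.
Variables (n : nat).

Definition count_lt k (t : incr n k) (l : nat) : nat := \sum_(a < k) (tnth (val t) a < l)%N.

Lemma count_lt_min k (t : incr n k) l : (count_lt t l <= minn l k)%N.
Proof.
have h : (count_lt t l <= \sum_(a < k) (a < l)%N)%N.
  apply: leq_sum => a _; case: ltnP => // h; rewrite (leq_ltn_trans _ h) //.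
  exact: (incr_ge t a).
by rewrite -(sum_ltn k l).
Qed.

Lemma count_lt_prefixed k (t : incr n k) (i : nat) :
  reflect (forall l, (l <= i)%N -> count_lt t l = minn l k) (prefixed i t).
Proof.
apply: (iffP (prefixedP _ _)) => [h l li|h a ai].
  apply/eqP; rewrite eqn_leq count_lt_min /=.
  rewrite -(sum_ltn k l); apply: leq_sum => a _; case: ltnP => // al; rewrite h ?al //.
  exact: leq_trans al li.
apply/eqP; rewrite eqn_leq (incr_ge t a) andbT leqNgt; apply/negP => lt.
have := h a.+1 ai; rewrite (minn_idPl (ltn_ord a)) => e.
have : (count_lt t a.+1 <= \sum_(b < k) (b < a)%N)%N.
  apply: leq_sum => b _; case: (ltnP b a) => ba; first by case: (_ < _)%N.
  rewrite leqn0 eqb0 -leqNgt; apply: leq_trans lt _.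
  by have := incr_gap t ba; lia.
by rewrite e sum_ltn; lia.
Qed.

Lemma count_lt_full k (t : incr n k) : count_lt t n = k.
Proof.
rewrite /count_lt; under eq_bigr do rewrite ltn_ord.
by rewrite sum1_card card_ord.
Qed.

Lemma count_lt_wt k (t : incr n k) (j : nat) :
  \sum_(i <- val t) ((i == j :> nat)%:R - (i == j.+1 :> nat)%:R) =
  2 * (count_lt t j.+1)%:Z - (count_lt t j)%:Z - (count_lt t j.+2)%:Z :> int.
Proof.
rewrite /count_lt big_tuple !(big_morph Posz PoszD (erefl _)) mulr_sumr -!sumrB.
apply: eq_bigr => a _; move: (nat_of_ord (tnth (val t) a)) => x.
rewrite !ltnS [(x <= j)%N]leq_eqVlt [(x <= j.+1)%N]leq_eqVlt ltnS [(x <= j)%N]leq_eqVlt.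
case: (ltngtP x j) => h; case: eqP => h' //=; lia.
Qed.

Variable la : 'I_n.-1 -> nat.
Notation tb := (tbasis la).

(** [defect b l.+1] is the coefficient of [simple_root l] in lambda minus the weight of [b]. *)
Definition defect (b : tb) (l : nat) : nat :=
  \sum_(p : pos la) (minn l (tag p).+1 - count_lt (b p) l)%N.

Lemma defectE (b : tb) l : (defect b l)%:Z =
  \sum_(p : pos la) (minn l (tag p).+1)%:Z - \sum_(p : pos la) (count_lt (b p) l)%:Z.
Proof.
rewrite -sumrB (big_morph Posz PoszD (erefl _)); apply: eq_bigr => p _.
by rewrite subzn // count_lt_min.
Qed.

Lemma la_sum k : (la k)%:Z = \sum_(p : pos la)
   (2 * (minn k.+1 (tag p).+1)%:Z - (minn k (tag p).+1)%:Z - (minn k.+2 (tag p).+1)%:Z).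
Proof.
transitivity (\sum_(p : pos la) (tag p == k)%:Z).
  rewrite -(big_morph Posz PoszD (erefl _)); congr Posz.
  rewrite -(@sig_big_dep _ _ _ _ (fun i => 'I_(la i)) predT (fun _ => predT) (fun i (j : 'I_(la i)) => nat_of_bool (i == k))) /=.
  rewrite (bigD1 k) //= sum_nat_const card_ord eqxx muln1 big1 ?addn0 // => i ik.
  by rewrite sum_nat_const (negbTE ik) muln0.
apply: eq_bigr => p _; case: eqP => [->|ne]; first lia.
have : tag p <> k :> nat by move/ord_inj.
lia.
Qed.

Lemma basis_weight_defect (b : tb) (k : 'I_n.-1) : basis_weight b k - (la k)%:Z =
  - (2 * (defect b k.+1)%:Z - (defect b k)%:Z - (defect b k.+2)%:Z).
Proof.
rewrite la_sum /basis_weight (eq_bigr _ (fun p _ => count_lt_wt (b p) k)) !sumrB -!mulr_sumr !defectE.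
set a1 := \sum_(p : pos la) _; set a2 := \sum_(p : pos la) _; set a3 := \sum_(p : pos la) _.
set a4 := \sum_(p : pos la) _; set a5 := \sum_(p : pos la) _; set a6 := \sum_(p : pos la) _; lia.
Qed.

(** The Cartan matrix of type A is a second difference; the boundary values 0 replace the missing
    neighbours at both ends. *)
Lemma cartan_sum (f : nat -> int) (k : 'I_n.-1) : f 0%N = 0 -> f n = 0 ->
  \sum_(l < n.-1) f l.+1 * - simple_root l k = - (2 * f k.+1 - f k - f k.+2).
Proof.
move=> f0 fn.
have pick (x : nat) : \sum_(l < n.-1) f l.+1 * (l == x :> nat)%:R = if (x < n.-1)%N then f x.+1 else 0.
  case: ifP => [xn|xn].
    rewrite (bigD1 (Ordinal xn)) //= eqxx mulr1 big1 ?addr0 // => l lx.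
    by rewrite (_ : (l == x :> nat) = false) ?mulr0 //; apply: contraNF lx => /eqP e; apply/eqP/ord_inj.
  rewrite big1 // => l _; case: eqP => [e|]; rewrite ?mulr0 //.
  by rewrite -e ltn_ord in xn.
transitivity (\sum_(l < n.-1) f l.+1 * (l == k.+1 :> nat)%:R +
   \sum_(l < n.-1) f l.+1 * (l.+1 == k :> nat)%:R - 2 * \sum_(l < n.-1) f l.+1 * (l == k :> nat)%:R).
  rewrite mulr_sumr -big_split -sumrB; apply: eq_bigr => l _ /=; rewrite /simple_root.
  rewrite -(inj_eq (@ord_inj _)) [(k : nat) == _]eq_sym.
  case: (eqVneq (l : nat) k) => [->|lk]; first by rewrite ltn_eqF // gtn_eqF //=; lia.
  case: (eqVneq (l : nat) k.+1) => [->|lk1] /=; first by rewrite gtn_eqF //; lia.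
  by case: eqP; lia.
rewrite !pick ltn_ord.
have -> : \sum_(l < n.-1) f l.+1 * (l.+1 == k :> nat)%:R = f k.
  have [->|k0] := posnP k; first by rewrite f0 big1 // => l _; rewrite mulr0.
  have k1 : (k.-1 < n.-1)%N by have := ltn_ord k; lia.
  have := pick k.-1; rewrite k1 prednK // => <-; apply: eq_bigr => l _.
  by congr (_ * _%:R); congr nat_of_bool; apply/eqP/eqP; lia.
case: ifP => kn; first lia.
have -> : k.+2 = n by have := ltn_ord k; lia.
by rewrite fn; lia.
Qed.

Lemma defect0 b : defect b 0 = 0%N.
Proof. by rewrite /defect big1 // => p _; rewrite min0n. Qed.

Lemma defectn b : defect b n = 0%N.
Proof.
rewrite /defect big1 // => p _; rewrite count_lt_full.
have := ltn_ord (tag p); lia.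
Qed.

(** Coefficients on simple roots are unique: a function with zero second differences vanishing at 0
    and n is zero. So [m] is the defect, and its vanishing up to [i] forces the prefix 0, ..., i-1
    in every tensor factor. *)
Lemma belowP (i : 'I_n) (b : tb) :
  `[< below la i (basis_weight b) >] = [forall p, prefixed i (b p)].
Proof.
apply/asboolP/forallP => [[m [m0 mE]] p|h].
  pose g (l : nat) : int := (if l is l'.+1 then if insub l' is Some x then (m x)%:Z else 0 else 0) - (defect b l)%:Z.
  have gS (l : 'I_n.-1) : g l.+1 = (m l)%:Z - (defect b l.+1)%:Z by rewrite /g valK.
  have g0 : g 0%N = 0 by rewrite /g defect0.
  have gn : g n = 0.
    have n0 : (0 < n)%N by apply: leq_ltn_trans (ltn_ord i).
    rewrite -[X in g X](prednK n0) /g insubN ?ltnn // prednK // defectn; exact: subrr.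
  have rec (k : 'I_n.-1) : 2 * g k.+1 - g k - g k.+2 = 0.
    have e1 := cartan_sum k g0 gn; have e2 := basis_weight_defect b k.
    have e3 := @cartan_sum (fun l => (defect b l)%:Z) k _ _.
    rewrite /= defect0 defectn in e3.
    have e4 := mE k; apply/eqP; rewrite -oppr_eq0 -e1; under eq_bigr do rewrite gS mulrBl.
    by rewrite sumrB e3 // -e4 e2 subrr.
  have lin l : (l <= n)%N -> (g l = l%:Z * g 1%N) /\ ((l.+1 <= n)%N -> g l.+1 = l.+1%:Z * g 1%N).
    elim: l => [|l IH] ln; first by rewrite g0 mul0r mul1r.
    have [e1 e2] := IH (ltnW ln); split=> [|ln2]; first exact: e2.
    have kl : (l < n.-1)%N by lia.
    have := rec (Ordinal kl); rewrite /= e1 e2 //; lia.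
  have g1 : g 1%N = 0.
    have [+ _] := lin n (leqnn n); rewrite gn => /esym/eqP; rewrite mulf_eq0 => /orP[|/eqP //].
    by have := ltn_ord i; lia.
  have gz l : (l <= n)%N -> g l = 0 by move=> /lin[-> _]; rewrite g1 mulr0.
  have dz l : (l <= i)%N -> defect b l = 0%N.
    case: l => [|l] li; first exact: defect0.
    have ln : (l < n.-1)%N by have := ltn_ord i; lia.
    by have := gS (Ordinal ln); rewrite gz ?m0 //=; have := ltn_ord i; lia.
  apply/count_lt_prefixed => l li; have /eqP := dz l li.
  rewrite /defect sum_nat_eq0 => /forallP/(_ p); rewrite subn_eq0 => le.
  by apply/eqP; rewrite eqn_leq count_lt_min.
exists (fun l => defect b l.+1); split=> [l li|k].
  rewrite /defect big1 // => p _; have /count_lt_prefixed -> // := h p.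
  by rewrite subnn.
rewrite basis_weight_defect; apply/esym/(@cartan_sum (fun l => (defect b l)%:Z)).
  by rewrite defect0.
by rewrite defectn.
Qed.

End Weights.

(** * Operators and weight projections on the tensor product *)

Section TensorOperators.
Variables (K : numFieldType) (n : nat) (la : 'I_n.-1 -> nat).
Notation tb := (tbasis la).
Notation ps := (pos la).
Notation U := {ffun tb -> K^o}.
Implicit Types (b : tb) (u : U).

Definition agree_off (p : ps) b b' : K := \prod_(q | q != p) (b' q == b q)%:R.

Lemma agree_offP p b b' : agree_off p b b' != 0 -> forall q, q != p -> b' q = b q.
Proof.
move=> /prodf_neq0 h q qp; apply/eqP; move: (h q qp).
by case: (b' q == b q); rewrite ?eqxx.
Qed.

Lemma tb_eq b b' : (b' == b)%:R = \prod_q (b' q == b q)%:R :> K.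
Proof.
case: eqP => [->|ne]; first by rewrite big1 // => q _; rewrite eqxx.
have [q /negbTE h] : exists q, b' q != b q.
  apply/existsP; rewrite -negb_forall; apply: contra_notN ne => /forallP h.
  by apply/ffunP => q; apply/eqP.
by rewrite (bigD1 q) //= h mul0r.
Qed.

Definition upd1 b (p : ps) (t : incr n (tag p).+1) : tb := [ffun q => dfwith b t q].

Lemma upd1_in b p t : @upd1 b p t p = t.
Proof. by rewrite ffunE dfwith_in. Qed.

Lemma upd1_out b p t q : q != p -> @upd1 b p t q = b q.
Proof. by move=> qp; rewrite ffunE dfwith_out // eq_sym. Qed.

(** Turns matrix coefficients on basis tensors into an action on one factor of a pure tensor at a
    time. *)
Lemma leibniz (w : forall p : ps, ext K n (tag p).+1)
    (M : forall p : ps, incr n (tag p).+1 -> incr n (tag p).+1 -> K) b' :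
  \sum_(b : tb) (\prod_q (w q (b q) : K)) * \sum_p M p (b p) (b' p) * agree_off p b b' =
  \sum_p (\sum_t (w p t : K) * M p t (b' p)) * \prod_(q | q != p) (w q (b' q) : K).
Proof.
under eq_bigr do rewrite mulr_sumr; rewrite exchange_big; apply: eq_bigr => p _ /=.
rewrite (partition_big (fun b => b p) predT) //= mulr_suml; apply: eq_bigr => t _.
rewrite (bigD1 (upd1 b' t)) /=; last by rewrite upd1_in.
rewrite [X in _ + X]big1 ?addr0 => [|b /andP[/eqP bt ne]]; last first.
  have [->|/agree_offP h] := eqVneq (agree_off p b b') 0; first by rewrite !mulr0.
  case/eqP: ne; apply/ffunP => q; have [->|qp] := eqVneq q p; first by rewrite upd1_in.
  by rewrite upd1_out // h.
rewrite upd1_in (bigD1 p) //= upd1_in /agree_off.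
rewrite [X in _ * (_ * X)]big1 ?mulr1 => [|q qp]; last by rewrite upd1_out ?eqxx.
rewrite -!mulrA; congr (_ * _); rewrite mulrC; congr (_ * _).
by apply: eq_bigr => q qp; rewrite upd1_out.
Qed.

Lemma act_coord (x : 'M[K]_n) u b' : act la x u b' =
  \sum_b (u b : K) * \sum_p (ext_act_basis x (b p) (b' p) : K) * agree_off p b b'.
Proof.
rewrite /act linfun_linear; last first.
  move=> a u1 u2; rewrite scaler_sumr -big_split; apply: eq_bigr => b _ /=.
  by rewrite !ffunE scalerDl scalerA.
rewrite sum_ffunE; apply: eq_bigr => b _; rewrite scale_coordE sum_ffunE; congr (_ * _).
apply: eq_bigr => p _; rewrite ffunE (bigD1 p) //= eqxx; congr (_ * _).
by apply: eq_bigr => q /negbTE ->; rewrite ffunE.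
Qed.

Lemma f_op_coord (i j : 'I_n) u b' : f_op K la i j u b' =
  \sum_b (u b : K) * \sum_p fcoef K i j (b p) (b' p) * agree_off p b b'.
Proof. exact: act_coord. Qed.

Lemma ext_act_diag k (d : 'rV[K]_n) (t t' : incr n k) :
  ext_act_basis (diag_mx d) t t' = (\sum_(i <- val t) d 0 i) * (t' == t)%:R :> K.
Proof.
rewrite sum_ffunE big_tuple mulr_suml; apply: eq_bigr => l _.
rewrite -(wedge_colsub1 K) !wedgeE.
pose D : 'rV[K]_k := \row_b (if b == l then d 0 (tnth (val t) l) else 1).
have -> : d 0 (tnth (val t) l) = \det (diag_mx D).
  rewrite det_diag (bigD1 l) //= !mxE eqxx big1 ?mulr1 // => b /negbTE bl.
  by rewrite !mxE bl.
rewrite mulrC -det_mulmx; congr (\det _); apply/matrixP => a b.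
rewrite mul_mx_diag !mxE; case: eqP => [->|_]; last by rewrite mulr1.
by case: eqP => [->|_]; rewrite ?mulr1n ?mul1r ?mulr0n ?mul0r.
Qed.

Lemma coroot_coord (k : 'I_n.-1) u b : act la (coroot K k) u b = (basis_weight b k)%:~R * (u b : K).
Proof.
rewrite act_coord (bigD1 b) //= [X in _ + X]big1 ?addr0 => [|b' ne]; last first.
  rewrite big1 ?mulr0 // => p _; rewrite ext_act_diag -mulrA.
  have := tb_eq b' b; rewrite (bigD1 p) //= -/(agree_off p b' b) => <-.
  by rewrite eq_sym (negbTE ne) mulr0.
rewrite mulrC; congr (_ * _); rewrite /basis_weight raddf_sum; apply: eq_bigr => p _ /=.
have -> : agree_off p b b = 1 by rewrite /agree_off big1 // => q _; rewrite eqxx.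
rewrite ext_act_diag eqxx !mulr1 raddf_sum; apply: eq_bigr => i _ /=; rewrite mxE rmorphB /= !rmorph_nat.
by [].
Qed.

Lemma stable_op (x : 'M[K]_n) u : \tr x = 0 -> u \in Lla K la -> act la x u \in Lla K la.
Proof.
move=> tr uL; have [_ st _] := cyclic_subrepP (fun f => exists2 x : 'M[K]_n, \tr x = 0 & act la x = f) (vla K la).
by apply: (subvP (st (act la x) _)); [exists x|exact: memv_img].
Qed.

Lemma stable_f_op (i j : 'I_n) u : i != j -> u \in Lla K la -> f_op K la i j u \in Lla K la.
Proof.
move=> ij; apply: stable_op; rewrite /mxtrace big1 // => x _; rewrite mxE.
by case: eqP => [->|_] //=; rewrite eq_sym (negbTE ij).
Qed.

Lemma stable_coroot (k : 'I_n.-1) u : u \in Lla K la -> act la (coroot K k) u \in Lla K la.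
Proof.
apply: stable_op; rewrite mxtrace_diag.
have k1 : (k.+1 < n)%N by have := ltn_ord k; lia.
under eq_bigr do rewrite mxE; rewrite sumrB (bigD1 (Ordinal (ltnW k1))) //= eqxx big1 ?addr0 => [|i ne].
  rewrite (bigD1 (Ordinal k1)) //= eqxx big1 ?addr0 ?subrr // => i ne.
  by case: eqP => // e; case/eqP: ne; apply: ord_inj.
by case: eqP => // e; case/eqP: ne; apply: ord_inj.
Qed.

Definition scale_by (d : tb -> K) u : U := [ffun b => d b * (u b : K)].

(** Diagonal operators preserving [Lla] form an algebra; it contains the coroots and therefore the
    weight projections. *)
Definition stabilizes (d : tb -> K) := forall u, u \in Lla K la -> scale_by d u \in Lla K la.

Lemma stab_ext d d' : d =1 d' -> stabilizes d -> stabilizes d'.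
Proof.
move=> e h u /h; have -> // : scale_by d u = scale_by d' u.
by apply/ffunP => b; rewrite !ffunE e.
Qed.

Lemma stab_cst c : stabilizes (fun _ => c).
Proof.
move=> u uL; have -> : scale_by (fun _ => c) u = c *: u by apply/ffunP => b; rewrite !ffunE.
exact: memvZ.
Qed.

Lemma stabD d d' : stabilizes d -> stabilizes d' -> stabilizes (fun b => d b + d' b).
Proof.
move=> h h' u uL; have -> : scale_by (fun b => d b + d' b) u = scale_by d u + scale_by d' u.
  by apply/ffunP => b; rewrite !ffunE mulrDl.
by apply: memvD; [exact: h|exact: h'].
Qed.

Lemma stabM d d' : stabilizes d -> stabilizes d' -> stabilizes (fun b => d b * d' b).
Proof.
move=> h h' u uL; have -> : scale_by (fun b => d b * d' b) u = scale_by d (scale_by d' u).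
  by apply/ffunP => b; rewrite !ffunE mulrA.
exact/h/h'.
Qed.

Lemma stab_prod (I : finType) (P : pred I) (d : I -> tb -> K) : (forall i, P i -> stabilizes (d i)) ->
  stabilizes (fun b => \prod_(i | P i) d i b).
Proof.
move=> h; have : forall i, stabilizes (fun b => if P i then d i b else 1).
  by move=> i; case Pi: (P i); [exact: h|exact: stab_cst].
move=> {}h; apply: (@stab_ext (fun b => \prod_i if P i then d i b else 1)).
  by move=> b; rewrite -big_mkcond.
elim: (index_enum I) => [|i r IH].
  by apply: stab_ext (stab_cst 1) => b; rewrite big_nil.
by apply: stab_ext (stabM (h i) IH) => b; rewrite big_cons.
Qed.

Lemma stab_weight (k : 'I_n.-1) : stabilizes (fun b => (basis_weight b k)%:~R).
Proof.
move=> u /(stable_coroot k); have -> // : act la (coroot K k) u = scale_by (fun b => (basis_weight b k)%:~R) u.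
by apply/ffunP => b; rewrite coroot_coord ffunE.
Qed.

Definition same_weight b b' := [forall k, basis_weight b k == basis_weight b' k].

Lemma same_weightP b b' : reflect (basis_weight b = basis_weight b') (same_weight b b').
Proof.
apply: (iffP forallP) => [h|-> //]; apply: functional_extensionality_dep => k; exact/eqP.
Qed.

(* by Lagrange interpolation in the weights *)
Lemma stab_same_weight b0 : stabilizes (fun b => (same_weight b b0)%:R).
Proof.
pose F b' b : K := if [pick k | basis_weight b' k != basis_weight b0 k] is Some k
  then ((basis_weight b k)%:~R - (basis_weight b' k)%:~R) *
       ((basis_weight b0 k)%:~R - (basis_weight b' k)%:~R)^-1 else 1.
apply: (@stab_ext (fun b => \prod_b' F b' b)) => [b|]; last first.
  apply: stab_prod => b' _; rewrite /F; case: pickP => [k _|_]; last exact: stab_cst.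
  apply: stabM; last exact: stab_cst.
  by apply: stabD; [exact: stab_weight|exact: stab_cst].
case: (boolP (same_weight b b0)) => [/same_weightP e|ne].
  rewrite big1 // => b' _; rewrite /F; case: pickP => // k kk; rewrite e mulfV //.
  by rewrite subr_eq0 eqr_int eq_sym.
rewrite (bigD1 b) //= /F; case: pickP => [k _|h]; first by rewrite subrr mul0r mul0r.
by case/negP: ne; apply/forallP => k; apply/negbNE/negbT/h.
Qed.

Lemma mem_weight_space b0 u : (u \in weight_space K la (basis_weight b0)) =
  (u \in Lla K la) && [forall b, (u b != 0) ==> same_weight b b0].
Proof.
rewrite memv_cap; congr (_ && _); apply/idP/forallP => [h b|h].
  apply/implyP => ub; apply/forallP => k.
  have : u \in passmx.leigenspace (act la (coroot K k)) (basis_weight b0 k)%:~R.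
    by apply: (subvP _ _ h); exact: (bigcapv_inf k).
  rewrite memv_ker add_lfunE opp_lfunE scale_lfunE id_lfunE subr_eq0 => /eqP/ffunP/(_ b).
  rewrite coroot_coord scale_coordE => /(mulIf ub)/eqP; by rewrite eqr_int.
rewrite memvE; apply/subv_bigcapP => k _; rewrite -memvE memv_ker add_lfunE opp_lfunE scale_lfunE id_lfunE subr_eq0.
apply/eqP/ffunP => b; rewrite coroot_coord scale_coordE.
case: (eqVneq (u b) 0) => [->|ub]; first by rewrite !mulr0.
by have /forallP/(_ k)/eqP -> := implyP (h b) ub.
Qed.

Definition all_prefixed (i : nat) b := [forall p, prefixed i (b p)].

Lemma sum_weight_space (P : pred tb) u : (forall b b', same_weight b b' -> P b = P b') ->
  u \in Lla K la -> scale_by (fun b => (P b)%:R) u \in (\sum_(b | P b) weight_space K la (basis_weight b))%VS.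
Proof.
(* The sum over tableaux meets a weight once for each basis tensor of that weight; [N] corrects this
   multiplicity. *)
move=> hP uL; pose N b0 : K := \sum_(b | same_weight b b0) 1.
have N0 b0 : N b0 != 0.
  rewrite /N sumr_const pnatr_eq0 -lt0n; apply/card_gt0P; exists b0.
  by rewrite unfold_in; apply/same_weightP.
have -> : scale_by (fun b => (P b)%:R) u =
    \sum_(b0 | P b0) (N b0)^-1 *: scale_by (fun b => (same_weight b b0)%:R) u.
  apply/ffunP => b; rewrite sum_ffunE ffunE.
  case: (boolP (P b)) => Pb; last first.
    rewrite mul0r big1 // => b0 Pb0; rewrite !ffunE; case: (boolP (same_weight b b0)) => [/hP e|].
      by rewrite e Pb0 in Pb.
    by rewrite mul0r scaler0.
  rewrite (bigID (fun b0 => same_weight b0 b)) /= [X in _ + X]big1 ?addr0; last first.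
    move=> b0 /andP[_ ne]; rewrite !ffunE (_ : same_weight b b0 = false) ?mul0r ?scaler0 //.
    apply: contraNF ne => /same_weightP e; exact/same_weightP.
  transitivity (\sum_(b0 | same_weight b0 b) (N b)^-1 * (u b : K)).
    by rewrite -mulr_suml -[X in _ = X * _](_ : 1 = _) // -[(N b)^-1]mulr1 -mulr_sumr mulVf.
  apply/esym; apply: eq_big => b0.
    case: (boolP (same_weight b0 b)); rewrite ?andbF // => /hP ->; by rewrite Pb.
  move=> /andP[_ /same_weightP e]; rewrite !ffunE.
  have -> : same_weight b b0 by apply/same_weightP.
  rewrite mul1r; congr (_^-1 * _); apply: eq_bigl => b1; by apply/same_weightP/same_weightP; rewrite e.
apply: memv_suml => b0 Pb0; apply: memvZ; apply: (subvP (sumv_sup b0 Pb0 (subvv _))).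
rewrite mem_weight_space; apply/andP; split; first exact: stab_same_weight.
apply/forallP => b; apply/implyP; rewrite ffunE; case: (same_weight b b0) => //.
by rewrite mul0r eqxx.
Qed.

Lemma sum_weight_supp (P : pred tb) u : (forall b b', same_weight b b' -> P b = P b') ->
  u \in (\sum_(b | P b) weight_space K la (basis_weight b))%VS -> forall b, ~~ P b -> u b = 0.
Proof.
move=> hP /memv_sumP[w wP ->] b Pb; rewrite sum_ffunE big1 // => b0 Pb0.
have := wP b0 Pb0; rewrite mem_weight_space => /andP[_ /forallP/(_ b)]; apply: contraTeq => nz.
by rewrite nz /=; apply: contra Pb => /hP ->.
Qed.

(** Basis tensors are weight vectors, so the projection onto L_lambda(i) is a coordinate projection,
    and [belowP] tells which coordinates survive. *)
Lemma phiE (i j : 'I_n) u : u \in Lla K la ->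
  phi K la i j u = f_op K la i j (scale_by (fun b => (all_prefixed i b)%:R) u).
Proof.
move=> uL; rewrite /phi comp_lfunE; congr (f_op K la i j _).
pose P b := `[< below la i (basis_weight b) >].
have hP b b' : same_weight b b' -> P b = P b' by rewrite /P => /same_weightP ->.
have hP' b b' : same_weight b b' -> ~~ P b = ~~ P b' by move=> /hP ->.
have -> : scale_by (fun b => (all_prefixed i b)%:R) u = scale_by (fun b => (P b)%:R) u.
  by apply/ffunP => b; rewrite !ffunE /P belowP.
have cap0 : (Lbelow K la i :&: Lnotbelow K la i)%VS = 0%VS.
  apply/eqP; rewrite -subv0; apply/subvP => v; rewrite memv_cap => /andP[v1 v2].
  rewrite memv0; apply/eqP/ffunP => b; rewrite ffunE; case: (boolP (P b)) => Pb.
    by apply: (sum_weight_supp hP' v2); rewrite negbK.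
  exact: (sum_weight_supp hP v1).
have m1 := sum_weight_space hP uL; have m2 := sum_weight_space hP' uL.
have -> : u = scale_by (fun b => (P b)%:R) u + scale_by (fun b => (~~ P b)%:R) u.
  by apply/ffunP => b; rewrite !ffunE -mulrDl; case: (P b); rewrite ?addr0 ?add0r mul1r.
rewrite linearD /= (daddv_pi_id cap0 m1).
have cap0' : (Lnotbelow K la i :&: Lbelow K la i)%VS = 0%VS by rewrite capvC.
have := daddv_pi_add cap0' (subvP (addvSl _ _) _ m2).
rewrite (daddv_pi_id cap0' m2) => /(canRL (addKr _)); rewrite addNr => ->.
rewrite addr0; apply/ffunP => b; rewrite !ffunE.
by case: (P b); rewrite !(mul1r, mul0r, addr0, add0r, mulr0).
Qed.

End TensorOperators.

(** * The induced operators on the associated graded space *)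

Section GradedAction.
Variables (K : numFieldType) (n : nat) (A : 'I_n -> 'I_n -> int) (la : 'I_n.-1 -> nat).
Hypothesis hA1 : forall i j k : 'I_n, j = i.+1 :> nat -> k = j.+1 :> nat ->
     A i j + A j k <= A i k.
Hypothesis hA2 : forall i i' j j' : 'I_n, i' = i.+1 :> nat -> j' = j.+1 :> nat ->
     (i.+1 < j)%N -> A i j + A i' j' <= A i j' + A i' j.
Notation tb := (tbasis la).
Notation U := {ffun tb -> K^o}.
Notation S := (fun k : 'I_n.-1 => @sigma n k.+1 A).
Implicit Types (b : tb) (u : U).

Lemma tcompE m u : tcomp K la S m u = restr (fun b => tdeg S b == m) u.
Proof. by rewrite /tcomp linfun_linear //; exact: restr_linear. Qed.

Lemma mem_Ufil m u : reflect (forall b, u b != 0 -> tdeg S b <= m) (u \in Ufil K la S m).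
Proof.
apply: (iffP idP) => [/memv_sumP[w wP ->] b|h].
  apply: contraR => lt; rewrite sum_ffunE big1 // => b0 b0m.
  have /vlineP[a ->] := wP b0 b0m; rewrite !ffunE; case: eqP => [e|]; rewrite ?scaler0 //.
  by rewrite e b0m in lt.
have -> : u = \sum_(b | tdeg S b <= m) (u b : K) *: tens_basis K b.
  apply/ffunP => b; rewrite sum_ffunE; case: (boolP (tdeg S b <= m)) => bm.
    rewrite (bigD1 b) //= !ffunE eqxx [_ *: _]mulr1 big1 ?addr0 // => b0 /andP[_ ne].
    by rewrite !ffunE eq_sym (negbTE ne) scaler0.
  rewrite big1 => [|b0 b0m]; first by apply: contraNeq bm => /h.
  by rewrite !ffunE; case: eqP => [e|]; rewrite ?scaler0 //; rewrite e b0m in bm.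
apply: memv_suml => b bm; apply: memvZ; apply: (subvP (sumv_sup b bm (subvv _))); exact: memv_line.
Qed.

Lemma tdeg_agree p b b' : agree_off K p b b' != 0 ->
  tdeg S b' = tdeg S b - sigma A (b p) + sigma A (b' p).
Proof.
move=> /agree_offP h; rewrite /tdeg (bigD1 p) //= [in RHS](bigD1 p) //=.
have -> : \sum_(q | q != p) sigma A (b' q) = \sum_(q | q != p) sigma A (b q).
  by apply: eq_bigr => q qp; rewrite h.
by rewrite [sigma A (b p) + _]addrC addrK addrC.
Qed.

(** The part of the truncated f_(i,j) that raises the degree by exactly [A i j], defined on all of
    [U] and so independent of lifts. *)
Definition psiU (i j : 'I_n) u : U :=
  [ffun b' => \sum_b if all_prefixed i b && (tdeg S b' == tdeg S b + A i j) then
     (u b : K) * \sum_p fcoef K i j (b p) (b' p) * agree_off K p b b' else 0].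

Lemma psiU_linear i j : linear (psiU i j).
Proof.
move=> a u v; apply/ffunP => b'; rewrite !ffunE scaler_sumr -big_split; apply: eq_bigr => b _ /=.
case: ifP => _; last by rewrite scaler0 addr0.
by rewrite !ffunE mulrDl -mulrA.
Qed.

Lemma f_op_deg (i j : 'I_n) u b' : (i < j)%N ->
  f_op K la i j (scale_by (fun b => (all_prefixed i b)%:R) u) b' != 0 ->
  exists b, [/\ u b != 0, all_prefixed i b & tdeg S b' <= tdeg S b + A i j].
Proof.
move=> ij; rewrite f_op_coord => nz.
have [b hb] : exists b, (scale_by (fun b => (all_prefixed i b)%:R) u b : K) *
    \sum_p fcoef K i j (b p) (b' p) * agree_off K p b b' != 0.
  apply/existsP; apply: contraNT nz; rewrite negb_exists => /forallP h.
  by apply/eqP; apply: big1 => b _; apply/eqP/negbNE.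
move: hb; rewrite ffunE mulf_eq0 negb_or mulf_eq0 negb_or pnatr_eq0 eqb0 negbK => /andP[/andP[pb ub] sb].
exists b; split=> //.
have [p hp] : exists p, fcoef K i j (b p) (b' p) * agree_off K p b b' != 0.
  apply/existsP; apply: contraNT sb; rewrite negb_exists => /forallP h.
  by apply/eqP; apply: big1 => p _; apply/eqP/negbNE.
move: hp; rewrite mulf_eq0 negb_or => /andP[fnz anz].
have := sigma_fcoef hA1 hA2 ij (forallP pb p) fnz; rewrite (tdeg_agree anz); lia.
Qed.

(** Coordinates of degree below [m] only reach degrees below [m + A i j], so the top component of
    the image depends on the top component alone. *)
Lemma psiU_comp (i j : 'I_n) m u : (i < j)%N -> u \in Ufil K la S m ->
  tcomp K la S (m + A i j) (f_op K la i j (scale_by (fun b => (all_prefixed i b)%:R) u)) =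
  psiU i j (tcomp K la S m u).
Proof.
move=> ij /mem_Ufil um; rewrite !tcompE; apply/ffunP => b'; rewrite [LHS]ffunE [RHS]ffunE f_op_coord.
case: eqP => [e|ne]; last first.
  rewrite big1 // => b _; rewrite ffunE; case: ifP => // /andP[_ /eqP e].
  by case: eqP => [bm|_]; rewrite ?mul0r //; case: ne; rewrite e bm.
apply: eq_bigr => b _; rewrite !ffunE e (inj_eq (addIr _)) eq_sym.
case: (boolP (all_prefixed i b)) => pb /=; last by rewrite !mul0r.
rewrite mul1r; case: eqP => // bm.
have [->|/um le] := eqVneq (u b) 0; first by rewrite mul0r.
rewrite big1 ?mulr0 // => p _; have [->|fnz] := eqVneq (fcoef K i j (b p) (b' p)) 0; first by rewrite mul0r.
have [->|anz] := eqVneq (agree_off K p b b') 0; first by rewrite mulr0.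
have := sigma_fcoef hA1 hA2 ij (forallP pb p) fnz; have := tdeg_agree anz; lia.
Qed.

Lemma mem_LS_comp m u : u \in LS K la S -> tcomp K la S m u \in (tcomp K la S m @: Lfil K la S m)%VS.
Proof.
rewrite /LS => uL; have : forall r, uniq r -> forall w, w \in (\sum_(m <- r) tcomp K la S m @: Lfil K la S m)%VS ->
   tcomp K la S m w \in (tcomp K la S m @: Lfil K la S m)%VS.
  elim=> [_ w|m' r IH]; first by rewrite big_nil memv0 => /eqP ->; rewrite linear0 mem0v.
  rewrite big_cons => /= /andP[m'r ur] w /memv_addP[w1 /memv_imgP[v vL ->] [w2 w2r ->]].
  rewrite linearD /=; apply: memvD; last exact: IH.
  rewrite !tcompE; have [->|ne] := eqVneq m m'.
    rewrite (_ : restr _ (restr _ v) = restr (fun b => tdeg S b == m') v); last first.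
      by apply/ffunP => b; rewrite !ffunE; case: (_ == m').
    by rewrite -tcompE memv_img.
  rewrite (_ : restr _ (restr _ v) = 0) ?mem0v //; apply/ffunP => b; rewrite !ffunE.
  by case: eqP => // ->; rewrite (negbTE ne).
by move=> h; exact: (h _ (undup_uniq _) u uL).
Qed.

Lemma sub_LS m u : u \in (tcomp K la S m @: Lfil K la S m)%VS -> u \in LS K la S.
Proof.
move=> um; case: (boolP (m \in tdegs la S)) => mt.
  rewrite /LS (bigD1_seq m) ?undup_uniq //=; exact: (subvP (addvSl _ _)).
have [v _ ->] := memv_imgP um; rewrite tcompE (_ : restr _ v = 0) ?mem0v //.
apply/ffunP => b; rewrite !ffunE; case: eqP => // e; case/negP: mt; rewrite -e mem_undup.
by apply/mapP; exists b; rewrite ?mem_enum.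
Qed.

Lemma sum_tcomp u : \sum_(m <- tdegs la S) tcomp K la S m u = u.
Proof.
apply/ffunP => b; rewrite sum_ffunE (bigD1_seq (tdeg S b)) ?undup_uniq //=; last first.
  by rewrite mem_undup; apply/mapP; exists b; rewrite ?mem_enum.
rewrite tcompE ffunE eqxx big1 ?addr0 // => m ne; rewrite tcompE ffunE eq_sym (negbTE ne).
by [].
Qed.

Lemma lift_tcomp m u : u \in (tcomp K la S m @: Lfil K la S m)%VS ->
  Defs.lift K la S m u \in Lfil K la S m /\ tcomp K la S m (Defs.lift K la S m u) = u.
Proof.
move=> um; rewrite /Defs.lift comp_lfunE; set incl := linfun _.
have inclE x : incl x = vsval x by rewrite lfunE.
split; first by rewrite inclE; exact: subvsP.
have um' : u \in limg (tcomp K la S m \o incl)%VF.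
  have [v vL ->] := memv_imgP um; have -> : tcomp K la S m v = (tcomp K la S m \o incl)%VF (vsproj _ v).
    by rewrite comp_lfunE inclE vsprojK.
  exact: memv_img (memvf _).
by rewrite -[RHS](limg_lfunVK um') [RHS]comp_lfunE.
Qed.

(** By [psiU_comp] the choice of lift disappears: on each degree the induced map is the restriction
    of [psiU]. *)
Lemma gr_opE (i j : 'I_n) (w : subvs_of (LS K la S)) : (i < j)%N ->
  vsval (gr_op S (A i j) (phi K la i j) w) = psiU i j (vsval w).
Proof.
move=> ij; rewrite /gr_op !comp_lfunE [linfun vsval w]lfunE [linfun (vsproj _) _]lfunE /= sum_lfunE.
have E m : (tcomp K la S (m + A i j) \o phi K la i j \o Defs.lift K la S m \o tcomp K la S m)%VF (vsval w) =
    psiU i j (tcomp K la S m (vsval w)) /\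
    (tcomp K la S (m + A i j) \o phi K la i j \o Defs.lift K la S m \o tcomp K la S m)%VF (vsval w) \in LS K la S.
  rewrite 3!comp_lfunE; have [vL ve] := lift_tcomp (mem_LS_comp m (subvsP w)).
  move: vL; rewrite memv_cap => /andP[vL vU].
  rewrite (phiE i j vL) psiU_comp // ve; split=> //; rewrite -[in psiU _ _ _]ve -psiU_comp //.
  apply: (@sub_LS (m + A i j)); apply: memv_img; rewrite memv_cap stable_f_op /=; last 2 first.
  - by apply: contraTneq ij => ->; rewrite ltnn.
  - have hP b b' : same_weight b b' -> all_prefixed i b = all_prefixed i b'.
      by rewrite /all_prefixed -!belowP => /same_weightP ->.
    have := sum_weight_space hP vL; apply: subvP; apply/subv_sumP => b _; exact: capvSl.
  apply/mem_Ufil => b' /(f_op_deg ij)[b [ub _ le]]; apply: le_trans le _.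
  by rewrite lerD2r; apply: (mem_Ufil _ _ vU).
rewrite vsprojK; last by apply: memv_suml => m _; case: (E m).
transitivity (\sum_(m <- tdegs la S) psiU i j (tcomp K la S m (vsval w))).
  by apply: eq_bigr => m _; case: (E m).
have L := linfun_linear (psiU_linear i j).
have e : linfun (psiU i j) (\sum_(m <- tdegs la S) tcomp K la S m (vsval w)) =
  \sum_(m <- tdegs la S) linfun (psiU i j) (tcomp K la S m (vsval w)) by exact: linear_sum.
by rewrite sum_tcomp L in e; rewrite e; apply: eq_bigr => m _; rewrite L.
Qed.

End GradedAction.

(** The iterates before the first vanishing one are linearly independent, so there are at most \dim
    of them. This matches the truncation in [lexp] with the nilpotency found on pure tensors. *)
Lemma nilpotent_dim (K : fieldType) (W : vectType K) (g : 'End(W)) (x : W) (N m : nat) :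
  iter N g x = 0 -> (\dim {:W} <= m)%N -> iter m g x = 0.
Proof.
move=> gN; have exP : exists d, iter d g x == 0 by exists N; apply/eqP.
have [d /eqP gd dmin] := ex_minnP exP => dm.
have iter0 k : iter k g (0 : W) = 0 by elim: k => //= k ->; rewrite linear0.
suff le : (d <= \dim {:W})%N.
  by rewrite -(subnK (leq_trans le dm)) iterD gd iter0.
case: (posnP d) => [->//|d0].
have itL k (I : finType) (f : I -> K) (y : I -> W) :
    iter k g (\sum_i f i *: y i) = \sum_i f i *: iter k g (y i).
  by elim: k => //= k ->; rewrite linear_sum; apply: eq_bigr => i _; rewrite linearZ.
pose X := [tuple iter i g x | i < d].
have XE (i : 'I_d) : X`_i = iter i g x by rewrite -tnth_nth tnth_mktuple.
suff fX : free X.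
  rewrite -[d](size_tuple X) -(eqP fX); apply: dimvS; exact: subvf.
apply/freeP => f fX; suff H k : forall i : 'I_d, (i < k)%N -> f i = 0 by move=> i; apply: (H d).
elim: k => // k IH i; rewrite ltnS leq_eqVlt => /orP[/eqP ik|]; last exact: IH.
(* The power d-1-k of [g] isolates the k-th coefficient: earlier ones vanish by induction and later
   iterates reach g^d x = 0. *)
have := congr1 (iter (d.-1 - k) g) fX; rewrite iter0 itL (bigD1 i) //= big1 => [|j ji]; last first.
  case: (ltngtP j k) => [jk|kj|e]; first by rewrite IH // scale0r.
    rewrite XE -iterD -[X in iter X](@subnK d); last by have := ltn_ord i; lia.
    by rewrite iterD gd iter0 scaler0.
  by case/eqP: ji; apply: ord_inj; rewrite ik.
rewrite addr0 XE ik -iterD subnK; last by have := ltn_ord i; lia.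
move/eqP; rewrite scaler_eq0 => /orP[/eqP //|/dmin].
by have := d0; lia.
Qed.

(** * Exponentials act factorwise on pure tensors *)

Section ExpAction.
Variables (K : numFieldType) (n : nat) (A : 'I_n -> 'I_n -> int) (la : 'I_n.-1 -> nat).
Hypothesis hA1 : forall i j k : 'I_n, j = i.+1 :> nat -> k = j.+1 :> nat ->
     A i j + A j k <= A i k.
Hypothesis hA2 : forall i i' j j' : 'I_n, i' = i.+1 :> nat -> j' = j.+1 :> nat ->
     (i.+1 < j)%N -> A i j + A i' j' <= A i j' + A i' j.
Notation tb := (tbasis la).
Notation ps := (pos la).
Notation U := {ffun tb -> K^o}.
Notation S := (fun k : 'I_n.-1 => @sigma n k.+1 A).
Implicit Types (b : tb) (u : U).

Lemma fdef_supp k (i j : 'I_n) (w : ext K n k) : (i < j)%N -> supp_in i (fdef A 0 i j w).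
Proof.
move=> ij t; rewrite ffunE => nz.
have [t' ht] : exists t', (if prefixed i t' then
     (w t' : K) * fcoef K i j t' t * 0 ^+ absz (sigma A t' + A i j - sigma A t)%R else 0) != 0.
  apply/existsP; apply: contraNT nz; rewrite negb_exists => /forallP h.
  by apply/eqP; apply: big1 => t' _; apply/eqP/negbNE.
case: ifP ht => [pt|]; last by rewrite eqxx.
rewrite mulf_eq0 negb_or mulf_eq0 negb_or => /andP[/andP[_ nz'] _].
exact: prefixed_fcoef nz'.
Qed.

(** After one application the index [i] has been replaced by [j], so nothing is left to act on. *)
Lemma fdef_nil k (i j : 'I_n) (w : ext K n k) : (i < j)%N -> fdef A 0 i j (fdef A 0 i j w) = 0.
Proof.
move=> ij; apply/ffunP => t; rewrite [LHS]ffunE [RHS]ffunE big1 // => t' _.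
case: ifP => // pt'; suff [->|->] : (fdef A 0 i j w t' = 0 :> K) \/ fcoef K i j t' t = 0.
- by rewrite !mul0r.
- by rewrite mulr0 mul0r.
case: (boolP [exists l, tnth (val t') l == i]) => [/existsP[l /eqP li]|h]; last first.
  by right; apply: fcoef_out => l; move: h; rewrite negb_exists => /forallP.
left; rewrite ffunE big1 // => t'' _; case: ifP => // pt''.
have [->|/fcoef_neq0[l' [l'i [s hs]]]] := eqVneq (fcoef K i j t'' t') 0; first by rewrite mulr0 mul0r.
have := hs (s^-1 l)%g; rewrite permKV li; case: eqP => [_ e|ne e].
  by move: ij; rewrite -e ltnn.
by case: ne; apply: (@incr_inj _ _ t''); rewrite -e l'i.
Qed.

Lemma tens_coord (w : forall p : ps, ext K n (tag p).+1) b : tens w b = \prod_p (w p (b p) : K).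
Proof. by rewrite ffunE. Qed.

Lemma psiU_tens (i j : 'I_n) (w : forall p : ps, ext K n (tag p).+1) : (i < j)%N ->
  (forall p, supp_in i (w p)) ->
  psiU A i j (tens w) = \sum_p tens (fun q => if q == p then fdef A 0 i j (w q) else w q).
Proof.
move=> ij ws; apply/ffunP => b'; rewrite sum_ffunE ffunE.
pose M (p : ps) (t t' : incr n (tag p).+1) : K := if prefixed i t then
  fcoef K i j t t' * 0 ^+ absz (sigma A t + A i j - sigma A t')%R else 0.
transitivity (\sum_(b : tb) (\prod_q (w q (b q) : K)) * \sum_p M p (b p) (b' p) * agree_off K p b b').
  apply: eq_bigr => b _; rewrite tens_coord; set P := \prod_q _.
  have [->|P0] := eqVneq P 0; first by rewrite !mul0r; case: ifP.
  have pb : all_prefixed i b.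
    apply/forallP => p; apply: (ws p); move/prodf_neq0: P0; exact.
  rewrite pb /= -[if _ then _ else 0](_ : P * (if tdeg S b' == tdeg S b + A i j then \sum_p fcoef K i j (b p) (b' p) * agree_off K p b b' else 0) = _); last first.
    by case: ifP; rewrite ?mulr0.
  congr (_ * _); rewrite -[if _ then _ else 0](_ : \sum_p (if tdeg S b' == tdeg S b + A i j then fcoef K i j (b p) (b' p) * agree_off K p b b' else 0) = _); last first.
    by case: ifP => // _; rewrite big1.
  apply: eq_bigr => p _; rewrite /M (forallP pb p).
  have [->|anz] := eqVneq (agree_off K p b b') 0; first by rewrite !mulr0 if_same.
  rewrite (tdeg_agree A anz) expr0n absz_eq0 subr_eq0.
  have -> : (tdeg S b - sigma A (b p) + sigma A (b' p) == tdeg S b + A i j) = (sigma A (b p) + A i j == sigma A (b' p)).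
    by rewrite -addrA (inj_eq (addrI _)) addrC subr_eq addrC eq_sym.
  by case: ifP; rewrite ?mulr1 // mulr0 mul0r.
rewrite leibniz; apply: eq_bigr => p _; rewrite tens_coord [RHS](bigD1 p) //= eqxx; congr (_ * _).
  rewrite ffunE; apply: eq_bigr => t _; rewrite /M; case: ifP => _; last by rewrite mulr0.
  by rewrite mulrA.
by apply: eq_bigr => q /negbTE ->.
Qed.

Section Powers.
Variables (i j : 'I_n) (ij : (i < j)%N) (w : forall p : ps, ext K n (tag p).+1).
Hypothesis ws : forall p, supp_in i (w p).

Let wT (T : {set ps}) (q : ps) := if q \in T then fdef A 0 i j (w q) else w q.

(** The m-th power of [psiU] over m!: since [fdef] squares to zero, it acts once on each factor of a
    set of m factors. *)
Definition divided_power (m : nat) : U := \sum_(T : {set ps} | #|T| == m) tens (wT T).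

Lemma psiU_wT (T : {set ps}) : psiU A i j (tens (wT T)) = \sum_(p | p \notin T) tens (wT (p |: T)%SET).
Proof.
rewrite psiU_tens // => [|p]; last by rewrite /wT; case: ifP => _ //; exact: fdef_supp.
rewrite (bigID (fun p => p \in T)) /= big1 ?add0r => [|p pT]; last first.
  apply/ffunP => b; rewrite tens_coord [RHS]ffunE (bigD1 p) //= eqxx /wT pT fdef_nil // ffunE.
  by rewrite mul0r.
apply: eq_bigr => p pT; congr tens; apply: functional_extensionality_dep => q; rewrite /wT !inE.
by case: eqP => //= ->; rewrite (negbTE pT).
Qed.

(** Each set of m + 1 factors arises in m + 1 ways by adding one factor to a set of size m. *)
Lemma psiU_divided m : psiU A i j (divided_power m) = m.+1%:R *: divided_power m.+1.
Proof.
have L := linfun_linear (psiU_linear (K := K) A (la := la) i j).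
rewrite -L /divided_power linear_sum /= scaler_sumr.
transitivity (\sum_(T : {set ps} | #|T| == m) \sum_(p | p \notin T) tens (wT (p |: T)%SET)).
  by apply: eq_bigr => T _; rewrite L psiU_wT.
rewrite (exchange_big_dep xpredT) //=.
transitivity (\sum_p \sum_(T : {set ps} | (#|T| == m.+1) && (p \in T)) tens (wT T)).
  apply: eq_bigr => p _; rewrite [RHS](reindex_onto (fun T => p |: T)%SET (fun T => T :\ p)%SET) /=.
    apply: eq_bigl => T; rewrite finset.setU11 andbT cardsU1.
    case: (boolP (p \in T)) => pT; rewrite ?andbF ?andbT /=.
      apply/esym/negbTE; rewrite negb_and; apply/orP; right.
      by apply: contraTneq pT => <-; rewrite !inE eqxx.
    by rewrite add1n eqSS finset.setU1K // eqxx andbT.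
  by move=> T /andP[_ pT]; rewrite finset.setD1K.
rewrite (exchange_big_dep (fun T : {set ps} => #|T| == m.+1)) /=; last by move=> p T _ /andP[].
apply: eq_bigr => T /eqP Tm; rewrite (eq_bigl (fun p => p \in T)); last by move=> p; rewrite Tm eqxx.
by rewrite sumr_const Tm scaler_nat.
Qed.

Lemma divided_power0 : divided_power 0 = tens w.
Proof.
rewrite /divided_power (big_pred1 finset.set0) => [|T]; last by rewrite cards_eq0.
by congr tens; apply: functional_extensionality_dep => q; rewrite /wT inE.
Qed.

Lemma divided_power_sum (c : K) : \sum_(m < #|ps|.+1) c ^+ m *: divided_power m =
  tens (fun p => [ffun t => (w p t : K) + c * (fdef A 0 i j (w p) t : K)]).
Proof.
apply/ffunP => b; rewrite tens_coord.
under [RHS]eq_bigr do rewrite ffunE addrC.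
rewrite bigA_distr /= sum_ffunE (partition_big (fun T : {set ps} => inord #|T| : 'I_#|ps|.+1) predT) //=.
apply: eq_bigr => m _; rewrite scale_coordE sum_ffunE mulr_sumr; apply: eq_big => T.
  have Tm : (#|T| < #|ps|.+1)%N by rewrite ltnS max_card.
  by apply/eqP/eqP => [->|<-]; rewrite ?inord_val ?inordK.
move=> /eqP <-; rewrite tens_coord /wT -prodr_const big_mkcond -big_split /=; apply: eq_bigr => q _.
by case: ifP; rewrite ?mul1r.
Qed.

Lemma iter_psiU m : iter m (psiU A i j) (tens w) = m`!%:R *: divided_power m.
Proof.
elim: m => [|m IH]; first by rewrite divided_power0 scale1r.
have L := linfun_linear (psiU_linear (K := K) A (la := la) i j).
by rewrite /= IH -L linearZ /= L psiU_divided scalerA -natrM mulnC factS.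
Qed.

Lemma lexp_gr_op (c : K) (x : subvs_of (LS K la S)) : vsval x = tens w ->
  vsval (lexp (c *: gr_op S (A i j) (phi K la i j)) x) =
  tens (fun p => [ffun t => (w p t : K) + c * (fdef A 0 i j (w p) t : K)]).
Proof.
move=> xw; set G := gr_op S _ _; pose N := \dim {:subvs_of (LS K la S)}.
have itG m : vsval (iter m G x) = m`!%:R *: divided_power m.
  by rewrite -iter_psiU -xw; elim: m => //= m <-; rewrite gr_opE.
have itc m : iter m (c *: G) x = c ^+ m *: iter m G x.
  elim: m => [|m IH]; first by rewrite scale1r.
  by rewrite /= IH scale_lfunE linearZ /= scalerA exprS.
have big0 m : (#|ps| < m)%N -> divided_power m = 0.
  move=> ml; rewrite /divided_power big1 // => T /eqP Tm.
  by have := max_card (mem T); rewrite Tm leqNgt ml.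
have G0 : iter #|ps|.+1 G x = 0 by apply: val_inj; apply: etrans (itG _) _; rewrite big0 // scaler0.
have dim0 m : (N < m)%N -> divided_power m = 0.
  move=> Nm; have := itG m; rewrite (nilpotent_dim G0 (ltnW Nm)) linear0 => /esym/eqP.
  by rewrite scaler_eq0 pnatr_eq0 -[m`! == 0]negbK -lt0n fact_gt0 => /eqP.
rewrite -divided_power_sum /lexp linear_sum /=.
transitivity (\sum_(m < N.+1) c ^+ m *: divided_power m).
  apply: eq_bigr => m _; rewrite itc !linearZ /= itG !scalerA; congr (_ *: _).
  by rewrite divfK // pnatr_eq0 -lt0n fact_gt0.
(* Terms vanish beyond the dimension and also beyond the number of factors; both truncated sums are
   compared with a longer common one. *)
have trunc M M' : (forall m, (M < m)%N -> divided_power m = 0) -> (M <= M')%N ->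
    \sum_(m < M'.+1) c ^+ m *: divided_power m = \sum_(m < M.+1) c ^+ m *: divided_power m.
  move=> M0 MM; rewrite [RHS](big_ord_widen M'.+1 (fun m => c ^+ m *: divided_power m)) //.
  rewrite [RHS]big_mkcond; apply: eq_bigr => m _; case: ltnP => // Mm.
  by rewrite M0 ?scaler0.
rewrite -(trunc N (N + #|ps|)%N) ?leq_addr // (trunc #|ps|) ?leq_addl //.
Qed.

End Powers.

Lemma vsval_vlaS : vsval (vlaS K la S) = tens (fun p => ext_hw K n (tag p).+1).
Proof.
have hw0 b : vla K la b != 0 -> tdeg S b = 0.
  rewrite tens_coord => /prodf_neq0 h; rewrite /tdeg big1 // => p _.
  have := h p isT; rewrite ext_hwE pnatr_eq0 eqb0 negbK => /prefixedP hp.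
  by rewrite sigmaE big1 // => a _; rewrite hp // costxx.
have e : tcomp K la S 0 (vla K la) = vla K la.
  rewrite tcompE; apply/ffunP => b; rewrite ffunE; case: eqP => // ne.
  by apply/esym/eqP; apply: contra_notT ne => /hw0.
rewrite /vlaS vsprojK e //; apply: (@sub_LS _ _ _ _ 0); rewrite -[in X in X \in _]e; apply: memv_img.
rewrite memv_cap; apply/andP; split; first by case: (cyclic_subrepP (fun f => exists2 x : 'M[K]_n, \tr x = 0 & act la x = f) (vla K la)).
by apply/mem_Ufil => b /hw0 ->.
Qed.

Lemma exp_actionE c : vsval (exp_action A c (vlaS K la S)) = tens (fun p : ps => orbit_fam A c (tag p)).
Proof.
rewrite /exp_action -/(root_list n) /orbit_fam /orbit_vec.
have := root_list_increasing n; elim: (root_list n) => [_|[i j] L IH]; first exact: vsval_vlaS.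
rewrite /increasing_list /= => /andP[/andP[ij aL] /andP[h pL]].
have iL : increasing_list L by rewrite /increasing_list aL pL.
rewrite (lexp_gr_op ij _ _ (IH iL)) // => p.
by apply: eorbit_supp => // i0; exact: ext_hw_supp.
Qed.

End ExpAction.

(** * The Segre embedding and the closure of the orbit *)

Section Forms.
Variables (K : numFieldType) (n : nat).
Notation R := {mpoly K[#|plu n|]}.
Notation family := (forall k : 'I_n.-1, ext K n k.+1).

(** Multihomogeneous forms of multidegree [mu], as functions on families of vectors. *)
Definition multiform (mu : 'I_n.-1 -> nat) (F : family -> K) :=
  spanned (fun (b : tbasis mu) v => tmon v b) predT F.

Lemma multiform_mem mu (b : tbasis mu) : multiform mu (fun v => tmon v b).
Proof. exact: (@spanned_mem _ _ _ (fun (b : tbasis mu) v => tmon v b) predT b isT). Qed.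

Lemma tmon_prod mu (v : family) (b : tbasis mu) :
  tmon v b = \prod_k \prod_(i < mu k) (v k (b (existT _ k i)) : K).
Proof.
rewrite (@sig_big_dep _ _ _ _ (fun k => 'I_(mu k)) predT (fun _ => predT)
  (fun k i => v k (b (existT _ k i)) : K)) /tmon /=.
by apply: eq_bigr => -[k i] _.
Qed.

Lemma multiform_eq mu mu' F : mu =1 mu' -> multiform mu F -> multiform mu' F.
Proof. by move=> e; have -> : mu' = mu by apply: functional_extensionality_dep. Qed.

Lemma multiform1 : multiform (fun _ => 0%N) (fun _ => 1).
Proof.
pose b0 : tbasis (fun _ : 'I_n.-1 => 0%N) :=
  [ffun p : pos (fun _ : 'I_n.-1 => 0%N) => False_rect _ (notF (ltn_ord (tagged p) : false))].
apply: spanned_ext (multiform_mem b0) => v.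
by rewrite tmon_prod big1 // => k _; rewrite big_ord0.
Qed.

Definition tab_cat (mu mu' : 'I_n.-1 -> nat) (b : tbasis mu) (b' : tbasis mu') : tbasis (fun k => mu k + mu' k)%N :=
  [ffun p => match split (tagged p) with
             | inl i => b (existT _ (tag p) i)
             | inr i => b' (existT _ (tag p) i) end].

Lemma tmon_cat (mu mu' : 'I_n.-1 -> nat) (b : tbasis mu) (b' : tbasis mu') (v : family) :
  tmon v (tab_cat b b') = tmon v b * tmon v b'.
Proof.
rewrite !tmon_prod -big_split; apply: eq_bigr => k _; rewrite big_split_ord; congr (_ * _).
  by apply: eq_bigr => i _; rewrite ffunE /= (unsplitK (inl i)).
by apply: eq_bigr => i _; rewrite ffunE /= (unsplitK (inr i)).
Qed.

Lemma multiformM mu mu' F G : multiform mu F -> multiform mu' G ->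
  multiform (fun k => mu k + mu' k)%N (fun v => F v * G v).
Proof.
move=> [kap [_ FE]] [kap' [_ GE]].
apply: (@spanned_ext _ _ _ _ _ (fun v => \sum_b \sum_b' (kap b * kap' b') * tmon v (tab_cat b b'))).
  move=> v; rewrite FE GE mulr_suml; apply: eq_bigr => b _; rewrite mulr_sumr.
  by apply: eq_bigr => b' _; rewrite tmon_cat mulrACA.
apply: spanned_sum => b _; apply: spanned_sum => b' _; apply: spannedZ.
exact: (multiform_mem (tab_cat b b')).
Qed.

Lemma multiform_prod (I : Type) (r : seq I) (F : I -> family -> K) (e : I -> nat) mu :
  (forall i, multiform mu (F i)) ->
  multiform (fun k => (\sum_(i <- r) e i) * mu k)%N (fun v => \prod_(i <- r) F i v ^+ e i).
Proof.
move=> hF; have hX i m : multiform (fun k => m * mu k)%N (fun v => F i v ^+ m).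
  elim: m => [|m IH]; first exact: multiform1.
  apply: (multiform_eq (mu := fun k => (mu k + m * mu k)%N)) => [k|]; first by rewrite mulSn.
  by apply: spanned_ext (multiformM (hF i) IH) => v; rewrite exprS.
elim: r => [|i r IH].
  apply: (multiform_eq (mu := fun _ => 0%N)) => [k|]; first by rewrite big_nil.
  by apply: spanned_ext multiform1 => v; rewrite big_nil.
apply: (multiform_eq (mu := fun k => (e i * mu k + (\sum_(i <- r) e i) * mu k)%N)) => [k|].
  by rewrite big_cons mulnDl.
by apply: spanned_ext (multiformM (hX i (e i)) IH) => v; rewrite big_cons.
Qed.

Lemma multiform_linear mu (f : {ffun tbasis mu -> K^o} -> K^o) : linear f ->
  multiform mu (fun v => f (tens (fun p => v (tag p)))).
Proof.
move=> lf; pose de b : {ffun tbasis mu -> K^o} := [ffun b' => (b' == b)%:R].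
apply: (@spanned_ext _ _ _ _ _ (fun v => \sum_b (f (de b) : K) * tmon v b)) => [v|]; last first.
  apply: spanned_sum => b _; apply: spannedZ.
  exact: (multiform_mem b).
have L := linfun_linear lf.
have -> : tens (fun p => v (tag p)) = \sum_b tmon v b *: de b.
  apply/ffunP => b; rewrite tens_coord sum_ffunE (bigD1 b) //= [X in _ + X]big1 ?addr0 => [|b' ne].
    by rewrite scale_coordE ffunE eqxx mulr1.
  by rewrite scale_coordE ffunE eq_sym (negbTE ne) mulr0.
rewrite -L linear_sum; apply: eq_bigr => b _; rewrite linearZ /= L.
by rewrite mulrC.
Qed.

Definition multideg (m : 'X_{1..#|plu n|}) (k : 'I_n.-1) : nat := \sum_(t : incr n k.+1) m (plu_var t).

Lemma plu_prodE (f : 'I_#|plu n| -> K) :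
  \prod_a f a = \prod_(k < n.-1) \prod_(t : incr n k.+1) f (plu_var t).
Proof.
rewrite (@sig_big_dep _ _ _ _ (fun k : 'I_n.-1 => incr n k.+1) predT (fun _ => predT)
  (fun k t => f (plu_var t))) /=.
rewrite (reindex (@enum_rank (plu n))) /=; last by apply: onW_bij; exact: enum_rank_bij.
by apply: eq_bigr => -[k t] _.
Qed.

Lemma multiform_monomial (m : 'X_{1..#|plu n|}) :
  multiform (multideg m) (fun v => plu_eval ('X_[m] : R) v).
Proof.
pose l k := flatten [seq nseq (m (plu_var t)) t | t : incr n (k : 'I_n.-1).+1].
have sl k : size (l k) == multideg m k.
  rewrite size_flatten /shape -map_comp sumnE big_map big_enum /=.
  by apply/eqP/eq_bigr => t _; rewrite size_nseq.
pose b : tbasis (multideg m) := [ffun p => tnth (Tuple (sl (tag p))) (tagged p)].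
apply: spanned_ext (multiform_mem b) => v.
rewrite /plu_eval mevalX plu_prodE tmon_prod; apply: eq_bigr => k _.
transitivity (\prod_(t <- Tuple (sl k)) (v k t : K)).
  by rewrite big_tuple; apply: eq_bigr => i _; rewrite ffunE.
rewrite /l /= big_flatten big_map big_enum /=; apply: eq_bigr => t _.
rewrite /plu_var enum_rankK /=; elim: (m _) => [|e IH]; first by rewrite big_nil.
by rewrite /= big_cons IH exprS.
Qed.

End Forms.

Section ProjectivePoints.
Variables (K : fieldType) (W : vectType K).

Lemma proj_repP (x : proj W) : val x = <[proj_rep x]>%VS.
Proof.
apply/esym/eqP; rewrite eqEdim; apply/andP; split; first by rewrite -memvE memv_pick.
by rewrite (eqP (valP x)) dim_vline proj_rep_neq0.
Qed.

Lemma line_eq (u v : W) (z : K) : z != 0 -> u = z *: v -> <[u]>%VS = <[v]>%VS.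
Proof.
move=> z0 ->; apply/eqP; rewrite eqEsubv -!memvE memvZ ?memv_line //=.
by apply/vlineP; exists z^-1; rewrite scalerA mulVf // scale1r.
Qed.

Lemma vline_neq0 (u v : W) : u != 0 -> <[u]>%VS = <[v]>%VS -> exists2 z : K, z != 0 & u = z *: v.
Proof.
move=> u0 e; have /vlineP[z uz] : u \in <[v]>%VS by rewrite -e memv_line.
by exists z => //; apply: contraNneq u0 => z0; rewrite uz z0 scale0r.
Qed.

Lemma proj_incl_line (V : {vspace W}) (x : proj (subvs_of V)) u :
  val x = <[u]>%VS -> val (proj_incl x) = <[vsval u]>%VS.
Proof. by move=> e; rewrite /= e limg_line lfunE. Qed.

End ProjectivePoints.

Section SegreImage.
Variables (K : numFieldType) (n : nat) (A : 'I_n -> 'I_n -> int) (la : 'I_n.-1 -> nat).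
Hypothesis hA1 : forall i j k : 'I_n, j = i.+1 :> nat -> k = j.+1 :> nat ->
     A i j + A j k <= A i k.
Hypothesis hA2 : forall i i' j j' : 'I_n, i' = i.+1 :> nat -> j' = j.+1 :> nat ->
     (i.+1 < j)%N -> A i j + A i' j' <= A i j' + A i' j.
Hypothesis hla : forall k, (0 < la k)%N.
Notation tb := (tbasis la).
Notation ps := (pos la).
Notation U := {ffun tb -> K^o}.
Notation S := (fun k : 'I_n.-1 => @sigma n k.+1 A).
Notation LSA := (LS K la S).
Notation family := (forall k : 'I_n.-1, ext K n k.+1).
Notation multiproj := (forall k : 'I_n.-1, proj (ext K n k.+1)).
Notation degenerate := (@degenerate_flag_variety K n S).

Definition ten (v : family) : U := tens (fun p : ps => v (tag p)).

Lemma ten_scale (z : 'I_n.-1 -> K) (v : family) :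
  ten (fun k => z k *: v k) = (\prod_(p : ps) z (tag p)) *: ten v.
Proof.
by apply/ffunP => b; rewrite scale_coordE !tens_coord -big_split; apply: eq_bigr => p _; rewrite scale_coordE.
Qed.

Lemma ten_orbit c : ten (orbit_fam A c) = vsval (exp_action A c (vlaS K la S)).
Proof. by rewrite exp_actionE. Qed.

Lemma ten_orbit_neq0 c : ten (orbit_fam A c) != 0.
Proof. by apply: tens_neq0 => p; apply: orbit_vec_neq0 => //; exact: wt_size. Qed.

Definition on_lines (v : family) (x : multiproj) := forall k, v k \in val (x k) /\ v k != 0.

Lemma proj_rep_on_lines x : on_lines (fun k => proj_rep (x k)) x.
Proof. by move=> k; split; [exact: memv_pick|exact: proj_rep_neq0]. Qed.

Lemma multiform_vanish mu F x v : multiform mu F -> (forall c, F (orbit_fam A c) = 0) ->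
  degenerate x -> on_lines v x -> F v = 0.
Proof.
move=> [kap [_ FE]] F0 xF vx; rewrite FE; apply: (degenerate_vanish hA1 hA2 _ xF vx) => c.
by rewrite -FE.
Qed.

(** Each coordinate of [u - projv LSA u] pulls back to a form vanishing on the orbit, hence on F^S:
    the linear equations of [LS] are inherited. *)
Lemma ten_LS x v : degenerate x -> on_lines v x -> ten v \in LSA.
Proof.
move=> xF vx; pose f (b : tb) (u : U) : K^o := (u - projv LSA u) b.
suff h b : f b (ten v) = 0.
  have -> : ten v = projv LSA (ten v).
    by apply/eqP; rewrite -subr_eq0; apply/eqP/ffunP => b; rewrite [RHS]ffunE; exact: h.
  exact: memv_proj.
apply: (@multiform_vanish la (fun v => f b (ten v)) x v _ _ xF vx).
  apply: multiform_linear => a u1 u2; rewrite /f linearP opprD addrACA -scalerBr.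
  by rewrite [LHS]ffunE [in LHS]ffunE.
move=> c; rewrite /f ten_orbit projv_id ?subvsP // subrr ffunE.
by [].
Qed.

Lemma ten_rep_neq0 x : ten (fun k => proj_rep (x k)) != 0.
Proof. by apply: tens_neq0 => p; exact: proj_rep_neq0. Qed.

Lemma vsproj_neq0 (u : U) : u \in LSA -> u != 0 -> vsproj LSA u != 0.
Proof. by move=> uL; apply: contraNneq => /(congr1 vsval); rewrite vsprojK // linear0 => ->. Qed.

Lemma vlaS_neq0 : vlaS K la S != 0.
Proof.
apply/eqP => e; have := vsval_vlaS K A la; rewrite e => /esym/eqP; apply/negP.
by apply: tens_neq0 => p; rewrite ext_hw_wedge; have := flag_vec_neq0 (tag p) (det1 K n); rewrite /flag_vec /first_cols mul1mx.
Qed.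

(** Away from the degenerate flag variety the tensor may leave [LS]; there the map takes the line of
    [vlaS] as a default. *)
Lemma ex_segre : exists iota : multiproj -> proj (subvs_of LSA),
  forall x, degenerate x -> val (iota x) = <[vsproj LSA (ten (fun k => proj_rep (x k)))]>%VS.
Proof.
suff /choice[iota h] : forall x, exists y : proj (subvs_of LSA),
    degenerate x -> val y = <[vsproj LSA (ten (fun k => proj_rep (x k)))]>%VS by exists iota.
move=> x; have [xF|nx] := pselect (degenerate x); last by exists (line vlaS_neq0).
have xL := ten_LS xF (proj_rep_on_lines x).
by exists (line (vsproj_neq0 xL (ten_rep_neq0 x))).
Qed.

Lemma ten_upd1 (w : forall p : ps, ext K n (tag p).+1) (b : tb) (p : ps) t :
  tens w (upd1 b t) = (w p t : K) * \prod_(q | q != p) (w q (b q) : K).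
Proof.
rewrite tens_coord (bigD1 p) //= upd1_in; congr (_ * _); apply: eq_bigr => q qp.
by rewrite upd1_out.
Qed.

Lemma upd1_id (b : tb) (p : ps) : upd1 b (b p) = b.
Proof.
by apply/ffunP => q; have [->|qp] := eqVneq q p; rewrite ?upd1_in ?upd1_out.
Qed.

(** Varying one tensor index of a nonzero coordinate recovers that factor up to a scalar; regularity
    supplies such a position for every [k]. *)
Lemma segre_inj (x y : multiproj) : segre la x = segre la y -> x = y.
Proof.
move=> /(congr1 val) /= e; apply: functional_extensionality_dep => k; apply: val_inj.
have [z z0 xy] := vline_neq0 (ten_rep_neq0 x) e.
pose p : ps := existT _ k (Ordinal (hla k)).
have [b bx] : exists b, ten (fun k => proj_rep (x k)) b != 0.
  apply/existsP; apply: contraNT (ten_rep_neq0 x); rewrite negb_exists => /forallP h.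
  by apply/eqP/ffunP => b; rewrite [RHS]ffunE; exact/eqP/negbNE/h.
have := @ten_upd1 (fun p => proj_rep (x (tag p))) b p (b p).
rewrite upd1_id; set X := \prod_(q | _) _ => bX.
have X0 : X != 0 by move: bx; rewrite /ten bX mulf_eq0 negb_or => /andP[].
have E : proj_rep (x k) = (X^-1 * (z * \prod_(q | q != p) (proj_rep (y (tag q)) (b q) : K))) *: proj_rep (y k).
  apply/ffunP => t; rewrite scale_coordE; apply: (mulfI X0).
  have := @ten_upd1 (fun p => proj_rep (x (tag p))) b p t.
  rewrite -/X -/(ten (fun k => proj_rep (x k))) xy scale_coordE.
  rewrite (@ten_upd1 (fun p => proj_rep (y (tag p))) b p t) => e1.
  rewrite [LHS]mulrC -e1 !mulrA mulfV // mul1r.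
  by rewrite mulrAC.
rewrite !proj_repP; apply: (line_eq _ E).
by apply: contraNneq (proj_rep_neq0 (x k)) => e0; rewrite E e0 scale0r.
Qed.

Notation coords := (fun (w : subvs_of LSA) i => coord (vbasis {:subvs_of LSA}) i w).

(** Functions on [U] that restrict to a form of degree [d] in the coordinates of [LS], the only ones
    that closed sets of its projective space detect. *)
Definition polyform (d : nat) (G : U -> K) := exists p : {mpoly K[\dim {:subvs_of LSA}]},
  p \is d.-homog /\ forall w : subvs_of LSA, p.@[coords w] = G (vsval w).

Lemma meval_homog m d (p : {mpoly K[m]}) z f : p \is d.-homog ->
  p.@[fun i => z * f i] = z ^+ d * p.@[f].
Proof.
move=> /dhomogP h; rewrite !mevalE mulr_sumr big_seq [RHS]big_seq; apply: eq_bigr => a /h <-.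
rewrite mulrCA; congr (_ * _); rewrite -[X in z ^+ X]/(mdeg a) mdegE expr_sum -big_split; apply: eq_bigr => i _.
by rewrite exprMn.
Qed.

Lemma coords_scale d (p : {mpoly K[\dim {:subvs_of LSA}]}) z w : p \is d.-homog ->
  p.@[coords (z *: w)] = z ^+ d * p.@[coords w].
Proof.
by move=> ph; rewrite -meval_homog //; apply: meval_eq => i; rewrite linearZ.
Qed.

Lemma polyform_scale d G z (w : subvs_of LSA) : polyform d G -> G (z *: vsval w) = z ^+ d * G (vsval w).
Proof.
by move=> [p [ph pE]]; rewrite -!pE -coords_scale // pE linearZ.
Qed.

Lemma polyform_coord b : polyform 1 (fun u => u b).
Proof.
pose e (i : 'I_(\dim {:subvs_of LSA})) : K := vsval (vbasis {:subvs_of LSA})`_i b.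
exists (\sum_i e i *: 'X_i); split=> [|w].
  apply: rpred_sum => i _; apply: rpredZ; by rewrite dhomogX; apply/eqP; exact: mdeg1.
rewrite raddf_sum /= {2}(coord_vbasis (memvf w)) linear_sum sum_ffunE; apply: eq_bigr => i _.
by rewrite mevalZ mevalXU linearZ scale_coordE mulrC.
Qed.

Lemma polyformD d G G' : polyform d G -> polyform d G' -> polyform d (fun u => G u + G' u).
Proof.
move=> [p [ph pE]] [p' [ph' pE']]; exists (p + p'); split=> [|w]; first exact: rpredD.
by rewrite mevalD pE pE'.
Qed.

Lemma polyformZ d c G : polyform d G -> polyform d (fun u => c * G u).
Proof.
by move=> [p [ph pE]]; exists (c *: p); split=> [|w]; [exact: rpredZ|rewrite mevalZ pE].
Qed.

Lemma polyformM d d' G G' : polyform d G -> polyform d' G' -> polyform (d + d') (fun u => G u * G' u).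
Proof.
move=> [p [ph pE]] [p' [ph' pE']]; exists (p * p'); split=> [|w]; first exact: dhomogM.
by rewrite mevalM pE pE'.
Qed.

Lemma polyform_sum d (I : finType) (G : I -> U -> K) : (forall i, polyform d (G i)) ->
  polyform d (fun u => \sum_i G i u).
Proof.
move=> /choice[p pP]; exists (\sum_i p i); split=> [|w].
  by apply: rpred_sum => i _; case: (pP i).
by rewrite raddf_sum; apply: eq_bigr => i _; case: (pP i) => _ <-.
Qed.

Lemma polyform_prod d (G : 'I_d -> U -> K) : (forall i, polyform 1 (G i)) ->
  polyform d (fun u => \prod_i G i u).
Proof.
elim: d G => [G _|d IH G hG].
  by exists 1; split=> [|w]; rewrite ?dhomog1 // meval1 big_ord0.
have [p [ph pE]] := polyformM (hG ord0) (IH _ (fun i => hG (lift ord0 i))).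
by exists p; split=> // w; rewrite pE big_ord_recl.
Qed.

End SegreImage.

Lemma prod_blocks (K : comRingType) (d l : nat) (g : nat -> K) :
  \prod_(r < d) \prod_(i < l) g (r * l + i)%N = \prod_(x < d * l) g x.
Proof.
elim: d => [|d IH]; first by rewrite !big_ord0.
by rewrite big_ord_recr /= IH mulSnr big_split_ord.
Qed.

(** * The Zariski closure of the orbit *)

Section Closure.
Variables (K : numFieldType) (n : nat) (A : 'I_n -> 'I_n -> int) (la : 'I_n.-1 -> nat).
Hypothesis hA1 : forall i j k : 'I_n, j = i.+1 :> nat -> k = j.+1 :> nat ->
     A i j + A j k <= A i k.
Hypothesis hA2 : forall i i' j j' : 'I_n, i' = i.+1 :> nat -> j' = j.+1 :> nat ->
     (i.+1 < j)%N -> A i j + A i' j' <= A i j' + A i' j.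
Hypothesis hla : forall k, (0 < la k)%N.
Notation tb := (tbasis la).
Notation ps := (pos la).
Notation U := {ffun tb -> K^o}.
Notation S := (fun k : 'I_n.-1 => @sigma n k.+1 A).
Notation LSA := (LS K la S).
Notation family := (forall k : 'I_n.-1, ext K n k.+1).
Notation multiproj := (forall k : 'I_n.-1, proj (ext K n k.+1)).
Notation degenerate := (@degenerate_flag_variety K n S).
Notation coords := (fun (w : subvs_of LSA) i => coord (vbasis {:subvs_of LSA}) i w).

Lemma exp_action_neq0 c : exp_action A c (vlaS K la S) != 0.
Proof.
by have := ten_orbit_neq0 la hA1 hA2 c; rewrite ten_orbit.
Qed.

Lemma vanishes_atP d (p : {mpoly K[\dim {:subvs_of LSA}]}) (y : proj (subvs_of LSA)) w :
  p \is d.-homog -> w != 0 -> val y = <[w]>%VS -> vanishes_at p y <-> p.@[coords w] = 0.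
Proof.
move=> ph w0 yw; split=> [h|h v]; first by apply: h; rewrite ?yw ?memv_line.
by rewrite yw => /vlineP[z ->] _; rewrite (coords_scale z w ph) h mulr0.
Qed.

(** A form of degree [d] pulls back along the tensor map to a form of multidegree d lambda, to which
    [multiform_vanish] applies. *)
Lemma degenerate_vanishes (x : multiproj) (y : proj (subvs_of LSA)) d p :
  degenerate x -> val y = <[vsproj LSA (ten la (fun k => proj_rep (x k)))]>%VS ->
  p \is d.-homog -> (forall e, Ela A e -> vanishes_at p e) -> vanishes_at p y.
Proof.
move=> xF yE ph pE; have xL v : on_lines v x -> ten la v \in LSA by exact: ten_LS.
have rx := proj_rep_on_lines x.
apply/(vanishes_atP ph _ yE); first exact: vsproj_neq0 (xL _ rx) (ten_rep_neq0 la x).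
pose F (v : family) := p.@[coords (vsproj LSA (ten la v))].
suff FM : multiform (fun k => d * la k)%N F /\ (forall c, F (orbit_fam A c) = 0).
  by case: FM => F1 F2; exact: (multiform_vanish hA1 hA2 F1 F2 xF rx).
split; last first.
  move=> c; rewrite /F ten_orbit // vsvalK.
  have := pE (line (exp_action_neq0 c)) _; rewrite (vanishes_atP ph (exp_action_neq0 c)) //; apply.
  by exists c.
  apply: (@spanned_ext _ _ _ _ _ (fun v => \sum_(m <- msupp p) p@_m * \prod_i coord (vbasis {:subvs_of LSA}) i (vsproj LSA (ten la v)) ^+ m i)).
    by move=> v; rewrite /F mevalE.
  apply: (@spanned_ext _ _ _ _ _ (fun v => \sum_(m <- msupp p | m \in msupp p) p@_m * \prod_i coord (vbasis {:subvs_of LSA}) i (vsproj LSA (ten la v)) ^+ m i)).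
    by move=> v; rewrite [RHS]big_seq.
  apply: spanned_sum => m mp; apply: spannedZ.
  have /dhomogP h := ph; have md : mdeg m = d := h m mp.
  apply: (multiform_eq (mu := fun k => ((\sum_i m i) * la k)%N)) => [k|]; first by rewrite -mdegE md.
  apply: multiform_prod => i; apply: (multiform_linear (f := fun u => coord (vbasis {:subvs_of LSA}) i (vsproj LSA u))).
  by move=> a u1 u2; rewrite !linearP.
Qed.

Section LimitPoint.
Variable y : proj (subvs_of LSA).
Hypothesis hy : forall d p, p \is d.-homog -> (forall e, Ela A e -> vanishes_at p e) -> vanishes_at p y.
Let u : U := vsval (proj_rep y).

Lemma limit_polyform d G : polyform A d G -> (forall c, G (ten la (orbit_fam A c)) = 0) -> G u = 0.
Proof.
move=> [p [ph pE]] G0; rewrite -pE; apply/(vanishes_atP ph (proj_rep_neq0 y) (proj_repP y)).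
apply: (hy ph) => e [c ec]; apply/(vanishes_atP ph (exp_action_neq0 c) ec).
by rewrite pE -ten_orbit.
Qed.

Lemma limit_eq d G G' : polyform A d G -> polyform A d G' ->
  (forall c, G (ten la (orbit_fam A c)) = G' (ten la (orbit_fam A c))) -> G u = G' u.
Proof.
move=> hG hG' e; apply/eqP; rewrite -subr_eq0 -mulN1r; apply/eqP.
apply: (@limit_polyform d (fun u => G u + -1 * G' u)).
  by apply: polyformD => //; exact: polyformZ.
by move=> c; rewrite e mulN1r subrr.
Qed.

Lemma polyform_quad (b b' : tb) : polyform A 2 (fun u : U => u b * u b').
Proof. by apply: (@polyformM _ _ _ _ 1 1); exact: polyform_coord. Qed.

(** The Segre quadrics: on pure tensors, two coordinates may exchange their indices at one
    position. *)
Lemma limit_exchange (b b' : tb) (p : ps) :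
  u b * u b' = u (upd1 b (b' p)) * u (upd1 b' (b p)) :> K.
Proof.
apply: (limit_eq (polyform_quad b b') (polyform_quad _ _)) => c; rewrite /ten.
have e b1 := @ten_upd1 K n la (fun p => orbit_fam A c (tag p)) b1 p (b1 p).
rewrite -{1}(upd1_id b p) -{1}(upd1_id b' p) !ten_upd1 mulrACA [RHS]mulrACA; congr (_ * _).
exact: mulrC.
Qed.

(** Quadrics of the diagonal embedding: two factors with the same [k] are proportional. *)
Lemma limit_sym (b : tb) k (i i' : 'I_(la k)) (t t' : incr n k.+1) :
  u (@upd1 n la b (existT _ k i) t) * u (@upd1 n la b (existT _ k i') t') =
  u (@upd1 n la b (existT _ k i) t') * u (@upd1 n la b (existT _ k i') t) :> K.
Proof.
apply: (limit_eq (polyform_quad _ _) (polyform_quad _ _)) => c; rewrite /ten.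
rewrite !ten_upd1 /= mulrACA [RHS]mulrACA; congr (_ * _); exact: mulrC.
Qed.

Let p0 (k : 'I_n.-1) : ps := existT _ k (Ordinal (hla k)).

Lemma limit_decomp : exists (b0 : tb) (a : K) (v : family),
  [/\ a != 0, u = a *: ten la v & forall k, v k (b0 (p0 k)) = 1].
Proof.
have u0 : u != 0 by apply: contraNneq (proj_rep_neq0 y) => e; apply/eqP/val_inj.
have [b0 b0u] : exists b, u b != 0.
  apply/existsP; apply: contraNT u0; rewrite negb_exists => /forallP h.
  by apply/eqP/ffunP => b; rewrite [RHS]ffunE; exact/eqP/negbNE/h.
(* The candidate factor at [p], normalised to 1 at the index of the nonzero coordinate [b0]. *)
pose w (p : ps) (t : incr n (tag p).+1) : K := u (upd1 b0 t) / u b0.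
have w0 p : w p (b0 p) = 1 by rewrite /w upd1_id divff.
(* Induction on the number of positions where [b] differs from [b0]; one exchange repairs one
   position. *)
have dec b : u b = u b0 * \prod_p w p (b p) :> K.
  have [N] := ubnP #|[pred p | b p != b0 p]|; elim: N b => // N IH b; rewrite ltnS => bN.
  case: (pickP [pred p | b p != b0 p]) => [p /= bp|h]; last first.
    have -> : b = b0 by apply/ffunP => p; apply/eqP; exact: negbFE (h p).
    by rewrite big1 ?mulr1 // => p _; rewrite w0.
  have e := limit_exchange b b0 p.
  have : (#|[pred q | upd1 b (b0 p) q != b0 q]| < N)%N.
    apply: leq_trans bN; apply: proper_card; apply/properP; split.
      apply/fintype.subsetP => q; rewrite !inE; have [->|qp] := eqVneq q p; first by rewrite upd1_in eqxx.
      by rewrite upd1_out.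
    by exists p; rewrite !inE // upd1_in eqxx.
  move=> /IH e1.
  have wu : u (upd1 b0 (b p)) = w p (b p) * u b0 :> K by rewrite /w divfK.
  have P1 : \prod_q w q (upd1 b (b0 p) q) = \prod_(q | q != p) w q (b q).
    rewrite (bigD1 p) //= upd1_in w0 mul1r; apply: eq_bigr => q qp; by rewrite upd1_out.
  have R (x1 x2 x3 : K) : x1 * x2 * (x3 * x1) = x1 * (x3 * x2) * x1 by ring.
  by apply: (mulIf b0u); rewrite e e1 P1 wu [in RHS](bigD1 p).
pose v (k : 'I_n.-1) : ext K n k.+1 := [ffun t => w (p0 k) t : K^o].
(* The ratio of the factor at [p] to the representative factor of the same length. *)
pose C (p : ps) : K := w p (b0 (p0 (tag p))).
have wC p t : w p t = C p * (v (tag p) t : K).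
  case: p t => k i t; rewrite ffunE /C /w /=.
  have := @limit_sym b0 k i (Ordinal (hla k)) t (b0 (p0 k)); rewrite (upd1_id b0 (p0 k)).
  have R (x1 x2 x3 x4 : K) : x4 != 0 -> x1 * x4 = x2 * x3 -> x1 / x4 = x2 / x4 * (x3 / x4).
    by move=> x40 e; rewrite mulrACA -e -mulrA; congr (_ * _); rewrite mulrA divff // mul1r.
  exact: R b0u.
have ua : u = (u b0 * \prod_p C p : K) *: ten la v.
  apply/ffunP => b; rewrite scale_coordE dec -mulrA; congr (_ * _).
  by rewrite tens_coord -big_split; apply: eq_bigr => p _; rewrite wC.
exists b0, (u b0 * \prod_p C p), v; split=> //.
  by apply: contraNneq u0 => a0; rewrite ua a0 scale0r.
by move=> k; rewrite ffunE w0.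
Qed.

Variables (b0 : tb) (a : K) (v : family).
Hypotheses (a0 : a != 0) (ua : u = a *: ten la v) (v1 : forall k, v k (b0 (p0 k)) = 1).

(** The r-th of [d] tableaux of shape lambda into which a tableau of shape [mu] is cut. Missing
    columns are filled with the index at which [v] has coordinate 1. *)
Definition block mu (b : tbasis mu) (r : nat) : tb :=
  [ffun p : ps => if insub (r * la (tag p) + tagged p)%N is Some j
                  then b (existT _ (tag p) (j : 'I_(mu (tag p)))) else b0 (p0 (tag p))].

Lemma ten_block mu (b : tbasis mu) (v' : family) (d : nat) : (forall k, mu k <= d * la k)%N ->
  \prod_(r < d) (ten la v' (block b r) : K) =
  tmon v' b * \prod_k (v' k (b0 (p0 k)) : K) ^+ (d * la k - mu k).
Proof.
move=> le; pose g k (x : nat) : K :=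
  v' k (if insub x is Some j then b (existT _ k (j : 'I_(mu k))) else b0 (p0 k)).
have e r : ten la v' (block b r) = \prod_k \prod_(i < la k) g k (r * la k + i)%N :> K.
  rewrite -[LHS]/(tens _ _) tens_coord -/(tmon v' (block b r)) tmon_prod; apply: eq_bigr => k _.
  by apply: eq_bigr => i _; rewrite ffunE.
transitivity (\prod_(r < d) \prod_k \prod_(i < la k) g k (r * la k + i)%N).
  by apply: eq_bigr => r _; exact: e.
rewrite exchange_big tmon_prod -big_split; apply: eq_bigr => k _ /=.
have cast N N' : N = N' -> \prod_(x < N) g k x = \prod_(x < N') g k x by move=> ->.
rewrite prod_blocks (cast _ _ (esym (subnKC (le k)))) big_split_ord /=; congr (_ * _).
  by apply: eq_bigr => i _; rewrite /g valK.
rewrite -[(d * la k - mu k)%N in RHS]card_ord -prodr_const; apply: eq_bigr => i _.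
by rewrite /g insubN // -leqNgt leq_addr.
Qed.

(** Multiplying [F] by powers of the coordinates equal to 1 at [v] raises its multidegree to d
    lambda, where it becomes a form on [LS]. Since every [la k] is positive, the total degree of
    [mu] is a large enough [d]. *)
Lemma limit_multiform mu F : multiform mu F -> (forall c, F (orbit_fam A c) = 0) -> F v = 0.
Proof.
move=> [kap [_ FE]] F0; pose d := (\sum_k mu k)%N.
have le k : (mu k <= d * la k)%N.
  by apply: leq_trans (leq_pmulr _ (hla k)); rewrite /d (bigD1 k) //= leq_addr.
pose G (u' : U) : K := \sum_b kap b * \prod_(r < d) (u' (block b r) : K).
have GP : polyform A d G.
  apply: polyform_sum => b; apply: polyformZ; apply: polyform_prod => r; exact: polyform_coord.
have GE v' : G (ten la v') = F v' * \prod_k (v' k (b0 (p0 k)) : K) ^+ (d * la k - mu k).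
  rewrite FE mulr_suml; apply: eq_bigr => b _; by rewrite ten_block // mulrA.
have Gu : G u = 0 by apply: (limit_polyform GP) => c; rewrite GE F0 mul0r.
have := GE v; rewrite [X in _ = _ * X]big1 => [|k _]; last by rewrite v1 expr1n.
rewrite mulr1 => <-; have -> : ten la v = a^-1 *: u by rewrite ua scalerA mulVf // scale1r.
by rewrite (polyform_scale _ _ GP) Gu mulr0.
Qed.

Lemma plu_eval_scale (m : 'X_{1..#|plu n|}) (z : 'I_n.-1 -> K) (v' : family) :
  plu_eval 'X_[m] (fun k => z k *: v' k) = (\prod_k z k ^+ multideg m k) * plu_eval 'X_[m] v'.
Proof.
rewrite /plu_eval !mevalX !plu_prodE -big_split; apply: eq_bigr => k _ /=.
rewrite /multideg expr_sum -big_split; apply: eq_bigr => t _.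
by rewrite /plu_var enum_rankK /= scale_coordE exprMn.
Qed.

(* the multihomogeneous components of [q] are separated by the scalings
   [s ^ (B ^ k)] of the factors *)
Lemma limit_degenerate (x : multiproj) : (forall k, val (x k) = <[v k]>%VS) -> degenerate x.
Proof.
move=> xE q qI v' v'x.
pose B := (\sum_(m <- msupp q) \sum_k multideg m k).+1.
have mB m k : m \in msupp q -> (multideg m k < B)%N.
  move=> mq; rewrite ltnS (bigD1_seq m) //= ?msupp_uniq // (bigD1 k) //= -addnA leq_addr.
  by [].
pose code m := (\sum_(k < n.-1) multideg m k * B ^ k)%N.
pose P (w : family) : {poly K} := \sum_(m <- msupp q) (q@_m * plu_eval 'X_[m] w) *: 'X^(code m).
have PE w s : (P w).[s] = plu_eval q (fun k : 'I_n.-1 => s ^+ (B ^ k) *: w k).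
  rewrite horner_sum /plu_eval mevalE; apply: eq_bigr => m _.
  rewrite hornerZ hornerXn -mulrA; congr (_ * _); rewrite -mevalX.
  rewrite -/(plu_eval 'X_[m] w) -/(plu_eval 'X_[m] (fun k : 'I_n.-1 => s ^+ (B ^ k) *: w k)) plu_eval_scale mulrC; congr (_ * _).
  by rewrite /code expr_sum; apply: eq_bigr => k _; rewrite -exprM mulnC.
have coefP w e : (P w)`_e = \sum_(m <- msupp q | (m \in msupp q) && (code m == e)) q@_m * plu_eval 'X_[m] w.
  rewrite coef_sum [LHS]big_seq big_mkcondr /=; apply: eq_bigr => m _; rewrite coefZ coefXn eq_sym.
  by case: eqP; rewrite ?mulr1 ?mulr0.
have /choice[z zP] k : exists z : K, z != 0 /\ v' k = z *: v k.
  have [] := v'x k; rewrite xE => /vlineP[z ->] z0; exists z; split=> //.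
  by apply: contraNneq z0 => ->; rewrite scale0r.
(* Rescaling the factors does not move the multiprojective point, so [q] vanishes for every nonzero
   s, and each coefficient in s vanishes on the orbit. *)
have PO c : P (fun k => z k *: orbit_fam A c k) = 0.
  apply: poly_eq0_away0 => s s0; rewrite PE.
  pose xc : multiproj := fun k => line (orbit_vec_neq0 hA1 hA2 (wt_size k) 0 c).
  have xcF : degenerate xc by apply: (orbit_degenerate hA1 hA2 (c := c)).
  apply: (xcF _ qI) => k; split; first by rewrite !memvZ ?memv_line.
  rewrite !scaler_eq0 !negb_or expf_neq0 //= (proj1 (zP k)) orbit_vec_neq0 //; exact: wt_size.
have vE : v' = (fun k => z k *: v k).
  by apply: functional_extensionality_dep => k; case: (zP k).
have Pv : P v' = 0.
  apply/polyP => e; rewrite coef0 vE.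
  case: (boolP (has (fun m => code m == e) (msupp q))) => [/hasP[m0 m0q /eqP m0e]|/hasPn h]; last first.
    by rewrite coefP big1 // => m /andP[/h /negbTE ->].
  apply: (@limit_multiform (multideg m0) (fun w => (P (fun k => z k *: w k))`_e)) => [|c]; last by rewrite PO coef0.
  apply: (@spanned_ext _ _ _ _ _ (fun w => \sum_(m <- msupp q | (m \in msupp q) && (code m == e))
      q@_m * ((\prod_k z k ^+ multideg m k) * plu_eval 'X_[m] w))).
    by move=> w; rewrite coefP; apply: eq_bigr => m _; rewrite plu_eval_scale.
  apply: spanned_sum => m /andP[mq /eqP me]; do 2 apply: spannedZ.
  (* Equal codes have equal digits in base [B], so all monomials in one coefficient share the
     multidegree of [m0]. *)
  apply: (multiform_eq _ (multiform_monomial K m)) => k.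
  pose dg m' (j : nat) := if insub j is Some k' then multideg m' (k' : 'I_n.-1) else 0%N.
  have dgE m' (k' : 'I_n.-1) : dg m' k' = multideg m' k' by rewrite /dg valK.
  have dgB m' j : m' \in msupp q -> (dg m' j < B)%N.
    by move=> m'q; rewrite /dg; case: insubP => // k' _ _; exact: mB.
  rewrite -!dgE; apply: (@digits_inj n.-1 B (dg m) (dg m0) (fun j _ => dgB m j mq) (fun j _ => dgB m0 j m0q)); last exact: ltn_ord.
  have codeE m' : code m' = (\sum_(k < n.-1) dg m' k * B ^ k)%N by apply: eq_bigr => k' _; rewrite dgE.
  by rewrite -!codeE me m0e.
have -> : plu_eval q v' = (P v').[1].
  rewrite PE; apply: meval_eq => i; by rewrite expr1n scale1r.
by rewrite Pv horner0.
Qed.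

End LimitPoint.

Lemma limit_point (y : proj (subvs_of LSA)) :
  (forall d p, p \is d.-homog -> (forall e, Ela A e -> vanishes_at p e) -> vanishes_at p y) ->
  exists2 x, degenerate x & val y = <[vsproj LSA (ten la (fun k => proj_rep (x k)))]>%VS.
Proof.
move=> hy; have [b0 [a [v [a0 ua v1]]]] := limit_decomp hy.
have v0 k : v k != 0.
  by apply: contra_eq_neq (v1 k) => ->; rewrite ffunE eq_sym oner_neq0.
pose x : multiproj := fun k => line (v0 k).
exists x; first exact: (limit_degenerate hy a0 ua v1).
have /choice[z zP] k : exists z : K, z != 0 /\ proj_rep (x k) = z *: v k.
  have [z z0 e] := vline_neq0 (proj_rep_neq0 (x k)) (esym (proj_repP (x k))).
  by exists z.
have -> : (fun k => proj_rep (x k)) = (fun k => z k *: v k).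
  by apply: functional_extensionality_dep => k; case: (zP k).
have pz0 : \prod_(p : ps) z (tag p) != 0 by apply/prodf_neq0 => p _; case: (zP (tag p)).
rewrite proj_repP ten_scale.
apply: (line_eq (z := a / \prod_(p : ps) z (tag p))); first by rewrite mulf_neq0 ?invr_eq0.
by rewrite -linearZ /= scalerA divfK // -ua vsvalK.
Qed.

Lemma zariski_closure_Ela (iota : multiproj -> proj (subvs_of LSA)) :
  (forall x, degenerate x -> val (iota x) = <[vsproj LSA (ten la (fun k => proj_rep (x k)))]>%VS) ->
  zariski_closure (@Ela K n la S A) = (iota @` [set x | degenerate x])%classic.
Proof.
move=> iotaE; apply/seteqP; split=> [y|y [x xF <-]].
  pose T (p : {mpoly K[\dim {:subvs_of LSA}]}) :=
    (exists d : nat, p \is d.-homog) /\ (forall e, Ela A e -> vanishes_at p e).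
  pose Z (y : proj (subvs_of LSA)) := forall p, T p -> vanishes_at p y.
  move=> ycl; have hy : Z y.
    by apply: ycl; split=> [|e eE p [_]]; [exists T; split=> // p []|exact].
  have [|x xF yE] := @limit_point y; first by move=> d p ph pE; apply: hy; split=> //; exists d.
  by exists x => //; apply: val_inj; rewrite yE iotaE.
move=> _ [[T [homT ->]] ET] p Tp; have [d ph] := homT p Tp.
by apply: (degenerate_vanishes xF (iotaE x xF) ph) => e eE; exact: ET.
Qed.

Lemma proj_incl_segre (x : multiproj) (y : proj (subvs_of LSA)) : degenerate x ->
  val y = <[vsproj LSA (ten la (fun k => proj_rep (x k)))]>%VS -> proj_incl y = segre la x.
Proof.
move=> xF yE; apply: val_inj; rewrite (proj_incl_line yE) vsprojK //.
exact: (ten_LS la hA1 hA2 xF (proj_rep_on_lines x)).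
Qed.

End Closure.

Local Open Scope classical_set_scope.

Theorem theoremA (R : realType) (n : nat) (hn : (2 <= n)%N)
  (A : 'I_n -> 'I_n -> int)
  (hA1 : forall i j k : 'I_n, j = i.+1 :> nat -> k = j.+1 :> nat ->
     A i j + A j k <= A i k)
  (hA2 : forall i i' j j' : 'I_n, i' = i.+1 :> nat -> j' = j.+1 :> nat ->
     (i.+1 < j)%N -> A i j + A i' j' <= A i j' + A i' j)
  (la : 'I_n.-1 -> nat) (hla : forall k, (0 < la k)%N) :
  let S := fun k : 'I_n.-1 => @sigma n k.+1 A in
  exists iota : (forall k : 'I_n.-1, proj (ext R[i] n k.+1)) ->
                proj (subvs_of (LS R[i] la S)),
    [/\ forall x y, degenerate_flag_variety S x ->
          degenerate_flag_variety S y -> iota x = iota y -> x = y,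
        zariski_closure (@Ela R[i] n la S A) =
          iota @` @degenerate_flag_variety R[i] n S &
        forall x, degenerate_flag_variety S x ->
          proj_incl (iota x) = segre la x].
Proof.
move=> S; have [iota iotaE] := ex_segre R[i] la hA1 hA2.
have iota_segre x : degenerate_flag_variety S x -> proj_incl (iota x) = segre la x.
  by move=> xF; apply: (proj_incl_segre hA1 hA2 xF); exact: iotaE.
exists iota; split=> // [x y xF yF e|]; last exact: (zariski_closure_Ela hA1 hA2 hla iotaE).
by apply: (segre_inj hla); rewrite -!iota_segre // e.
Qed.
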